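(* Let $\mathcal Q_1=(0,1)^2$, and for each eigenvalue $\lambda$ of the Dirichlet (resp. Neumann) Laplacian on $\mathcal Q_1$ let $\mathcal N_\lambda^{\mathrm D}=\{(m,n)\in\mathbb N^2: m^2+n^2=\lambda/\pi^2\}$ and $\mathcal N_\lambda^{\mathrm N}=\{(m,n)\in(\mathbb N\cup\{0\})^2: m^2+n^2=\lambda/\pi^2\}$, and define $$u^{\mathrm D}_\lambda(z)=\frac{4}{|\mathcal N^{\mathrm D}_\lambda|^{1/2}}\sum_{(m,n)\in\mathcal N^{\mathrm D}_\lambda}\sin(m\pi z_1)\sin(n\pi z_2),\qquad u^{\mathrm N}_\lambda(z)=\frac{4}{|\mathcal N^{\mathrm N}_\lambda|^{1/2}}\sum_{(m,n)\in\mathcal N^{\mathrm N}_\lambda}\cos(m\pi z_1)\cos(n\pi z_2).$$ Let $\lambda_n$ enumerate the distinct eigenvalues and $u_n=u^{\mathrm{BC}}_{\lambda_n}$ for $\mathrm{BC}\in\{\mathrm D,\mathrm N\}$ fixed. Then there is a subsequence $\{n_j\}$ of density one such that for any $\varphi\in\mathrm{MW}$, any $\varepsilon>0$, any ball $B\subset\mathbb R^2$ and any $k\in\mathbb N$ there exist $J\in\mathbb N$ and a set $M\subset\mathcal Q_1$ of positive measure such that for every $z^0\in M$, $$\Big\|u_{n_J}\Big(z^0+\frac{\cdot}{\sqrt{\lambda_{n_J}}}\Big)-\varphi\Big\|_{C^k(B)}<\varepsilon.$$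
   Context: $\mathrm{MW}=\{\varphi\in C^\infty(\mathbb R^2,\mathbb R):\Delta\varphi+\varphi=0\}$. The eigenvalues of the Dirichlet and Neumann Laplacian on $\mathcal Q_1$ are the numbers $\pi^2(m^2+n^2)$ with $(m,n)$ in $\mathbb N^2$, resp. $(\mathbb N\cup\{0\})^2$; the functions $u^{\mathrm{BC}}_\lambda$ are given by their trigonometric formulas on all of $\mathbb R^2$. *)

(* Defs.v *)
From HB Require Import structures.
From mathcomp Require Import all_boot all_order all_algebra.
From mathcomp Require Import all_classical all_reals all_analysis.
Set Implicit Arguments. Unset Strict Implicit. Unset Printing Implicit Defensive.
Import Order.TTheory GRing.Theory Num.Theory.
Import numFieldNormedType.Exports.
Local Open Scope classical_set_scope.
Local Open Scope ring_scope.

Inductive BC := Dir | Neu.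

Definition admissible (bc : BC) (m n : nat) : bool :=
  if bc is Dir then (0 < m)%N && (0 < n)%N else true.

(* s = lambda / pi^2 is an eigenvalue index, i.e. pi^2 s is a (Dirichlet/Neumann)
   eigenvalue of the Laplacian on (0,1)^2. *)
Definition is_eig (bc : BC) (s : nat) : Prop :=
  exists m n : nat, admissible bc m n /\ (m ^ 2 + n ^ 2)%N = s.

(* N^{BC}_lambda for lambda = pi^2 s  (any solution has m, n <= s). *)
Definition Nset (bc : BC) (s : nat) : {set 'I_s.+1 * 'I_s.+1} :=
  [set p : 'I_s.+1 * 'I_s.+1 | admissible bc p.1 p.2 && ((p.1 : nat) ^ 2 + (p.2 : nat) ^ 2 == s)%N].

Definition u_eig {R : realType} (bc : BC) (s : nat) (x y : R) : R :=
  4 / Num.sqrt (#|Nset bc s|%:R) *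
  \sum_(p in Nset bc s)
     (if bc is Dir then sin ((p.1 : nat)%:R * pi * x) * sin ((p.2 : nat)%:R * pi * y)
      else cos ((p.1 : nat)%:R * pi * x) * cos ((p.2 : nat)%:R * pi * y)).

Definition pd1 {R : realType} (f : R -> R -> R) : R -> R -> R :=
  fun x y => derive1 (fun t => f t y) x.
Definition pd2 {R : realType} (f : R -> R -> R) : R -> R -> R :=
  fun x y => derive1 (fun t => f x t) y.

Definition uncurry2 {R : realType} (f : R -> R -> R) : R * R -> R :=
  fun p => f p.1 p.2.

Fixpoint Ck {R : realType} (k : nat) (f : R -> R -> R) : Prop :=
  continuous (uncurry2 f) /\
  match k with
  | 0 => True
  | k'.+1 =>
      (forall x y : R, derivable (fun t => f t y) x 1) /\
      (forall x y : R, derivable (fun t => f x t) y 1) /\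
      Ck k' (pd1 f) /\ Ck k' (pd2 f)
  end.

Definition smooth {R : realType} (f : R -> R -> R) : Prop := forall k, Ck k f.

Definition MW {R : realType} (phi : R -> R -> R) : Prop :=
  smooth phi /\ forall x y, pd1 (pd1 phi) x y + pd2 (pd2 phi) x y + phi x y = 0.

Fixpoint Dw {R : realType} (w : seq bool) (f : R -> R -> R) : R -> R -> R :=
  match w with
  | [::] => f
  | b :: w' => (if b then pd1 else pd2) (Dw w' f)
  end.

Definition inball {R : realType} (c1 c2 r x y : R) : Prop :=
  (x - c1) ^+ 2 + (y - c2) ^+ 2 < r ^+ 2.

(* ||g||_{C^k(B)} < eps, where ||g||_{C^k(B)} is the supremum over B of all
   partial derivatives of order <= k (the supremum is < eps iff some delta < eps
   bounds all of them, there being finitely many derivatives). *)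
Definition Ck_norm_lt {R : realType} (k : nat) (c1 c2 r : R)
    (g : R -> R -> R) (eps : R) : Prop :=
  exists delta : R, delta < eps /\
    forall w : seq bool, (size w <= k)%N ->
      forall x y : R, inball c1 c2 r x y -> `|Dw w g x y| <= delta.

Definition count_below (ns : nat -> nat) (N : nat) : nat :=
  #|[set i : 'I_N | [exists j : 'I_N, ns j == i]]|.

Definition density_one {R : realType} (ns : nat -> nat) : Prop :=
  (forall i j, (i < j)%N -> (ns i < ns j)%N) /\
  ((fun N : nat => ((count_below ns N)%:R / N%:R : R)) @ \oo --> (1 : R)).

Definition Q1 {R : realType} : set (R * R) :=
  [set p | 0 < p.1 < 1 /\ 0 < p.2 < 1].

(* Main.v *)
(* The density plays no role: for each [phi] a single suitable eigenvalue is produced, and all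
   eigenvalues are kept.

   A solution of [Delta phi + phi = 0] is recovered from its angular Fourier modes by Fejer averages
   over finite rotation groups.  Lowering the order of a mode with [d_x - i d_y] shows that it
   equals that of a multiple of [exp (i x)], up to the case of a rotation invariant solution
   vanishing at the origin, which is zero.  Hence [phi] is a [C^k] limit on balls of finite sums of
   plane waves with unit frequencies.

   To realise such a sum take [lambda = 4 pi^2 D^2 p^a] with [D] odd such that the lattice points of
   norm [D^2] have dense directions, and [p = q * conj q] a large prime in the Gaussian integers.
   The lattice points of norm [D^2 p^a] are the products of a point of norm [D^2] with
   [V_j = q^j conj(q)^(a - j)], [j <= a].  Reduction modulo [q] shows that the coordinates of the
   [V_j], [2 j < a], satisfy no integral relation with small coefficients, so by Kronecker's theorem the
   phases of the blocks attached to the [V_j] can be prescribed by the choice of the base point.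
   A block changes sign under a half-period shift.  By pigeonhole, at least a constant times [a]
   blocks have almost the same angle and signs; about [sqrt a] of these suffice to build the target by
   a quadrature formula in the phases, and the others are arranged to cancel up to a bounded error. *)

Require Import Defs.
From HB Require Import structures.
From mathcomp Require Import all_boot all_order all_algebra.
From mathcomp Require Import all_classical all_reals all_analysis.
From mathcomp Require Import ring lra zify.
Set Implicit Arguments. Unset Strict Implicit. Unset Printing Implicit Defensive.
Import Order.TTheory GRing.Theory Num.Theory.
Import numFieldNormedType.Exports.
Local Open Scope classical_set_scope.
Local Open Scope ring_scope.

(** * Calculus and trigonometry *)

(** The normalisation of [u_eig] divides by the square root of the number of waves. With about [a]
    blocks at hand, about [sqrt a] of them already carry the target; the others, unless made to
    cancel, would swamp it by a factor of the same order. The choices are made in the order target,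
    [D], [a], precision, coefficient bound, [p]. Angles and signs of the blocks depend on [p], so
    [a] must work for every configuration of them: hence the pigeonhole argument. Independence of
    the frequencies holds only for coefficients small compared with [p]: hence a form of Kronecker's
    theorem whose coefficient bound depends only on the number of frequencies and the precision. The
    factor 4 makes all indices even, so that phases are [2 * pi] times integral frequencies. The odd
    exponent [a] keeps lattice points off the axes, so that both boundary conditions see the same
    points, and it pairs each [V_j] with its conjugate [V_(a - j)]. One base point serves all
    derivatives, because its choice uses only bounds that they share. *)

Section RealAnalysis.
Variable R : realType.
Implicit Types (f g : R -> R) (x y t h e d l z : R).

Lemma is_deriveP f x l :
  (forall e, 0 < e -> exists2 d : R, 0 < d &
     forall h, `|h| < d -> `|f (x + h) - f x - h * l| <= e * `|h|) ->
  is_derive x 1 f l.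
Proof.
move=> H.
suff cv : (fun h => h^-1 *: (f (h *: (1 : R) + x) - f x)) @ 0^' --> (l : R).
  by apply: DeriveDef; [apply/cvg_ex; exists l | apply/cvg_lim].
apply/cvgrPdist_le => e e0.
have [d d0 Hd] := H e e0.
near=> h.
have h0 : h != 0 by near: h; exact: nbhs_dnbhs_neq.
have hd : `|h| < d.
  by near: h; exact: dnbhs0_lt.
have := Hd h hd.
have -> : l - h^-1 *: (f (h *: (1 : R) + x) - f x) =
          - (h^-1 * (f (x + h) - f x - h * l)).
  rewrite /GRing.scale /= mulr1 (addrC h x); field; exact: h0.
rewrite normrN normrM normfV => H1.
by rewrite ler_pdivrMl ?normr_gt0// (mulrC _ e).
Unshelve. all: by end_near. Qed.

Lemma mean_value (f df : R -> R) x y : (forall z : R, is_derive z (1 : R) f (df z)) ->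
  exists2 t : R, 0 <= t <= 1 & f y - f x = df (x + t * (y - x)) * (y - x).
Proof.
move=> Hf.
have cf : continuous f.
  by move=> z; apply/differentiable_continuous/derivable1_diffP; case: (Hf z).
have key a b : a < b -> exists2 t : R, 0 <= t <= 1 &
    f b - f a = df (a + t * (b - a)) * (b - a).
  move=> ab; have [c cab ->] := MVT ab (fun z _ => Hf z) (continuous_subspaceT cf).
  move: cab; rewrite in_itv /= => /andP[ac cb].
  have ba : 0 < b - a by rewrite subr_gt0.
  exists ((c - a) / (b - a)).
    apply/andP; split; first by rewrite divr_ge0// subr_ge0 ltW.
    by rewrite ler_pdivrMr// mul1r lerB// ltW.
  by rewrite divfK ?gt_eqF// (addrC a) subrK.
have [xy|yx|<-] := ltgtP x y.
- exact: key.
- have [t /andP[t0 t1] e] := key _ _ yx.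
  exists (1 - t); first by rewrite subr_ge0 t1/= lerBlDr lerDl.
  have -> : x + (1 - t) * (y - x) = y + t * (x - y) by ring.
  rewrite -opprB e; ring.
- by exists 0; rewrite ?lexx ?ler01// !subrr mulr0.
Qed.

Lemma seg_norm_le (x y t B : R) : `|x| <= B -> `|y| <= B -> 0 <= t <= 1 ->
  `|x + t * (y - x)| <= B.
Proof. by rewrite !ler_norml => /andP[? ?] /andP[? ?] /andP[? ?]; nra. Qed.

Lemma nonincr_bound (f df : R -> R) (B x : R) : (forall z : R, is_derive z (1 : R) f (df z)) -> 0 <= x ->
  (forall z, 0 < z -> z <= x -> df z <= B) -> f x <= f 0 + B * x.
Proof.
move=> Hf x0 HB.
have cf : continuous f.
  by move=> z; apply/differentiable_continuous/derivable1_diffP; case: (Hf z).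
have [xp|] := ltP 0 x; last first.
  by move=> x0'; have -> : x = 0 by [apply/eqP; rewrite eq_le x0 x0']; rewrite mulr0 addr0.
have [c cab e] := MVT xp (fun z _ => Hf z) (continuous_subspaceT cf).
move: cab; rewrite in_itv /= => /andP[ac cb].
rewrite -lerBlDl e subr0 ler_wpM2r// HB// ltW//.
Qed.

(* Landau's interpolation: a small function with bounded second derivative has a small derivative. *)
Lemma derive_interp (f df ddf : R -> R) (x h e B : R) : 0 < h ->
  (forall z : R, is_derive z (1 : R) f (df z)) -> (forall z : R, is_derive z (1 : R) df (ddf z)) ->
  `|f x| <= e -> `|f (x + h)| <= e ->
  (forall t, 0 <= t <= 1 -> `|ddf (x + t * h)| <= B) ->
  `|df x| <= 2 * e / h + B * h.
Proof.
move=> h0 Hf Hdf fx fxh HB.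
have [t t01 e1] := mean_value x (x + h) Hf.
have [u u01 e2] := mean_value x (x + t * h) Hdf.
rewrite (addrC x h) addrK in e1.
have e2' : df (x + t * h) - df x = ddf (x + u * t * h) * (t * h).
have E : x + t * h - x = t * h by ring.
  by rewrite e2 E (mulrA u).
have -> : df x = (f (h + x) - f x) / h - ddf (x + u * t * h) * (t * h).
  by rewrite e1 mulfK ?gt_eqF// -e2'; ring.
rewrite (le_trans (ler_normB _ _))// lerD//.
  rewrite normrM normfV (gtr0_norm h0) ler_wpM2r ?invr_ge0 ?(ltW h0)//.
  rewrite (le_trans (ler_normB _ _))// (addrC h x) mulrDl mul1r; exact: lerD.
have [t0 t1] := andP t01; have [u0 u1] := andP u01.
rewrite normrM ler_pM//.
  by apply: HB; rewrite mulr_ge0//= mulr_ile1.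
by rewrite ger0_norm ?mulr_ge0 ?(ltW h0)// ler_piMl// (ltW h0).
Qed.

End RealAnalysis.

Section Trig.
Variable R : realType.
Implicit Types (x y a b d : R) (n : int).

Lemma cosDz x n : cos (x + 2 * pi * n%:~R) = cos x.
Proof.
have P k z : cos (z + 2 * pi * k%:R) = cos z :> R.
  have := periodicn (@cosD2pi R) k z.
  by congr (cos _ = _); rewrite -mulr_natr mulr2n; ring.
case: n => k; first exact: P.
by rewrite -[in RHS](subrK (2 * pi * k.+1%:R) x) P NegzE mulrNz mulrN.
Qed.

Lemma sinDz x n : sin (x + 2 * pi * n%:~R) = sin x.
Proof. by rewrite -!cosBpihalf addrAC cosDz. Qed.

Lemma cos_lip a b : `|cos a - cos b| <= `|a - b|.
Proof.
have [t _ ->] := mean_value b a (fun z => is_derive_cos z).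
by rewrite normrM ler_piMl// normrN sin_max.
Qed.

Lemma sin_lip a b : `|sin a - sin b| <= `|a - b|.
Proof.
have [t _ ->] := mean_value b a (fun z => is_derive_sin z).
by rewrite normrM ler_piMl// cos_max.
Qed.

(** Once full turns are removed, [1 - cos (2 * pi * r / Q)] is twice the square of
    [sin (pi * r / Q)], which is positive for [0 < r < Q]. *)
Lemma cos_eq1_dvd (Q : nat) n : (0 < Q)%N -> cos (2 * pi * n%:~R / Q%:R) = 1 :> R -> (Q%:Z %| n)%Z.
Proof.
move=> Q0; have Qz : Q%:Z != 0 by rewrite eqz_nat -lt0n.
have QR : (Q%:R : R) != 0 by rewrite pnatr_eq0 -lt0n.
rewrite {1}(divz_eq n Q%:Z) -[(n %% Q)%Z]gez0_abs ?modz_ge0//.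
set r := `|(n %% Q)%Z|%N.
have rQ : (r < Q)%N by rewrite -ltz_nat /r gez0_abs ?modz_ge0// ltz_pmod// ltz_nat.
have -> : 2 * pi * ((n %/ Q)%Z * Q + r)%:~R / Q%:R =
   2 * pi * r%:R / Q%:R + 2 * pi * (n %/ Q)%Z%:~R :> R.
  by rewrite rmorphD rmorphM /= -!pmulrn; field.
rewrite cosDz => H.
have [r0|rp] := posnP r.
  by apply/dvdz_mod0P; rewrite -[LHS]gez0_abs ?modz_ge0// -/r r0.
have : 0 < sin (pi * r%:R / Q%:R : R).
  apply: sin_gt0_pi; apply/andP; split.
    by rewrite divr_gt0 ?mulr_gt0 ?pi_gt0 ?ltr0n.
  by rewrite ltr_pdivrMr ?ltr0n// ltr_pM2l ?pi_gt0// ltr_nat.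
have : cos (2 * pi * r%:R / Q%:R : R) = 1 - 2 * sin (pi * r%:R / Q%:R : R) ^+ 2.
  have -> : 2 * pi * r%:R / Q%:R = (pi * r%:R / Q%:R : R) *+ 2 by rewrite mulr2n; field.
  rewrite cos_mulr2n cos2sin2 mulr2n; ring.
rewrite H => e; have /eqP : sin (pi * r%:R / Q%:R : R) ^+ 2 = 0 by lra.
by rewrite sqrf_eq0 => /eqP ->; rewrite ltxx.
Qed.

(** A rotation other than the identity fixes only the origin: the determinant of the rotation minus
    the identity is [2 - 2 * c]. *)
Lemma rot_fixed (c s : R) x y : c ^+ 2 + s ^+ 2 = 1 -> c != 1 ->
  x = c * x - s * y -> y = s * x + c * y -> x = 0.
Proof.
move=> cs c1 e1 e2.
have h1 : (1 - c) * x = - (s * y) by lra.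
have h2 : (1 - c) * y = s * x by lra.
have h3 : 2 - 2 * c = (1 - c) ^+ 2 + s ^+ 2.
  have -> : s ^+ 2 = 1 - c ^+ 2 by rewrite -cs; ring.
  ring.
have : (2 - 2 * c) * x = 0.
  have -> : (2 - 2 * c) * x = (1 - c) * ((1 - c) * x) + s * (s * x) by rewrite h3; ring.
  by rewrite h1 -h2; ring.
by move/eqP; rewrite mulf_eq0 => /orP[/eqP h|/eqP//]; exfalso; move/eqP: c1; apply; lra.
Qed.

Lemma sum_shift (F : R -> R) (Q : nat) a d : F (a + d * Q%:R) = F a ->
  \sum_(0 <= k < Q) F (a + d * k%:R) = \sum_(0 <= k < Q) F (a + d * k%:R + d).
Proof.
case: Q => [|q] FQ; first by rewrite !big_geq.
have -> : \sum_(0 <= k < q.+1) F (a + d * k%:R) =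
    F (a + d * 0%:R) + \sum_(0 <= k < q) F (a + d * k.+1%:R) by rewrite big_nat_recl.
rewrite [RHS]big_nat_recr//= [LHS]addrC; congr (_ + _).
  by apply: eq_bigr => k _; congr F; rewrite -natr1; ring.
have -> : a + d * 0%:R = a by rewrite mulr0n mulr0 addr0.
by rewrite -FQ; congr F; rewrite -natr1; ring.
Qed.

(** Advancing the index by one rotates the vector of cosine and sine sums by [d], yet by periodicity
    it only permutes the terms; [rot_fixed] applies because [d] is not a multiple of [2 * pi]. *)
Lemma sum_cos0 (Q : nat) n a : (0 < Q)%N -> ~~ (Q%:Z %| n)%Z ->
  \sum_(0 <= k < Q) cos (a + 2 * pi * n%:~R / Q%:R * k%:R) = 0 :> R.
Proof.
move=> Q0 nQ; set d := 2 * pi * n%:~R / Q%:R.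
have QR : (Q%:R : R) != 0 by rewrite pnatr_eq0 -lt0n.
have dQ : d * Q%:R = 2 * pi * n%:~R by rewrite /d divfK.
apply: (@rot_fixed (cos d) (sin d) _ (\sum_(0 <= k < Q) sin (a + d * k%:R))).
- exact: cos2Dsin2.
- by apply: contra nQ => /eqP; apply: cos_eq1_dvd.
- rewrite {1}(sum_shift (F := cos)) ?dQ ?cosDz// !mulr_sumr -sumrB.
  by apply: eq_bigr => k _; rewrite cosD; ring.
- rewrite {1}(sum_shift (F := sin)) ?dQ ?sinDz// !mulr_sumr -big_split /=.
  by apply: eq_bigr => k _; rewrite sinD; ring.
Qed.

Lemma sum_cos_dvd (Q : nat) n a : (0 < Q)%N -> (Q%:Z %| n)%Z ->
  \sum_(0 <= k < Q) cos (a + 2 * pi * n%:~R / Q%:R * k%:R) = Q%:R * cos a :> R.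
Proof.
move=> Q0 /dvdzP[q ->].
have QR : (Q%:R : R) != 0 by rewrite pnatr_eq0 -lt0n.
under eq_bigr => k _.
  have -> : a + 2 * pi * (q * Q)%:~R / Q%:R * k%:R = a + 2 * pi * (q * k)%:~R :> R.
    by rewrite !rmorphM /= -!pmulrn; field.
  rewrite cosDz; over.
by rewrite big_const_nat subn0 iter_addr addr0 mulr_natl.
Qed.

End Trig.

(** * Smooth functions of two variables *)

Section Smooth.
Variable R : realType.
Implicit Types (f g : R -> R -> R) (x y z h e t u d : R).

(** Coinduction on the order of differentiation. Each use exhibits a class wide enough to be stable
    under both partial derivatives, which spares formulas for iterated derivatives. *)
Lemma smooth_coind (P : (R -> R -> R) -> Prop) :
  (forall f, P f -> [/\ continuous (uncurry2 f),
     forall x y, derivable (fun t => f t y) x 1,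
     forall x y, derivable (fun t => f x t) y 1, P (pd1 f) & P (pd2 f)]) ->
  forall f, P f -> smooth f.
Proof.
move=> H f Pf k; elim: k f Pf => [|k IHk] f /H[cf d1 d2 P1 P2] /=; first by [].
by split=> //; split=> //; split=> //; split; apply: IHk.
Qed.

Lemma smooth_continuous f : smooth f -> continuous (uncurry2 f).
Proof. by move=> /(_ 0%N)[]. Qed.

Lemma smooth_pd1 f : smooth f -> smooth (pd1 f).
Proof. by move=> sf k; case: (sf k.+1) => _ [_ [_ []]]. Qed.

Lemma smooth_pd2 f : smooth f -> smooth (pd2 f).
Proof. by move=> sf k; case: (sf k.+1) => _ [_ [_ []]]. Qed.

Lemma smooth_derivable1 f x y : smooth f -> derivable (fun t => f t y) x 1.
Proof. by move=> /(_ 1%N)[_ [d1 [d2 _]]]. Qed.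

Lemma smooth_derivable2 f x y : smooth f -> derivable (fun t => f x t) y 1.
Proof. by move=> /(_ 1%N)[_ [d1 [d2 _]]]. Qed.

Lemma is_derive_pd1 f x y : smooth f -> is_derive x 1 (fun t => f t y) (pd1 f x y).
Proof.
by move=> sf; apply: DeriveDef; rewrite ?/pd1 ?derive1E//; apply: smooth_derivable1.
Qed.

Lemma is_derive_pd2 f x y : smooth f -> is_derive y 1 (fun t => f x t) (pd2 f x y).
Proof.
by move=> sf; apply: DeriveDef; rewrite ?/pd2 ?derive1E//; apply: smooth_derivable2.
Qed.

Lemma pd1_eq f f1 : (forall x y, is_derive x 1 (fun t => f t y) (f1 x y)) -> pd1 f = f1.
Proof. by move=> H; apply/funext => x; apply/funext => y; rewrite /pd1 derive1E derive_val. Qed.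

Lemma pd2_eq f f1 : (forall x y, is_derive y 1 (fun t => f x t) (f1 x y)) -> pd2 f = f1.
Proof. by move=> H; apply/funext => x; apply/funext => y; rewrite /pd2 derive1E derive_val. Qed.

Local Opaque pd1 pd2.

Lemma smooth_Dw w f : smooth f -> smooth (Dw w f).
Proof. by move=> sf; elim: w => // -[] w IHw /=; [apply: smooth_pd1 | apply: smooth_pd2]. Qed.

Lemma continuous_eps f x y e : continuous (uncurry2 f) -> 0 < e ->
  exists2 d : R, 0 < d & forall x' y', `|x' - x| < d -> `|y' - y| < d ->
    `|f x' y' - f x y| <= e.
Proof.
move=> cf e0; have /cvgrPdist_le /(_ _ e0) /nbhs_ballP[d /= d0 Hd] := cf (x, y).
exists d => // x' y' hx hy; rewrite distrC.
by apply: (Hd (x', y')); split; rewrite /ball /= distrC.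
Qed.

Lemma chain_rule f (a1 b1 a2 b2 s : R) : smooth f ->
  is_derive s 1 (fun s => f (a1 + b1 * s) (a2 + b2 * s))
    (b1 * pd1 f (a1 + b1 * s) (a2 + b2 * s) + b2 * pd2 f (a1 + b1 * s) (a2 + b2 * s)).
Proof.
move=> sf; apply: is_deriveP => e e0.
set X := a1 + b1 * s; set Y := a2 + b2 * s.
pose M : R := `|b1| + `|b2| + 1.
have M0 : 0 < M by rewrite /M; have := normr_ge0 b1; have := normr_ge0 b2; lra.
have e'0 : 0 < e / M by rewrite divr_gt0.
have [d1 d10 H1] := continuous_eps X Y (smooth_continuous (smooth_pd1 sf)) e'0.
have [d2 d20 H2] := continuous_eps X Y (smooth_continuous (smooth_pd2 sf)) e'0.
pose d : R := Num.min d1 d2.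
have d0 : 0 < d by rewrite /d lt_min d10.
exists (d / M); first by rewrite divr_gt0.
move=> h hd.
have [t t01 e1] := mean_value X (X + b1 * h) (fun z => is_derive_pd1 z (Y + b2 * h) sf).
have [u u01 e2] := mean_value Y (Y + b2 * h) (fun z => is_derive_pd2 X z sf).
rewrite (addrC X (b1 * h)) addrK in e1; rewrite (addrC Y (b2 * h)) addrK in e2.
have -> : a1 + b1 * (s + h) = b1 * h + X by rewrite /X; ring.
have -> : a2 + b2 * (s + h) = b2 * h + Y by rewrite /Y; ring.
have -> : f (b1 * h + X) (b2 * h + Y) - f X Y - h * (b1 * pd1 f X Y + b2 * pd2 f X Y)
  = b1 * h * (pd1 f (X + t * (b1 * h)) (Y + b2 * h) - pd1 f X Y) +
    b2 * h * (pd2 f X (Y + u * (b2 * h)) - pd2 f X Y).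
  rewrite (addrC Y) in e1.
  rewrite -[f (b1 * h + X) _ - _](subrKA (f X (b2 * h + Y))) e1 e2 (addrC Y (b2 * h)); ring.
have small (b v : R) : `|b| <= M -> 0 <= v <= 1 -> `|v * (b * h)| < d.
  move=> bM /andP[v0 v1]; rewrite !normrM (ger0_norm v0).
  have : `|b| * `|h| <= M * `|h| by rewrite ler_wpM2r.
  have : M * `|h| < d by rewrite mulrC -ltr_pdivlMr.
  have := mulr_ge0 (normr_ge0 b) (normr_ge0 h); nra.
have B1 : `|b1| <= M by rewrite /M; have := normr_ge0 b1; have := normr_ge0 b2; lra.
have B2 : `|b2| <= M by rewrite /M; have := normr_ge0 b1; have := normr_ge0 b2; lra.
have dd1 : d <= d1 by rewrite /d ge_min; apply/orP; left.
have dd2 : d <= d2 by rewrite /d ge_min; apply/orP; right.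
have one1 : 0 <= (1 : R) <= 1 by rewrite ler01 lexx.
have K1 : `|pd1 f (X + t * (b1 * h)) (Y + b2 * h) - pd1 f X Y| <= e / M.
  apply: H1.
    by rewrite (addrC X) addrK (lt_le_trans (small _ _ B1 t01)).
  by rewrite (addrC Y) addrK -[b2 * h]mul1r (lt_le_trans (small _ _ B2 one1)).
have K2 : `|pd2 f X (Y + u * (b2 * h)) - pd2 f X Y| <= e / M.
  apply: H2; first by rewrite subrr normr0.
  by rewrite (addrC Y) addrK (lt_le_trans (small _ _ B2 u01)).
rewrite (le_trans (ler_normD _ _))// !normrM.
rewrite [leRHS](_ : _ = M * `|h| * (e / M)); last by field; rewrite gt_eqF.
apply: (@le_trans _ _ ((`|b1| + `|b2|) * `|h| * (e / M))).
  by rewrite !mulrDl lerD// ler_wpM2l// mulr_ge0.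
by apply: (ler_wpM2r (ltW e'0)); apply: ler_wpM2r => //; rewrite /M lerDl ler01.
Qed.

(** The second difference over a square of side [h], evaluated first in [x] and then in [y]. The
    next lemma takes the opposite order, and [schwarz] compares the two values as [h] tends to
    zero. *)
Lemma pd12_mean f x y h : smooth f -> exists2 t : R, 0 <= t <= 1 & exists2 u : R, 0 <= u <= 1 &
  f (x + h) (y + h) - f x (y + h) - (f (x + h) y - f x y) =
  pd2 (pd1 f) (x + t * h) (y + u * h) * h ^+ 2.
Proof.
move=> sf.
have dphi z : is_derive z 1 (fun s => f s (y + h) - f s y) (pd1 f z (y + h) - pd1 f z y).
  by apply: is_deriveB; apply: is_derive_pd1.
have [t t01 e1] := mean_value x (x + h) dphi.
rewrite (addrC x h) addrK in e1.
have [u u01 e2] := mean_value y (y + h) (fun z => is_derive_pd2 (x + t * h) z (smooth_pd1 sf)).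
rewrite (addrC y h) addrK in e2.
exists t => //; exists u => //; rewrite (addrC y h) in e1.
rewrite e2 in e1; move: e1; rewrite (addrC x h) (addrC y h) expr2 => e1.
rewrite mulrA -e1; ring.
Qed.

Lemma pd21_mean f x y h : smooth f -> exists2 t : R, 0 <= t <= 1 & exists2 u : R, 0 <= u <= 1 &
  f (x + h) (y + h) - f x (y + h) - (f (x + h) y - f x y) =
  pd1 (pd2 f) (x + t * h) (y + u * h) * h ^+ 2.
Proof.
move=> sf.
have dphi z : is_derive z 1 (fun s => f (x + h) s - f x s) (pd2 f (x + h) z - pd2 f x z).
  by apply: is_deriveB; apply: is_derive_pd2.
have [u u01 e1] := mean_value y (y + h) dphi.
rewrite (addrC y h) addrK in e1.
have [t t01 e2] := mean_value x (x + h) (fun z => is_derive_pd1 z (y + u * h) (smooth_pd2 sf)).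
rewrite (addrC x h) addrK in e2.
exists t => //; exists u => //; rewrite (addrC x h) in e1.
rewrite e2 in e1; move: e1; rewrite (addrC x h) (addrC y h) expr2 => e1.
rewrite mulrA -e1; ring.
Qed.

Lemma schwarz f : smooth f -> pd1 (pd2 f) = pd2 (pd1 f).
Proof.
move=> sf; apply/funext => x; apply/funext => y.
have c12 := smooth_continuous (smooth_pd2 (smooth_pd1 sf)).
have c21 := smooth_continuous (smooth_pd1 (smooth_pd2 sf)).
apply/eqP; rewrite -subr_eq0 -normr_le0; apply/ler_addgt0Pr => e e0; rewrite add0r.
have e2 : 0 < e / 2 by lra.
have [d1 d10 H1] := continuous_eps x y c12 e2.
have [d2 d20 H2] := continuous_eps x y c21 e2.
pose h : R := Num.min d1 d2 / 2.
have m0 : 0 < Num.min d1 d2 by rewrite lt_min d10.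
have h0 : 0 < h by rewrite /h; lra.
have h1 : h < d1.
  have : Num.min d1 d2 <= d1 by rewrite ge_min lexx.
  rewrite /h; lra.
have h2 : h < d2.
  have : Num.min d1 d2 <= d2 by rewrite ge_min lexx orbT.
  rewrite /h; lra.
have [t /andP[t0 t1] [u /andP[u0 u1] E1]] := pd12_mean x y h sf.
have [t' /andP[t'0 t'1] [u' /andP[u'0 u'1] E2]] := pd21_mean x y h sf.
have {E1 E2} E : pd1 (pd2 f) (x + t' * h) (y + u' * h) = pd2 (pd1 f) (x + t * h) (y + u * h).
  have h20 : h ^+ 2 != 0 by rewrite expf_neq0// lt0r_neq0.
  by move: E1; rewrite E2 => /(mulIf h20).
have small (v : R) : 0 <= v -> v <= 1 -> `|v * h| <= h.
  move=> v0 v1; rewrite ger0_norm; last exact: mulr_ge0 v0 (ltW h0).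
  exact: ler_piMl (ltW h0) v1.
have := H1 (x + t * h) (y + u * h); have := H2 (x + t' * h) (y + u' * h).
have AK (a b : R) : a + b - a = b by ring.
rewrite !AK.
move=> /(_ (le_lt_trans (small _ t'0 t'1) h2) (le_lt_trans (small _ u'0 u'1) h2)).
move=> + /(_ (le_lt_trans (small _ t0 t1) h1) (le_lt_trans (small _ u0 u1) h1)).
move=> A1 A2; rewrite -E in A2; rewrite [X in X <= _]distrC in A2.
have -> : e = e / 2 + e / 2 by field.
have alg (a b c : R) : a - b = - (c - a) - (b - c) by ring.
rewrite (alg _ _ (pd1 (pd2 f) (x + t' * h) (y + u' * h))).
apply: (le_trans (ler_normB _ _)); rewrite normrN; apply: lerD; [exact: A1 | exact: A2].
Qed.

Lemma continuous_bounded f (r : R) : continuous (uncurry2 f) ->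
  exists B, forall x y, `|x| <= r -> `|y| <= r -> `|f x y| <= B.
Proof.
move=> cf; have [r0|r0] := ltP r 0.
  by exists 0 => x y xr; have := le_lt_trans xr r0; rewrite normr_lt0.
pose A := `[(-r), r] `*` `[(-r), r] : set (R * R).
have cA : compact A by apply: compact_setX; exact: segment_compact.
have A0 : A !=set0 by exists (0, 0); split; rewrite /= in_itv /= oppr_le0 r0.
have cn : {within A, continuous (fun p => `|uncurry2 f p|)}.
  apply: continuous_subspaceT => p.
  apply: (@continuous_comp _ _ _ (uncurry2 f) (fun z : R => `|z|)); first exact: cf.
  exact: norm_continuous.
have [c _ Hc] := compact_EVT_max A0 cA cn.
exists `|uncurry2 f c| => x y hx hy; rewrite !ler_norml in hx hy.
apply: (Hc (x, y)); rewrite inE /A /=; split; rewrite /= in_itv /=; [exact: hx | exact: hy].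
Qed.

End Smooth.

Section Calculus.
Variable R : realType.
Implicit Types (f g : R -> R -> R) (x y z t a b c d e u v : R) (w : seq bool).

Local Opaque pd1 pd2.

Definition lin2 a f b g : R -> R -> R := fun x y => a * f x y + b * g x y.

Definition lcomp a b c d f : R -> R -> R := fun x y => f (a * x + b * y) (c * x + d * y).

Definition rotf t f := lcomp (cos t) (- sin t) (sin t) (cos t) f.

Definition pw a b e : R -> R -> R := fun x y => cos (a * x + b * y + e).

Lemma is_derive_lin2 (u v : R -> R) (du dv : R) a b x :
  is_derive x 1 u du -> is_derive x 1 v dv ->
  is_derive x 1 (fun s => a * u s + b * v s) (a * du + b * dv).
Proof.
move=> Hu Hv.
have H1 : is_derive x 1 (fun s => a * u s) (a * du) by exact: (@is_deriveZ _ _ _ u a x 1 du).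
have H2 : is_derive x 1 (fun s => b * v s) (b * dv) by exact: (@is_deriveZ _ _ _ v b x 1 dv).
exact: (@is_deriveD _ _ _ (fun s => a * u s) (fun s => b * v s) x 1 _ _ H1 H2).
Qed.

Lemma pd1_lin2 a f b g : smooth f -> smooth g ->
  pd1 (lin2 a f b g) = lin2 a (pd1 f) b (pd1 g).
Proof.
by move=> sf sg; apply: pd1_eq => x y; apply: is_derive_lin2; apply: is_derive_pd1.
Qed.

Lemma pd2_lin2 a f b g : smooth f -> smooth g ->
  pd2 (lin2 a f b g) = lin2 a (pd2 f) b (pd2 g).
Proof.
by move=> sf sg; apply: pd2_eq => x y; apply: is_derive_lin2; apply: is_derive_pd2.
Qed.

Lemma continuous_lin2 a f b g : continuous (uncurry2 f) -> continuous (uncurry2 g) ->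
  continuous (uncurry2 (lin2 a f b g)).
Proof.
move=> cf cg p; apply: (@continuousD _ _ _ (fun p => a * uncurry2 f p) (fun p => b * uncurry2 g p)).
  apply: (@continuousM _ _ (fun=> a) (uncurry2 f)); [exact: cst_continuous | exact: cf].
apply: (@continuousM _ _ (fun=> b) (uncurry2 g)); [exact: cst_continuous | exact: cg].
Qed.

Lemma smooth_lin2 a f b g : smooth f -> smooth g -> smooth (lin2 a f b g).
Proof.
move=> sf sg; apply: (@smooth_coind _ (fun h => exists f g, [/\ smooth f, smooth g &
   h = lin2 a f b g])); last by exists f, g.
move=> _ {f g sf sg} [f [g [sf sg ->]]]; split.
- by apply: continuous_lin2; apply: smooth_continuous.
- by move=> x y; apply: ex_derive; apply: is_derive_lin2; apply: is_derive_pd1.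
- by move=> x y; apply: ex_derive; apply: is_derive_lin2; apply: is_derive_pd2.
- exists (pd1 f), (pd1 g); split; [exact: smooth_pd1 | exact: smooth_pd1 | exact: pd1_lin2].
- exists (pd2 f), (pd2 g); split; [exact: smooth_pd2 | exact: smooth_pd2 | exact: pd2_lin2].
Qed.

Lemma Dw_lin2 w a f b g : smooth f -> smooth g ->
  Dw w (lin2 a f b g) = lin2 a (Dw w f) b (Dw w g).
Proof.
move=> sf sg; elim: w => // -[] w IHw /=; rewrite IHw.
  by rewrite pd1_lin2//; apply: smooth_Dw.
by rewrite pd2_lin2//; apply: smooth_Dw.
Qed.

Lemma smooth0 : smooth (fun _ _ : R => 0 : R).
Proof.
apply: (@smooth_coind _ (fun h => h = (fun _ _ => 0))) => // _ ->; split.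
- by move=> p; apply: cst_continuous.
- by move=> x y; apply: derivable_cst.
- by move=> x y; apply: derivable_cst.
- by apply: pd1_eq => x y; apply: is_derive_cst.
- by apply: pd2_eq => x y; apply: is_derive_cst.
Qed.

Definition lc (I : Type) (s : seq I) (c : I -> R) (F : I -> R -> R -> R) : R -> R -> R :=
  fun x y => \sum_(i <- s) c i * F i x y.

Lemma lc_nil (I : Type) (c : I -> R) F : lc [::] c F = (fun _ _ => 0).
Proof. by apply/funext => x; apply/funext => y; rewrite /lc big_nil. Qed.

Lemma lc_cons (I : Type) i (s : seq I) (c : I -> R) F :
  lc (i :: s) c F = lin2 (c i) (F i) 1 (lc s c F).
Proof. by apply/funext => x; apply/funext => y; rewrite /lc big_cons /lin2 mul1r. Qed.

Lemma smooth_lc (I : Type) (s : seq I) (c : I -> R) F : (forall i, smooth (F i)) ->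
  smooth (lc s c F).
Proof.
move=> sF; elim: s => [|i s IHs]; first by rewrite lc_nil; apply: smooth0.
by rewrite lc_cons; apply: smooth_lin2.
Qed.

Lemma Dw0 w : Dw w (fun _ _ : R => 0 : R) = (fun _ _ => 0).
Proof.
elim: w => // -[] w /= ->.
  by apply: pd1_eq => x y; apply: is_derive_cst.
by apply: pd2_eq => x y; apply: is_derive_cst.
Qed.

Lemma Dw_lc (I : Type) w (s : seq I) (c : I -> R) F : (forall i, smooth (F i)) ->
  Dw w (lc s c F) = lc s c (fun i => Dw w (F i)).
Proof.
move=> sF; elim: s => [|i s IHs]; first by rewrite !lc_nil Dw0.
by rewrite !lc_cons Dw_lin2 ?IHs//; apply: smooth_lc.
Qed.

Lemma pd1_lc (I : Type) (s : seq I) (c : I -> R) F : (forall i, smooth (F i)) ->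
  pd1 (lc s c F) = lc s c (fun i => pd1 (F i)).
Proof. exact: (@Dw_lc I [:: true]). Qed.

Lemma pd2_lc (I : Type) (s : seq I) (c : I -> R) F : (forall i, smooth (F i)) ->
  pd2 (lc s c F) = lc s c (fun i => pd2 (F i)).
Proof. exact: (@Dw_lc I [:: false]). Qed.

Lemma pd1_lcomp a b c d f : smooth f ->
  pd1 (lcomp a b c d f) = lin2 a (lcomp a b c d (pd1 f)) c (lcomp a b c d (pd2 f)).
Proof.
move=> sf; apply: pd1_eq => x y; rewrite /lcomp /lin2.
have := chain_rule (b * y) a (d * y) c x sf.
by under eq_fun do rewrite (addrC (b * y)) (addrC (d * y)); rewrite (addrC (b * y)) (addrC (d * y)).
Qed.

Lemma pd2_lcomp a b c d f : smooth f ->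
  pd2 (lcomp a b c d f) = lin2 b (lcomp a b c d (pd1 f)) d (lcomp a b c d (pd2 f)).
Proof.
move=> sf; apply: pd2_eq => x y; rewrite /lcomp /lin2.
exact: (chain_rule (a * x) b (c * x) d y sf).
Qed.

Lemma continuous_linear (a b c : R) : continuous (fun p : R * R => a * p.1 + b * p.2 + c).
Proof.
move=> p; apply: (@continuousD _ _ _ (fun p : R * R => a * p.1 + b * p.2) (fun=> c)); last exact: cst_continuous.
apply: (@continuousD _ _ _ (fun p : R * R => a * p.1) (fun p : R * R => b * p.2)).
  apply: (@continuousM _ _ (fun=> a) (fun p : R * R => p.1)); [exact: cst_continuous | exact: cvg_fst].
apply: (@continuousM _ _ (fun=> b) (fun p : R * R => p.2)); [exact: cst_continuous | exact: cvg_snd].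
Qed.

Lemma smooth_lcomp a b c d f : smooth f -> smooth (lcomp a b c d f).
Proof.
move=> sf; apply: (@smooth_coind _ (fun h => exists2 f, smooth f &
   h = lcomp a b c d f)); last by exists f.
move=> _ {f sf} [f sf ->]; split.
- have -> : uncurry2 (lcomp a b c d f) =
    uncurry2 f \o (fun p => (a * p.1 + b * p.2 + 0, c * p.1 + d * p.2 + 0)).
    by apply/funext => p; rewrite /uncurry2 /lcomp /= !addr0.
  move=> p; apply: continuous_comp; last exact: smooth_continuous.
  apply: (@cvg_pair _ _ _ _ (nbhs (a * p.1 + b * p.2 + 0)) (nbhs (c * p.1 + d * p.2 + 0))); exact: continuous_linear.
- move=> x y; have := chain_rule (b * y) a (d * y) c x sf.
  by under eq_fun do rewrite (addrC (b * y)) (addrC (d * y)); move=> ?; apply: ex_derive.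
- by move=> x y; apply: ex_derive; exact: (chain_rule (a * x) b (c * x) d y sf).
- exists (lin2 a (pd1 f) c (pd2 f)); last by rewrite pd1_lcomp.
  by apply: smooth_lin2; [exact: smooth_pd1 | exact: smooth_pd2].
- exists (lin2 b (pd1 f) d (pd2 f)); last by rewrite pd2_lcomp.
  by apply: smooth_lin2; [exact: smooth_pd1 | exact: smooth_pd2].
Qed.

Lemma smooth_rot t f : smooth f -> smooth (rotf t f).
Proof. exact: smooth_lcomp. Qed.

Lemma is_derive_cos_aff a b x : is_derive x 1 (fun s => cos (a * s + b)) (a * cos (a * x + b + pi / 2)).
Proof.
have H : is_derive x 1 (fun s => a * s + b) a.
  have H1 : is_derive x 1 (fun s : R => a * s) (a * 1).
    exact: (@is_deriveZ _ _ _ (id : R -> R) a x 1 1).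
  rewrite mulr1 in H1.
  have := @is_deriveD _ _ _ (fun s : R => a * s) (fun=> b) x 1 a 0 H1 (is_derive_cst _ _ _).
  by rewrite addr0.
rewrite cosDpihalf mulrC.
exact: (@is_derive1_comp _ cos (fun s : R => a * s + b) x _ _ (is_derive_cos _) H).
Qed.

Lemma is_derive_pw1 a b c e x y : is_derive x 1 (fun s => c * pw a b e s y) (c * (a * pw a b (e + pi / 2) x y)).
Proof.
have := is_derive_cos_aff a (b * y + e) x.
under eq_fun do rewrite addrA; rewrite !addrA => H; rewrite /pw addrA.
exact: (@is_deriveZ _ _ _ (fun s : R => cos (a * s + b * y + e)) c x 1 _).
Qed.

Lemma is_derive_pw2 a b c e x y : is_derive y 1 (fun s => c * pw a b e x s) (c * (b * pw a b (e + pi / 2) x y)).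
Proof.
have := is_derive_cos_aff b (a * x + e) y.
under eq_fun do rewrite addrCA addrA; rewrite addrCA !addrA => H; rewrite /pw addrA.
exact: (@is_deriveZ _ _ _ (fun s : R => cos (a * x + b * s + e)) c y 1 _).
Qed.

Lemma smooth_pw a b e : smooth (pw a b e).
Proof.
(* A derivative multiplies a plane wave by a frequency and advances its phase by a quarter turn, so
   the stable class lets both the factor and the phase vary. *)
suff H c : smooth (fun x y => c * pw a b e x y).
  by have := H 1; congr smooth; apply/funext => x; apply/funext => y; rewrite mul1r.
apply: (@smooth_coind _ (fun h => exists c e, h = fun x y => c * pw a b e x y)); last by exists c, e.
move=> _ {c e} [c [e ->]]; split.
- move=> p; apply: (@continuousM _ _ (fun=> c) (uncurry2 (pw a b e))); first exact: cst_continuous.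
  apply: (@continuous_comp _ _ _ (fun p : R * R => a * p.1 + b * p.2 + e) cos); first exact: continuous_linear.
  exact: continuous_cos.
- by move=> x y; apply: ex_derive; exact: is_derive_pw1.
- by move=> x y; apply: ex_derive; exact: is_derive_pw2.
- exists (c * a), (e + pi / 2); apply: pd1_eq => x y; rewrite -mulrA; exact: is_derive_pw1.
- exists (c * b), (e + pi / 2); apply: pd2_eq => x y; rewrite -mulrA; exact: is_derive_pw2.
Qed.

Lemma Dw_pw w a b e : Dw w (pw a b e) =
  fun x y => (\prod_(i <- w) (if i then a else b)) * pw a b (e + (size w)%:R * (pi / 2)) x y.
Proof.
have nE n : e + n.+1%:R * (pi / 2) = e + (n%:R * (pi / 2) + pi / 2) by rewrite -natr1; ring.
elim: w => [|[] w IHw] /=.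
- by apply/funext => x; apply/funext => y; rewrite big_nil mul1r mul0r addr0.
- rewrite IHw; apply: pd1_eq => x y; rewrite big_cons nE addrA.
  rewrite (mulrC a) -mulrA; exact: is_derive_pw1.
- rewrite IHw; apply: pd2_eq => x y; rewrite big_cons nE addrA.
  rewrite (mulrC b) -mulrA; exact: is_derive_pw2.
Qed.

End Calculus.

(** * Angular averages of monochromatic waves *)

Section Rotations.
Variable R : realType.
Implicit Types (f g F : R -> R -> R) (x y z t a b c d e s r B : R) (w : seq bool).

Local Opaque pd1 pd2.

(** Removing the innermost derivative instead of the outermost lets an induction on words replace a
    rotated function by rotations of [pd1 f] and [pd2 f]. *)
Lemma Dw_rcons w (b : bool) f : Dw (rcons w b) f = Dw w ((if b then pd1 else pd2) f).
Proof. by elim: w => //= b' w ->. Qed.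

Lemma lip_of_bound f B r : smooth f ->
  (forall x y, `|x| <= r -> `|y| <= r -> `|pd1 f x y| <= B) ->
  (forall x y, `|x| <= r -> `|y| <= r -> `|pd2 f x y| <= B) ->
  forall x y x' y', `|x| <= r -> `|y| <= r -> `|x'| <= r -> `|y'| <= r ->
  `|f x y - f x' y'| <= B * (`|x - x'| + `|y - y'|).
Proof.
move=> sf H1 H2 x y x' y' xr yr x'r y'r.
have [t t01 e1] := mean_value x' x (fun z => is_derive_pd1 z y sf).
have [u u01 e2] := mean_value y' y (fun z => is_derive_pd2 x' z sf).
rewrite -(subrKA (f x' y)) e1 e2 (le_trans (ler_normD _ _))// [leRHS]mulrDr !normrM.
by apply: lerD; apply: ler_wpM2r => //; [apply: H1 | apply: H2] => //; apply: seg_norm_le.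
Qed.

Lemma smooth_lip f r : smooth f -> exists2 B : R, 0 <= B &
  forall x y x' y', `|x| <= r -> `|y| <= r -> `|x'| <= r -> `|y'| <= r ->
  `|f x y - f x' y'| <= B * (`|x - x'| + `|y - y'|).
Proof.
move=> sf; have [B1 H1] := continuous_bounded r (smooth_continuous (smooth_pd1 sf)).
have [B2 H2] := continuous_bounded r (smooth_continuous (smooth_pd2 sf)).
exists (`|B1| + `|B2|); first exact: addr_ge0.
apply: lip_of_bound => // x y xr yr.
  by rewrite (le_trans (H1 _ _ xr yr))// (le_trans (ler_norm _))// lerDl.
by rewrite (le_trans (H2 _ _ xr yr))// (le_trans (ler_norm _))// lerDr.
Qed.

Lemma pd_rot (b : bool) t f : smooth f -> (if b then pd1 else pd2) (rotf t f) =
  lin2 (if b then cos t else - sin t) (rotf t (pd1 f)) (if b then sin t else cos t) (rotf t (pd2 f)).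
Proof. by case: b => sf; [exact: pd1_lcomp | exact: pd2_lcomp]. Qed.

Lemma rot_range t x y r : `|x| <= r -> `|y| <= r ->
  `|cos t * x + - sin t * y| <= 2 * r /\ `|sin t * x + cos t * y| <= 2 * r.
Proof.
have K a b x' y' : `|a| <= 1 -> `|b| <= 1 -> `|x'| <= r -> `|y'| <= r -> `|a * x' + b * y'| <= 2 * r.
  move=> a1 b1 xr yr; rewrite (le_trans (ler_normD _ _))// !normrM mulrDl mul1r lerD//.
    by rewrite (le_trans _ xr)// ler_piMl.
  by rewrite (le_trans _ yr)// ler_piMl.
by move=> xr yr; split; apply: K => //; rewrite ?normrN ?cos_max ?sin_max.
Qed.

Lemma rot_bounded w f r : smooth f -> exists2 B : R, 0 <= B &
  forall t x y, `|x| <= r -> `|y| <= r -> `|Dw w (rotf t f) x y| <= B.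
Proof.
elim/last_ind: w f => [|w b IHw] f sf /=.
  have [B HB] := continuous_bounded (2 * r) (smooth_continuous sf).
  exists `|B| => // t x y xr yr; have [? ?] := rot_range t xr yr.
  by rewrite (le_trans _ (ler_norm B))//; apply: HB.
have [B1 B10 H1] := IHw _ (smooth_pd1 sf); have [B2 B20 H2] := IHw _ (smooth_pd2 sf).
exists (B1 + B2); first exact: addr_ge0.
move=> t x y xr yr; have sr1 := smooth_rot t (smooth_pd1 sf); have sr2 := smooth_rot t (smooth_pd2 sf).
rewrite Dw_rcons (pd_rot b t sf) (Dw_lin2 _ _ _ sr1 sr2) /lin2 (le_trans (ler_normD _ _))// !normrM lerD//.
  rewrite -[leRHS]mul1r ler_pM//; last exact: H1.
  by case: b => //; rewrite ?normrN ?cos_max ?sin_max.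
rewrite -[leRHS]mul1r ler_pM//; last exact: H2.
by case: b => //; rewrite ?normrN ?cos_max ?sin_max.
Qed.

Lemma rot_lip w f r : smooth f -> exists2 B : R, 0 <= B &
  forall t t' x y, `|x| <= r -> `|y| <= r ->
  `|Dw w (rotf t f) x y - Dw w (rotf t' f) x y| <= B * (`|cos t - cos t'| + `|sin t - sin t'|).
Proof.
elim/last_ind: w f => [|w b IHw] f sf /=.
  have [B B0 HB] := smooth_lip (2 * r) sf.
  exists (B * (2 * `|r|)); first by rewrite mulr_ge0// mulr_ge0.
  move=> t t' x y xr yr; have [X1 Y1] := rot_range t xr yr.
  have [X2 Y2] := rot_range t' xr yr.
  rewrite /rotf /lcomp (le_trans (HB _ _ _ _ X1 Y1 X2 Y2))// -mulrA; apply: ler_wpM2l => //.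
  have xr' := le_trans xr (ler_norm r); have yr' := le_trans yr (ler_norm r).
  set C := cos t - cos t'; set S := sin t - sin t'.
  have -> : cos t * x + - sin t * y - (cos t' * x + - sin t' * y) = C * x - S * y.
    by rewrite /C /S; ring.
  have -> : sin t * x + cos t * y - (sin t' * x + cos t' * y) = S * x + C * y.
    by rewrite /C /S; ring.
  have -> : 2 * `|r| * (`|C| + `|S|) = (`|C| * `|r| + `|S| * `|r|) + (`|S| * `|r| + `|C| * `|r|).
    by ring.
  by apply: lerD; [apply: (le_trans (ler_normB _ _)) | apply: (le_trans (ler_normD _ _))];
    rewrite !normrM; apply: lerD; apply: ler_wpM2l.
have s1 := smooth_pd1 sf; have s2 := smooth_pd2 sf.
have [B1 B10 H1] := IHw _ s1; have [B2 B20 H2] := IHw _ s2.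
have [C1 C10 K1] := rot_bounded w r s1; have [C2 C20 K2] := rot_bounded w r s2.
exists ((B1 + C1) + (B2 + C2)); first by rewrite !addr_ge0.
move=> t t' x y xr yr; rewrite !Dw_rcons !(pd_rot b _ sf) !(Dw_lin2 _ _ _ (smooth_rot _ s1) (smooth_rot _ s2)) /lin2.
have key (al al' X X' Bl Cl D : R) : `|al| <= 1 -> `|al - al'| <= D -> `|X - X'| <= Bl * D ->
    `|X'| <= Cl -> 0 <= D -> `|al * X - al' * X'| <= (Bl + Cl) * D.
  move=> a1 aD XD XC D0; have -> : al * X - al' * X' = al * (X - X') + (al - al') * X' by ring.
  rewrite (le_trans (ler_normD _ _))// !normrM mulrDl lerD//.
    by rewrite (le_trans _ XD)// ler_piMl.
  by rewrite mulrC ler_pM.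
set D := `|cos t - cos t'| + `|sin t - sin t'|.
have D0 : 0 <= D by rewrite addr_ge0.
have Dc : `|cos t - cos t'| <= D by rewrite /D lerDl.
have Ds : `|sin t - sin t'| <= D by rewrite /D lerDr.
have Dn : `|- sin t - - sin t'| <= D by rewrite -opprD normrN.
set P := Dw w (rotf t (pd1 f)) x y; set P' := Dw w (rotf t' (pd1 f)) x y.
set Q := Dw w (rotf t (pd2 f)) x y; set Q' := Dw w (rotf t' (pd2 f)) x y.
have alg (a b' a' b'' : R) : a + b' - (a' + b'') = (a - a') + (b' - b'') by ring.
rewrite alg (le_trans (ler_normD _ _))// [leRHS]mulrDl lerD//.
  apply: key; rewrite ?H1 ?K1//; case: b => //; by rewrite ?normrN ?cos_max ?sin_max.
apply: key; rewrite ?H2 ?K2//; case: b => //; by rewrite ?normrN ?cos_max ?sin_max.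
Qed.

Lemma is_derive_sqr (u : R -> R) (du x : R) : is_derive x 1 u du ->
  is_derive x 1 (fun z => u z ^+ 2) (2 * u x * du).
Proof.
move=> Hu; have H : is_derive x 1 (fun z => u z * u z) (u x * du + u x * du).
  exact: (@is_deriveM _ _ u u x 1 du du).
by apply: (is_derive_eq H); ring.
Qed.

(** If [F] were invariant under all rotations, then [F_yy = F_x / x] on the positive axis, and the
    energy [F_x ^ 2 + F ^ 2] would have derivative [- 2 F_x ^ 2 / x] there; starting from zero it
    would remain zero. Invariance under the single rotation [(c, s)] gives this up to an error
    proportional to [s]. *)
Lemma radial_est F (c s B r : R) : MW F -> F 0 0 = 0 -> lcomp c (- s) s c F = F ->
  c ^+ 2 + s ^+ 2 = 1 -> 0 <= c -> 0 < s -> 1 <= r -> 0 <= B ->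
  (forall w, (size w <= 3)%N -> forall x y, `|x| <= r -> `|y| <= r -> `|Dw w F x y| <= B) ->
  forall x, 0 <= x -> x <= r -> F x 0 ^+ 2 <= (2 * B ^+ 2 + 25 * B ^+ 2 * r ^+ 4) * s * x.
Proof.
move=> [sF mwF] F0 inv cs c0 s0 r1 B0 HB x x0 xr.
have r0 : 0 <= r by apply: le_trans r1.
have s1 : s <= 1 by have := sqr_ge0 c; nra.
have c1 : c <= 1 by have := sqr_ge0 s; nra.
have oc : 1 - c <= s ^+ 2 by nra.
have oc0 : 0 <= 1 - c by lra.
have sF1 := smooth_pd1 sF; have sF2 := smooth_pd2 sF.
have sF22 := smooth_pd2 sF2; have sF11 := smooth_pd1 sF1.
have i1 x' y' : pd1 F x' y' = c * pd1 F (c * x' - s * y') (s * x' + c * y') +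
    s * pd2 F (c * x' - s * y') (s * x' + c * y').
  by rewrite -[in LHS]inv pd1_lcomp// /lin2 /lcomp (mulNr s y').
have i2 x' y' : pd2 F x' y' = - s * pd1 F (c * x' - s * y') (s * x' + c * y') +
    c * pd2 F (c * x' - s * y') (s * x' + c * y').
  by rewrite -[in LHS]inv pd2_lcomp// /lin2 /lcomp (mulNr s y').
(* The gradient at the origin is fixed by a nontrivial rotation. *)
have z0 : pd1 F 0 0 = 0.
  have cn : c != 1.
    apply: contraTneq s0 => c1'; rewrite c1' in cs; rewrite -leNgt.
    have : s ^+ 2 = 0 by lra.
    by move/eqP; rewrite sqrf_eq0 => /eqP ->.
  apply: (@rot_fixed R c (- s) _ (pd2 F 0 0)) => //; first by rewrite sqrrN.
    by have := i1 0 0; rewrite !mulr0 subr0 addr0 mulNr opprK.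
  by have := i2 0 0; rewrite !mulr0 subr0 addr0.
have lip1 := lip_of_bound sF1 (HB [:: true; true] isT) (HB [:: false; true] isT).
have lip2 := lip_of_bound sF2 (HB [:: true; false] isT) (HB [:: false; false] isT).
have lip22 := lip_of_bound sF22 (HB [:: true; false; false] isT) (HB [:: false; false; false] isT).
have b2 := HB [:: false] isT; have b22 := HB [:: false; false] isT.
simpl in lip1, lip2, lip22, b2, b22.
(* The approximate form of [F_yy = F_x / x]: the invariance [i2] at [(z, 0)], expanded to first
   order in [s]. The remainders add up to [B * s ^+ 2 * (1 + 4 * r + 2 * r ^+ 2)], at most
   [7 * B * r ^+ 2 * s ^+ 2] since [1 <= r]; one factor [s] is then divided out. *)
have eta z : 0 <= z -> z <= r -> `|z * pd2 (pd2 F) z 0 - pd1 F z 0| <= 7 * B * r ^+ 2 * s.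
  move=> z0' zr.
  have nz : `|z| <= r by rewrite ger0_norm.
  have n0 : `|0 : R| <= r by rewrite normr0.
  have nX : `|c * z| <= r by rewrite ger0_norm ?mulr_ge0// (le_trans _ zr)// ler_piMl.
  have nY : `|s * z| <= r by rewrite ger0_norm ?mulr_ge0 ?(ltW s0)// (le_trans _ zr)// ler_piMl.
  have [t t01 e1] := mean_value 0 (s * z) (fun v => is_derive_pd2 (c * z) v sF2).
  rewrite subr0 add0r in e1.
  have ntY : `|t * (s * z)| <= r.
    by have := seg_norm_le n0 nY t01; rewrite add0r subr0.
  have := i2 z 0; rewrite !mulr0 subr0 addr0 => E0.
  have L1 := lip1 _ _ _ _ nX nY nz n0; have L2 := lip2 _ _ _ _ nX n0 nz n0.
  have L22 := lip22 _ _ _ _ nX ntY nz n0.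
  have dX : `|c * z - z| <= r * s ^+ 2.
    have -> : c * z - z = - ((1 - c) * z) by ring.
    by rewrite normrN ger0_norm ?mulr_ge0// mulrC ler_pM.
  have s2s : s ^+ 2 <= s by rewrite expr2 ler_piMl// ltW.
  have dX' : `|c * z - z| <= r * s by rewrite (le_trans dX)// ler_wpM2l.
  have dY : `|s * z - 0| <= r * s.
    by rewrite subr0 ger0_norm ?mulr_ge0 ?(ltW s0)// mulrC ler_wpM2r// ltW.
  have dtY : `|t * (s * z) - 0| <= r * s.
    rewrite subr0 normrM (le_trans _ dY)// subr0 ler_piMl//.
    by case/andP: t01 => t0 t1; rewrite ger0_norm.
  rewrite subrr normr0 addr0 in L2.
  have {}L1 : `|pd1 F (c * z) (s * z) - pd1 F z 0| <= 2 * B * r * s.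
    rewrite (le_trans L1)// [leRHS](_ : _ = B * (r * s + r * s)); last by ring.
    by rewrite ler_wpM2l// lerD.
  have {}L22 : `|pd2 (pd2 F) (c * z) (t * (s * z)) - pd2 (pd2 F) z 0| <= 2 * B * r * s.
    rewrite (le_trans L22)// [leRHS](_ : _ = B * (r * s + r * s)); last by ring.
    by rewrite ler_wpM2l// lerD.
  have {}L2 : `|pd2 F (c * z) 0 - pd2 F z 0| <= B * r * s ^+ 2.
    by rewrite (le_trans L2)// -mulrA ler_wpM2l.
  have B2 := b2 _ _ nz n0; have B22 := b22 _ _ nz n0.
  move: e1 E0 L1 L2 L22 B2 B22.
  set A2 := pd2 F (c * z) (s * z); set A1 := pd1 F (c * z) (s * z); set F1 := pd1 F z 0.
  set F2 := pd2 F z 0; set A20 := pd2 F (c * z) 0; set F22 := pd2 (pd2 F) z 0.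
  set A22 := pd2 (pd2 F) _ _ => e1 E0 L1 L2 L22 B2 B22.
  have id : s * (z * F22 - F1) = (1 - c) * F2 - c * (A20 - F2) + s * (A1 - F1)
      - c * (s * z) * (A22 - F22) + (1 - c) * (s * z) * F22.
    have -> : A1 = (c * A2 - F2) / s by rewrite E0; field; rewrite gt_eqF.
    have -> : A2 = A20 + A22 * (s * z) by rewrite -e1; ring.
    by field; rewrite gt_eqF.
  rewrite -(ler_pM2l s0) -[X in X * `|_| <= _](gtr0_norm s0) -normrM id.
  have T1 : `|(1 - c) * F2| <= s ^+ 2 * B by rewrite normrM ger0_norm// ler_pM.
  have T2 : `|c * (A20 - F2)| <= 1 * (B * r * s ^+ 2) by rewrite normrM ger0_norm// ler_pM.
  have T3 : `|s * (A1 - F1)| <= s * (2 * B * r * s) by rewrite normrM gtr0_norm// ler_wpM2l// ltW.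
  have sz0 : 0 <= s * z by rewrite mulr_ge0// ltW.
  have szr : s * z <= s * r by rewrite ler_wpM2l// ltW.
  have T4 : `|c * (s * z) * (A22 - F22)| <= (1 * (s * r)) * (2 * B * r * s).
    rewrite normrM ger0_norm; last exact: mulr_ge0.
    apply: ler_pM => //; first exact: mulr_ge0.
    exact: ler_pM.
  have T5 : `|(1 - c) * (s * z) * F22| <= (s ^+ 2 * (1 * r)) * B.
    rewrite normrM ger0_norm; last exact: mulr_ge0.
    apply: ler_pM => //; first exact: mulr_ge0.
    apply: ler_pM => //; apply: (le_trans szr); exact: ler_wpM2r.
  apply: (@le_trans _ _ (s ^+ 2 * B + 1 * (B * r * s ^+ 2) + s * (2 * B * r * s) +
      (1 * (s * r)) * (2 * B * r * s) + (s ^+ 2 * (1 * r)) * B)).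
    apply: (le_trans (ler_normD _ _)); apply: lerD => //.
    apply: (le_trans (ler_normB _ _)); apply: lerD => //.
    apply: (le_trans (ler_normD _ _)); apply: lerD => //.
    by apply: (le_trans (ler_normB _ _)); apply: lerD.
  have Bs : 0 <= B * s ^+ 2 by rewrite mulr_ge0// sqr_ge0.
  have rr : 0 <= r - 1 by rewrite subr_ge0.
  rewrite -subr_ge0 [leRHS](_ : _ = B * s ^+ 2 * ((r - 1) * (5 * r + 1))); last by ring.
  by apply: mulr_ge0 => //; apply: mulr_ge0 => //; apply: addr_ge0 => //; apply: mulr_ge0.
pose E z := pd1 F z 0 ^+ 2 + F z 0 ^+ 2.
have dE z : is_derive z 1 E (2 * pd1 F z 0 * pd1 (pd1 F) z 0 + 2 * F z 0 * pd1 F z 0).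
  have H1 := is_derive_sqr (is_derive_pd1 z 0 sF1).
  have H2 := is_derive_sqr (is_derive_pd1 z 0 sF).
  exact: (@is_deriveD _ _ _ (fun z => pd1 F z 0 ^+ 2) (fun z => F z 0 ^+ 2) z 1 _ _ H1 H2).
have E00 : E 0 = 0 by rewrite /E z0 F0 expr0n /= addr0.
set K := 2 * B ^+ 2 + 25 * B ^+ 2 * r ^+ 4.
have KB : 0 <= B ^+ 2 by exact: sqr_ge0.
have Kr : 0 <= r ^+ 4 by exact: exprn_ge0.
have K1 : 0 <= B ^+ 2 * r ^+ 4 by exact: mulr_ge0.
suff : E x <= E 0 + K * s * x.
  by rewrite E00 add0r; apply: le_trans; rewrite /E lerDr sqr_ge0.
apply: (nonincr_bound dE x0) => z zp zx.
have zr := le_trans zx xr.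
have := eta z (ltW zp) zr; have := mwF z 0.
have nz : `|z| <= r by rewrite gtr0_norm.
have n0 : `|0 : R| <= r by rewrite normr0.
have B22 := b22 _ _ nz n0.
have := lip1 _ _ _ _ nz n0 n0 n0; rewrite z0 !subr0 normr0 addr0 (gtr0_norm zp).
move: B22.
set F1 := pd1 F z 0; set F11 := pd1 (pd1 F) z 0; set F22 := pd2 (pd2 F) z 0; set F00 := F z 0.
move=> B22 L1 mw et.
have -> : 2 * F1 * F11 + 2 * F00 * F1 = - (2 * (F1 * F22)).
  by have -> : F22 = - (F11 + F00); [lra | ring].
(* For [z <= s] the factor [F1] is at most [B * s], since it vanishes at the origin. For larger [z],
   completing the square gives [- 2 * F1 * (q + F1) <= q ^+ 2 / 2], and dividing by [z] costs only
   one of the two factors [s] of [M ^+ 2]. *)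
have [zs|zs] := leP z s.
  apply: (@le_trans _ _ (2 * B ^+ 2 * s)); last first.
    by rewrite /K ler_wpM2r ?(ltW s0)// lerDl -mulrA mulr_ge0.
  apply: (le_trans (ler_norm _)); rewrite normrN normrM normrM (ger0_norm (ler0n _ 2)).
  rewrite [leRHS](_ : _ = 2 * ((B * s) * B)); last by ring.
  by rewrite ler_wpM2l// ler_pM// (le_trans L1)// ler_wpM2l.
rewrite -(ler_pM2l zp).
apply: (@le_trans _ _ (z * (25 * (B ^+ 2 * r ^+ 4) * s))); last first.
  rewrite ler_wpM2l ?(ltW zp)// ler_wpM2r ?(ltW s0)// /K -mulrA lerDr mulr_ge0//.
set M := 7 * B * r ^+ 2 * s in et.
set q := z * F22 - F1 in et.
have -> : z * - (2 * (F1 * F22)) = - (2 * (F1 * (q + F1))) by rewrite /q; ring.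
have q2 : q ^+ 2 <= M ^+ 2.
  by rewrite -[q ^+ 2](real_normK (num_real q)) lerXn2r ?nnegrE ?(le_trans _ et).
apply: (@le_trans _ _ (M ^+ 2 / 2)).
  apply: (@le_trans _ _ (q ^+ 2 / 2)); last by rewrite ler_wpM2r// invr_ge0.
  rewrite -subr_ge0 [leRHS](_ : _ = 2 * (F1 + q / 2) ^+ 2); last by field.
  by rewrite mulr_ge0// sqr_ge0.
have -> : M ^+ 2 / 2 = (49 / 2) * (B ^+ 2 * r ^+ 4) * s * s by rewrite /M; field.
rewrite [leRHS](_ : _ = 25 * (B ^+ 2 * r ^+ 4) * s * z); last by ring.
apply: ler_pM; rewrite ?(ltW s0) ?(ltW zs)//.
  by rewrite mulr_ge0 ?(ltW s0)// mulr_ge0// divr_ge0.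
by rewrite ler_wpM2r ?(ltW s0)// ler_wpM2r//; lra.
Qed.

End Rotations.

(** * Averages over finite rotation groups *)

Section Averages.
Variable R : realType.
Implicit Types (f g F : R -> R -> R) (x y z t a b c d e s r B : R) (w : seq bool).

Local Opaque pd1 pd2 smooth.

Lemma angle_exists (c s : R) : c ^+ 2 + s ^+ 2 = 1 ->
  exists t, [/\ 0 <= t, t <= 2 * pi, cos t = c & sin t = s].
Proof.
move=> cs; have c1 : -1 <= c <= 1.
  rewrite -ler_norml -(@ler_pXn2r _ 2) ?nnegrE// expr1n real_normK ?num_real//.
  by rewrite -cs lerDl sqr_ge0.
have s2 : s ^+ 2 = 1 - c ^+ 2 by rewrite -cs; ring.
have a0 := acos_ge0 c1; have ap := acos_lepi c1; have p0 := pi_ge0 R.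
have [s0|s0] := leP 0 s.
  exists (acos c); split => //; first by rewrite (le_trans ap)// mulr2n_ge0 || lra.
    by rewrite acosK// in_itv.
  by rewrite sin_acos// -s2 sqrtr_sqr ger0_norm.
exists (2 * pi - acos c); split; [lra | lra | |].
  have -> : 2 * pi - acos c = - acos c + 2 * pi * 1%:~R :> R by rewrite mulr1; ring.
  by rewrite cosDz cosN acosK// in_itv.
have -> : 2 * pi - acos c = - acos c + 2 * pi * 1%:~R :> R by rewrite mulr1; ring.
by rewrite sinDz sinN sin_acos// -s2 sqrtr_sqr ltr0_norm// opprK.
Qed.

Lemma polar x y : exists a t, [/\ 0 <= a, a <= `|x| + `|y|, x = a * cos t & y = a * sin t].
Proof.
pose a := Num.sqrt (x ^+ 2 + y ^+ 2).
have p0 : 0 <= x ^+ 2 + y ^+ 2 by rewrite addr_ge0 ?sqr_ge0.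
have a2 : a ^+ 2 = x ^+ 2 + y ^+ 2 by rewrite sqr_sqrtr.
have a0 : 0 <= a by exact: sqrtr_ge0.
have aub : a <= `|x| + `|y|.
  rewrite -(@ler_pXn2r _ 2) ?nnegrE ?addr_ge0// a2 sqrrD !real_normK ?num_real//.
  by rewrite lerD2r lerDl mulrn_wge0// mulr_ge0.
have [a00|an0] := eqVneq a 0.
  have e0 : x ^+ 2 + y ^+ 2 = 0 by rewrite -a2 a00 expr0n.
  move/eqP: e0; rewrite paddr_eq0 ?sqr_ge0// !sqrf_eq0 => /andP[/eqP-> /eqP->].
  by exists 0, 0; split; rewrite ?mul0r// addr_ge0.
have [t [_ _ ct st]] : exists t, [/\ 0 <= t, t <= 2 * pi, cos t = x / a & sin t = y / a].
  by apply: angle_exists; rewrite !expr_div_n -mulrDl -a2 divff// expf_neq0.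
by exists a, t; split => //; rewrite ?ct ?st mulrC divfK.
Qed.

(** Only finitely many words have length at most [n]. The monotone parameter [B] is a bound on
    derivatives in most uses, but a threshold for the size of the rotation group in [Cn_approx]. *)
Lemma words_bound (P : seq bool -> R -> Prop) :
  (forall w B B', P w B -> B <= B' -> P w B') ->
  (forall w, exists2 B : R, 0 <= B & P w B) ->
  forall n, exists2 B : R, 0 <= B & forall w, (size w <= n)%N -> P w B.
Proof.
move=> mono ex n; elim: n P mono ex => [|n IHn] P mono ex.
  by have [B B0 HB] := ex [::]; exists B => // -[].
have [B B0 HB] := ex [::].
have [B1 B10 H1] := IHn (fun w => P (true :: w)) (fun w => mono (true :: w)) (fun w => ex (true :: w)).
have [B2 B20 H2] := IHn (fun w => P (false :: w)) (fun w => mono (false :: w)) (fun w => ex (false :: w)).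
exists (B + B1 + B2); first by rewrite !addr_ge0.
have L1 : B <= B + B1 + B2 by rewrite -addrA lerDl addr_ge0.
have L2 : B1 <= B + B1 + B2 by rewrite addrAC lerDr addr_ge0.
have L3 : B2 <= B + B1 + B2 by rewrite lerDr addr_ge0.
by move=> [|[] w] /= nw; [exact: mono HB L1 | exact: mono (H1 _ nw) L2 | exact: mono (H2 _ nw) L3].
Qed.

(** Convergence to zero in the usual topology of smooth functions on the plane. *)
Definition tends0 (g : nat -> R -> R -> R) := forall w r e, 0 < e ->
  exists Q0, forall Q, (Q0 <= Q)%N -> forall x y, `|x| <= r -> `|y| <= r -> `|Dw w (g Q) x y| <= e.

Definition loc_bounded (g : nat -> R -> R -> R) := forall w r, exists2 B : R, 0 <= B &
  forall Q x y, `|x| <= r -> `|y| <= r -> `|Dw w (g Q) x y| <= B.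

(** Landau's interpolation, one letter at a time: a first derivative is controlled by the function
    on a square enlarged by 1 and by the bounded second derivatives. *)
Lemma tends0_interp (g : nat -> R -> R -> R) : (forall Q, smooth (g Q)) -> loc_bounded g ->
  (forall r e, 0 < e -> exists Q0, forall Q, (Q0 <= Q)%N -> forall x y,
     `|x| <= r -> `|y| <= r -> `|g Q x y| <= e) -> tends0 g.
Proof.
move=> sg bg g0 w; elim: w => [|b w IHw] r e e0; first exact: g0.
have [B B0 HB] := bg (b :: b :: w) (r + 1).
(* [h <= 1] keeps the displaced point in the larger square. Both terms of [derive_interp] become at
   most [e / 2], the first one thanks to the tolerance [e * h / 4]. *)
pose h := Num.min 1 (e / (2 * (B + 1))).
have B1 : 0 < B + 1 by rewrite ltr_wpDl.
have h0 : 0 < h by rewrite lt_min ltr01 divr_gt0// mulr_gt0.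
have h1 : h <= 1 by rewrite ge_min lexx.
have hB : B * h <= e / 2.
  apply: (@le_trans _ _ ((B + 1) * (e / (2 * (B + 1))))); last first.
    by rewrite [leLHS](_ : _ = e / 2)//; field; rewrite gt_eqF.
  by apply: ler_pM => //; rewrite ?(ltW h0)// ?lerDl// ge_min lexx orbT.
have e'0 : 0 < e * h / 4 by rewrite divr_gt0// mulr_gt0.
have [Q0 HQ] := IHw (r + 1) _ e'0.
exists Q0 => Q QQ0 x y xr yr.
have rr1 : r <= r + 1 by rewrite lerDl.
have xr1 := le_trans xr rr1; have yr1 := le_trans yr rr1.
have shift z u : `|z| <= r -> 0 <= u <= 1 -> `|z + u * h| <= r + 1.
  move=> zr /andP[u0 u1]; rewrite (le_trans (ler_normD _ _))// lerD// ger0_norm.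
    by rewrite mulr_ile1// ltW.
  by rewrite mulr_ge0// ltW.
have one1 : 0 <= (1 : R) <= 1 by rewrite ler01 lexx.
have fin : 2 * (e * h / 4) / h + B * h <= e.
  rewrite [X in X + _](_ : _ = e / 2); last by field; rewrite gt_eqF.
  by rewrite [leRHS](splitr e) lerD2l.
have sw := smooth_Dw w (sg Q).
apply: le_trans fin; case: b HB => HB /=.
- apply: (derive_interp h0 (fun z => is_derive_pd1 z y sw)
    (fun z => is_derive_pd1 z y (smooth_pd1 sw))) => /=.
  + exact: HQ.
  + by apply: HQ => //; rewrite -[h]mul1r; apply: shift.
  + by move=> t t01; apply: HB => //; apply: shift.
- apply: (derive_interp h0 (fun z => is_derive_pd2 x z sw)
    (fun z => is_derive_pd2 x z (smooth_pd2 sw))) => /=.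
  + exact: HQ.
  + by apply: HQ => //; rewrite -[h]mul1r; apply: shift.
  + by move=> t t01; apply: HB => //; apply: shift.
Qed.

Lemma MW_lin2 a f b g : MW f -> MW g -> MW (lin2 a f b g).
Proof.
move=> [sf hf] [sg hg]; split; first exact: smooth_lin2.
move=> x y; rewrite (pd1_lin2 _ _ sf sg) (pd1_lin2 _ _ (smooth_pd1 sf) (smooth_pd1 sg)).
rewrite (pd2_lin2 _ _ sf sg) (pd2_lin2 _ _ (smooth_pd2 sf) (smooth_pd2 sg)).
have alg (f1 f2 f0 g1 g2 g0 : R) : f1 + f2 + f0 = 0 -> g1 + g2 + g0 = 0 ->
    a * f1 + b * g1 + (a * f2 + b * g2) + (a * f0 + b * g0) = 0.
  move=> h1 h2; have -> : a * f1 + b * g1 + (a * f2 + b * g2) + (a * f0 + b * g0) =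
    a * (f1 + f2 + f0) + b * (g1 + g2 + g0) by ring.
  by rewrite h1 h2 !mulr0 addr0.
exact: alg (hf x y) (hg x y).
Qed.

Lemma MW0 : MW (fun _ _ : R => 0 : R).
Proof.
split; first exact: smooth0.
have D0 w : Dw w (fun _ _ : R => 0 : R) = (fun _ _ => 0) by exact: Dw0.
by move=> x y; have := D0 [:: true; true]; have := D0 [:: false; false]; rewrite /= => -> ->; rewrite !addr0.
Qed.

Lemma MW_lc (I : Type) (s : seq I) (c : I -> R) G : (forall i, MW (G i)) -> MW (lc s c G).
Proof.
move=> sF; elim: s => [|i s IHs]; first by rewrite lc_nil; apply: MW0.
by rewrite lc_cons; apply: MW_lin2.
Qed.

Lemma lin2_sum3 f g F x y : lin2 1 (lin2 1 f 1 g) 1 F x y = f x y + g x y + F x y.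
Proof. by rewrite /lin2 !mul1r. Qed.

Lemma MW_pd1 f : MW f -> MW (pd1 f).
Proof.
move=> [sf hf]; split; first exact: smooth_pd1.
have s1 := smooth_pd1 sf; have s2 := smooth_pd2 sf.
have -> : pd2 (pd2 (pd1 f)) = pd1 (pd2 (pd2 f)).
  by rewrite -(schwarz sf); exact: (esym (schwarz s2)).
have z : lin2 1 (lin2 1 (pd1 (pd1 f)) 1 (pd2 (pd2 f))) 1 f = (fun _ _ => 0).
  by apply/funext => x; apply/funext => y; rewrite lin2_sum3; exact: hf.
have E : pd1 (lin2 1 (lin2 1 (pd1 (pd1 f)) 1 (pd2 (pd2 f))) 1 f) = (fun _ _ => 0).
  by rewrite z; exact: (Dw0 _ [:: true]).
have s11 := smooth_pd1 s1; have s22 := smooth_pd2 s2.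
rewrite (pd1_lin2 _ _ (smooth_lin2 _ _ s11 s22) sf) (pd1_lin2 _ _ s11 s22) in E.
by move=> x y; rewrite -lin2_sum3 E.
Qed.

Lemma MW_pd2 f : MW f -> MW (pd2 f).
Proof.
move=> [sf hf]; split; first exact: smooth_pd2.
have s1 := smooth_pd1 sf; have s2 := smooth_pd2 sf.
have -> : pd1 (pd1 (pd2 f)) = pd2 (pd1 (pd1 f)).
  by rewrite (schwarz sf); exact: (schwarz s1).
have z : lin2 1 (lin2 1 (pd1 (pd1 f)) 1 (pd2 (pd2 f))) 1 f = (fun _ _ => 0).
  by apply/funext => x; apply/funext => y; rewrite lin2_sum3; exact: hf.
have E : pd2 (lin2 1 (lin2 1 (pd1 (pd1 f)) 1 (pd2 (pd2 f))) 1 f) = (fun _ _ => 0).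
  by rewrite z; exact: (Dw0 _ [:: false]).
have s11 := smooth_pd1 s1; have s22 := smooth_pd2 s2.
rewrite (pd2_lin2 _ _ (smooth_lin2 _ _ s11 s22) sf) (pd2_lin2 _ _ s11 s22) in E.
by move=> x y; rewrite -lin2_sum3 E.
Qed.

Lemma MW_rotf t f : MW f -> MW (rotf t f).
Proof.
move=> [sf hf]; split; first exact: smooth_rot.
move=> x y; have s1 := smooth_pd1 sf; have s2 := smooth_pd2 sf.
have e1 := @pd1_lcomp R (cos t) (- sin t) (sin t) (cos t).
have e2 := @pd2_lcomp R (cos t) (- sin t) (sin t) (cos t).
have sm g : smooth g -> smooth (lcomp (cos t) (- sin t) (sin t) (cos t) g) by exact: smooth_lcomp.
rewrite /rotf (e1 _ sf) (e2 _ sf) (pd1_lin2 _ _ (sm _ s1) (sm _ s2)) (pd2_lin2 _ _ (sm _ s1) (sm _ s2)).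
rewrite (e1 _ s1) (e1 _ s2) (e2 _ s1) (e2 _ s2) (schwarz sf) /lin2 /lcomp.
set X := _ + _ * y; set Y := sin t * x + _.
have := hf X Y; set f11 := pd1 _ X Y; set f22 := pd2 _ X Y; set f12 := pd2 _ X Y => h.
have -> : f X Y = - f11 - f22 by lra.
have cs := cos2Dsin2 t.
have -> : cos t * (cos t * f11 + sin t * f12) + sin t * (cos t * f12 + sin t * f22) +
  (- sin t * (- sin t * f11 + cos t * f12) + cos t * (- sin t * f12 + cos t * f22)) +
  (- f11 - f22) = (cos t ^+ 2 + sin t ^+ 2 - 1) * (f11 + f22) by ring.
by rewrite cs subrr mul0r.
Qed.

Lemma rotf_add a b f : rotf a (rotf b f) = rotf (a + b) f.
Proof.
apply/funext => x; apply/funext => y; rewrite /rotf /lcomp cosD sinD.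
by congr f; ring.
Qed.

(* [avg Q v f] is a discrete substitute for the average of [f] over rotations, weighted by [v]. *)
Definition tk (Q k : nat) : R := 2 * pi / Q%:R * k%:R.

Definition avg (Q : nat) (v : nat -> R) f :=
  lc (index_iota 0 Q) (fun k => v k / Q%:R) (fun k => rotf (tk Q k) f).

Lemma avg_le (Q : nat) (v X : nat -> R) B : 0 <= B -> (forall k, `|v k| <= 1) ->
  (forall k, `|X k| <= B) -> `|\sum_(0 <= k < Q) v k / Q%:R * X k| <= B.
Proof.
move=> B0 v1 XB; have [->|Q0] := posnP Q; first by rewrite big_geq// normr0.
have QR : 0 < Q%:R :> R by rewrite ltr0n.
apply: (le_trans (ler_norm_sum _ _ _)).
apply: (@le_trans _ _ (\sum_(0 <= k < Q) B / Q%:R)).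
  apply: ler_sum => k _; rewrite !normrM normfV (gtr0_norm QR) mulrAC ler_wpM2r ?invr_ge0 ?(ltW QR)//.
  by rewrite -[leRHS]mul1r ler_pM.
by rewrite sumr_const_nat subn0 -[X in X <= _]mulr_natr divfK// gt_eqF.
Qed.

Lemma smooth_avg Q v f : smooth f -> smooth (avg Q v f).
Proof. by move=> sf; apply: smooth_lc => k; apply: smooth_rot. Qed.

Lemma MW_avg Q v f : MW f -> MW (avg Q v f).
Proof. by move=> mf; apply: MW_lc => k; apply: MW_rotf. Qed.

Lemma avg_bounded (v : nat -> nat -> R) f : smooth f -> (forall Q k, `|v Q k| <= 1) ->
  loc_bounded (fun Q => avg Q (v Q) f).
Proof.
move=> sf v1 w r; have [B B0 HB] := rot_bounded w r sf.
exists B => // Q x y xr yr; rewrite /avg Dw_lc; last by move=> k; apply: smooth_rot.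
by apply: avg_le => // k; apply: HB.
Qed.

Lemma rotf_avg t Q v f : rotf t (avg Q v f) =
  lc (index_iota 0 Q) (fun k => v k / Q%:R) (fun k => rotf (t + tk Q k) f).
Proof.
apply/funext => x; apply/funext => y; apply: eq_bigr => k _.
by rewrite -rotf_add.
Qed.

Lemma avg_invariant Q f : (0 < Q)%N -> rotf (2 * pi / Q%:R) (avg Q (fun=> 1) f) = avg Q (fun=> 1) f.
Proof.
move=> Q0; rewrite rotf_avg; apply/funext => x; apply/funext => y; rewrite /avg /lc.
have := @sum_shift R (fun t => 1 / Q%:R * rotf t f x y) Q 0 (2 * pi / Q%:R).
rewrite /= add0r divfK ?pnatr_eq0 -?lt0n// => H.
transitivity (\sum_(0 <= k < Q) 1 / Q%:R * rotf (0 + 2 * pi / Q%:R * k%:R + 2 * pi / Q%:R) f x y).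
  by apply: eq_bigr => k _; rewrite /tk add0r (addrC (2 * pi / Q%:R)).
rewrite -H; first by apply: eq_bigr => k _; congr (_ * rotf _ f x y); rewrite /tk; exact: add0r.
have := @cosDz R 0 1; have := @sinDz R 0 1; rewrite !add0r mulr1 /rotf /lcomp => -> ->.
by [].
Qed.

(** The average is again a solution, vanishes at the origin and is invariant under the angle
    [2 * pi / Q]. Rotating the given point to the nonnegative first axis brings it under
    [radial_est], whose bound on the square is then of order [1 / Q]. *)
Lemma radial_tends0 f : MW f -> f 0 0 = 0 -> tends0 (fun Q => avg Q (fun=> 1) f).
Proof.
move=> mf f0; have [sf _] := mf.
apply: tends0_interp; first by move=> Q; exact: smooth_avg.
  by apply: avg_bounded => // Q k; rewrite normr1.
(* A point of the square of half-side [r0] has polar radius at most [2 * r0]; the summand 1 serves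
   the hypothesis [1 <= r] of [radial_est]. *)
move=> r0 e e0; pose r := 1 + 2 * `|r0|.
have r1 : 1 <= r by rewrite /r lerDl mulr_ge0.
have rp : 0 <= r by apply: le_trans r1.
have [B B0 HB] : exists2 B : R, 0 <= B & forall w, (size w <= 3)%N ->
    forall t x y, `|x| <= r -> `|y| <= r -> `|Dw w (rotf t f) x y| <= B.
  apply: words_bound; last by move=> w; exact: rot_bounded.
  by move=> w B B' H BB t x y xr yr; apply: le_trans BB; apply: H.
pose K := (2 * B ^+ 2 + 25 * B ^+ 2 * r ^+ 4) * r.
have K0 : 0 <= K.
  apply: mulr_ge0 => //; apply: addr_ge0; first by rewrite mulr_ge0 ?sqr_ge0.
  by rewrite !mulr_ge0 ?sqr_ge0 ?exprn_ge0.
have p0 := pi_gt0 R.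
have [N HN] : exists N : nat, 2 * pi * K / e ^+ 2 <= N%:R.
  exists (Num.truncn (2 * pi * K / e ^+ 2)).+1; apply: ltW; exact: truncnS_gt.
exists (N + 5)%N => Q QN x y xr yr.
have Q5 : (5 <= Q)%N by apply: leq_trans QN; rewrite leq_addl.
have QR : 0 < Q%:R :> R by rewrite ltr0n (leq_trans _ Q5).
have Q4 : 4 <= Q%:R :> R by rewrite ler_nat (leq_trans _ Q5).
set dl := 2 * pi / Q%:R :> R.
have dl0 : 0 < dl by rewrite divr_gt0// mulr_gt0.
have dl2 : dl <= pi / 2.
  rewrite /dl ler_pdivrMr//.
  apply: (@le_trans _ _ (pi / 2 * 4)); last by rewrite ler_wpM2l// divr_ge0// ltW.
  by rewrite [leRHS](_ : _ = 2 * pi)//; field.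
have c0 : 0 <= cos dl.
  by apply: cos_ge0_pihalf; rewrite dl2 andbT (le_trans _ (ltW dl0))// oppr_le0 divr_ge0// ltW.
have s0 : 0 < sin dl.
  apply: sin_gt0_pi; rewrite dl0 (le_lt_trans dl2)//; rewrite ltr_pdivrMr//; lra.
have sd : sin dl <= dl.
  by have := sin_lip dl 0; rewrite sin0 !subr0 (gtr0_norm dl0); apply: le_trans; exact: ler_norm.
have [a [t [a0 aub xa ya]]] := polar x y.
have ar : a <= r.
  apply: (le_trans aub); apply: (@le_trans _ _ (r0 + r0)); first exact: lerD.
  by have := ler_norm r0; rewrite /r; lra.
pose F := rotf t (avg Q (fun=> 1) f).
have FE : F a 0 = avg Q (fun=> 1) f x y.
  by rewrite /F /rotf /lcomp !mulr0 !addr0 (mulrC (cos t)) (mulrC (sin t)) -xa -ya.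
have mF : MW F by apply: MW_rotf; apply: MW_avg.
have F00 : F 0 0 = 0.
  rewrite /F /rotf /lcomp !mulr0 !addr0 /avg /lc big1// => k _.
  by rewrite /rotf /lcomp !mulr0 !addr0 f0 mulr0.
have inv : lcomp (cos dl) (- sin dl) (sin dl) (cos dl) F = F.
  have -> : lcomp (cos dl) (- sin dl) (sin dl) (cos dl) F = rotf dl F by [].
  by rewrite /F rotf_add addrC -rotf_add avg_invariant// (leq_trans _ Q5).
have bF w : (size w <= 3)%N -> forall x y, `|x| <= r -> `|y| <= r -> `|Dw w F x y| <= B.
  move=> w3 x' y' xr' yr'; rewrite /F rotf_avg Dw_lc; last by move=> k; apply: smooth_rot.
  by apply: avg_le => // k; [rewrite normr1 | apply: HB].
have := radial_est mF F00 inv (cos2Dsin2 _) c0 s0 r1 B0 bF a0 ar.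
rewrite FE => H.
rewrite -(@ler_pXn2r _ 2) ?nnegrE ?(ltW e0)// real_normK ?num_real//.
apply: (le_trans H); apply: (@le_trans _ _ (K * dl)).
  rewrite /K; set X := 2 * B ^+ 2 + _.
  have X0 : 0 <= X by rewrite /X addr_ge0// !mulr_ge0 ?sqr_ge0 ?exprn_ge0.
  rewrite -(mulrA X) -(mulrA X); apply: ler_wpM2l => //.
  by rewrite (mulrC _ a); apply: ler_pM => //; rewrite ltW.
rewrite /dl mulrA ler_pdivrMr//.
have NQ : N%:R <= Q%:R :> R by rewrite ler_nat (leq_trans _ QN)// leq_addr.
have := le_trans HN NQ; rewrite ler_pdivrMr ?exprn_gt0//.
by rewrite (mulrC _ (e ^+ 2)) (mulrC K).
Qed.

End Averages.

(** * Angular Fourier modes and plane waves *)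

Section Approximation.
Variable R : realType.
Implicit Types (f g F : R -> R -> R) (x y z t a b c d e r B : R) (w : seq bool).

Local Opaque pd1 pd2 smooth.

(* With [h = f + i g], [Are + i Aim] is the discrete [n]-th angular Fourier mode of [h],
   and [dre + i dim] is [(d_x - i d_y) h]; the latter lowers the order of a mode by one. *)
Definition Cn (n Q : nat) f := avg Q (fun k => cos (n%:R * tk R Q k)) f.
Definition Sn (n Q : nat) f := avg Q (fun k => sin (n%:R * tk R Q k)) f.
Definition Are n Q f g := lin2 1 (Cn n Q f) 1 (Sn n Q g).
Definition Aim n Q f g := lin2 1 (Cn n Q g) (-1) (Sn n Q f).
Definition dre f g := lin2 1 (pd1 f) 1 (pd2 g).
Definition dim f g := lin2 1 (pd1 g) (-1) (pd2 f).

Lemma pd1_avg Q v f x y : smooth f -> pd1 (avg Q v f) x y =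
  \sum_(0 <= k < Q) v k / Q%:R * (cos (tk R Q k) * rotf (tk R Q k) (pd1 f) x y +
     sin (tk R Q k) * rotf (tk R Q k) (pd2 f) x y).
Proof.
move=> sf; rewrite /avg pd1_lc; last by move=> k; apply: smooth_rot.
by apply: eq_bigr => k _; rewrite (pd_rot true _ sf).
Qed.

Lemma pd2_avg Q v f x y : smooth f -> pd2 (avg Q v f) x y =
  \sum_(0 <= k < Q) v k / Q%:R * (- sin (tk R Q k) * rotf (tk R Q k) (pd1 f) x y +
     cos (tk R Q k) * rotf (tk R Q k) (pd2 f) x y).
Proof.
move=> sf; rewrite /avg pd2_lc; last by move=> k; apply: smooth_rot.
by apply: eq_bigr => k _; rewrite (pd_rot false _ sf).
Qed.

Lemma sum_comb_re Q (p1 p2 p3 p4 q1 q2 : nat -> R) :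
  (forall k, p1 k + p2 k + (p3 k - p4 k) = q1 k + q2 k) ->
  1 * (1 * (\sum_(0 <= k < Q) p1 k) + 1 * (\sum_(0 <= k < Q) p2 k)) +
  1 * (1 * (\sum_(0 <= k < Q) p3 k) + -1 * (\sum_(0 <= k < Q) p4 k)) =
  1 * (\sum_(0 <= k < Q) q1 k) + 1 * (\sum_(0 <= k < Q) q2 k).
Proof.
move=> H; rewrite !mul1r mulN1r -sumrN -!big_split /=.
by apply: eq_bigr => k _; rewrite H.
Qed.

Lemma sum_comb_im Q (p1 p2 p3 p4 q1 q2 : nat -> R) :
  (forall k, p1 k - p2 k - (p3 k + p4 k) = q1 k - q2 k) ->
  1 * (1 * (\sum_(0 <= k < Q) p1 k) + -1 * (\sum_(0 <= k < Q) p2 k)) +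
  -1 * (1 * (\sum_(0 <= k < Q) p3 k) + 1 * (\sum_(0 <= k < Q) p4 k)) =
  1 * (\sum_(0 <= k < Q) q1 k) + -1 * (\sum_(0 <= k < Q) q2 k).
Proof.
move=> H; rewrite !mul1r !mulN1r -!sumrN -!big_split /= -sumrN -big_split /=.
by apply: eq_bigr => k _; rewrite H.
Qed.

Lemma cos_predS n t : cos (n%:R * t) = cos (n.+1%:R * t) * cos t + sin (n.+1%:R * t) * sin t.
Proof. by rewrite -cosB; congr cos; rewrite -natr1; ring. Qed.

Lemma sin_predS n t : sin (n%:R * t) = sin (n.+1%:R * t) * cos t - cos (n.+1%:R * t) * sin t.
Proof. by rewrite -sinB; congr sin; rewrite -natr1; ring. Qed.

Lemma smooth_Cn n Q f : smooth f -> smooth (Cn n Q f). Proof. exact: smooth_avg. Qed.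
Lemma smooth_Sn n Q f : smooth f -> smooth (Sn n Q f). Proof. exact: smooth_avg. Qed.

(** Differentiating a function rotated by [t] with [d_x - i d_y] produces a factor [exp (i t)],
    which turns the weight [exp (- i (n + 1) t)] into [exp (- i n t)]. This is the real part;
    [dim_A] is the imaginary part. *)
Lemma dre_A n Q f g : smooth f -> smooth g ->
  dre (Are n.+1 Q f g) (Aim n.+1 Q f g) = Are n Q (dre f g) (dim f g).
Proof.
move=> sf sg; apply/funext => x; apply/funext => y.
rewrite /dre /Are /Aim (pd1_lin2 _ _ (smooth_Cn _ _ sf) (smooth_Sn _ _ sg)).
rewrite (pd2_lin2 _ _ (smooth_Cn _ _ sg) (smooth_Sn _ _ sf)) /lin2.
rewrite (pd1_avg _ _ _ _ sf) (pd1_avg _ _ _ _ sg) (pd2_avg _ _ _ _ sf) (pd2_avg _ _ _ _ sg).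
apply: sum_comb_re => k; rewrite /dim /lin2 /rotf /lcomp (cos_predS n) (sin_predS n).
set X := _ + _ * y; set Y := sin _ * x + _.
move: (pd1 f X Y) (pd2 f X Y) (pd1 g X Y) (pd2 g X Y) => f1 f2 g1 g2; ring.
Qed.

Lemma dim_A n Q f g : smooth f -> smooth g ->
  dim (Are n.+1 Q f g) (Aim n.+1 Q f g) = Aim n Q (dre f g) (dim f g).
Proof.
move=> sf sg; apply/funext => x; apply/funext => y.
rewrite /dim /Are /Aim (pd2_lin2 _ _ (smooth_Cn _ _ sf) (smooth_Sn _ _ sg)).
rewrite (pd1_lin2 _ _ (smooth_Cn _ _ sg) (smooth_Sn _ _ sf)) /lin2.
rewrite (pd1_avg _ _ _ _ sf) (pd1_avg _ _ _ _ sg) (pd2_avg _ _ _ _ sf) (pd2_avg _ _ _ _ sg).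
apply: sum_comb_im => k; rewrite /dre /lin2 /rotf /lcomp (cos_predS n) (sin_predS n).
set X := _ + _ * y; set Y := sin _ * x + _.
move: (pd1 f X Y) (pd2 f X Y) (pd1 g X Y) (pd2 g X Y) => f1 f2 g1 g2; ring.
Qed.

(** The Laplacian is [(d_x + i d_y) (d_x - i d_y)] and acts on [h = f + i g] as [- 1], so [h] is
    recovered by differentiating its lowered function. Convergence can thus climb from order [n]
    back to [n + 1]. *)
Lemma MW_re_dbar f g : MW f -> MW g -> f = lin2 (-1) (pd1 (dre f g)) 1 (pd2 (dim f g)).
Proof.
move=> [sf hf] [sg hg]; apply/funext => x; apply/funext => y.
rewrite /dre /dim (pd1_lin2 _ _ (smooth_pd1 sf) (smooth_pd2 sg)).
rewrite (pd2_lin2 _ _ (smooth_pd1 sg) (smooth_pd2 sf)) (schwarz sg) /lin2.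
have := hf x y; move: (pd1 (pd1 f) x y) (pd2 (pd2 f) x y) (pd2 (pd1 g) x y) (f x y) => p q u v; lra.
Qed.

Lemma MW_im_dbar f g : MW f -> MW g -> g = lin2 (-1) (pd1 (dim f g)) (-1) (pd2 (dre f g)).
Proof.
move=> [sf hf] [sg hg]; apply/funext => x; apply/funext => y.
rewrite /dre /dim (pd1_lin2 _ _ (smooth_pd1 sg) (smooth_pd2 sf)).
rewrite (pd2_lin2 _ _ (smooth_pd1 sf) (smooth_pd2 sg)) (schwarz sf) /lin2.
have := hg x y; move: (pd1 (pd1 g) x y) (pd2 (pd2 g) x y) (pd2 (pd1 f) x y) (g x y) => p q u v; lra.
Qed.

Lemma tends0_lin2 a b (g h : nat -> R -> R -> R) : (forall Q, smooth (g Q)) ->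
  (forall Q, smooth (h Q)) -> tends0 g -> tends0 h -> tends0 (fun Q => lin2 a (g Q) b (h Q)).
Proof.
move=> sg sh tg th w r e e0.
have M0 : 0 < `|a| + `|b| + 1 by rewrite ltr_wpDl// addr_ge0.
have e'0 : 0 < e / (`|a| + `|b| + 1) by rewrite divr_gt0.
have [Q1 H1] := tg w r _ e'0; have [Q2 H2] := th w r _ e'0.
exists (maxn Q1 Q2) => Q; rewrite geq_max => /andP[q1 q2] x y xr yr.
rewrite Dw_lin2// /lin2 (le_trans (ler_normD _ _))// !normrM.
apply: (@le_trans _ _ ((`|a| + `|b|) * (e / (`|a| + `|b| + 1)))).
  by rewrite mulrDl lerD// ler_wpM2l ?H1 ?H2.
by rewrite mulrA ler_pdivrMr// mulrC ler_wpM2l ?(ltW e0)// lerDl.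
Qed.

Lemma tends0_pd (b : bool) (g : nat -> R -> R -> R) : tends0 g ->
  tends0 (fun Q => (if b then pd1 else pd2) (g Q)).
Proof.
move=> tg w r e e0; have [Q0 H] := tg (rcons w b) r e e0.
by exists Q0 => Q QQ x y xr yr; rewrite -Dw_rcons; apply: H.
Qed.

(* [Pe a b + i Qe a b = (a + i b) exp (i x)]. *)
Definition ex := pw (1 : R) 0 0.
Definition ey := pw (1 : R) 0 (- (pi / 2)).
Definition Pe a b := lin2 a ex (- b) ey.
Definition Qe a b := lin2 a ey b ex.

Lemma MW_pw a b e : a ^+ 2 + b ^+ 2 = 1 -> MW (pw a b e).
Proof.
move=> ab; split; first exact: smooth_pw.
move=> x y; have := Dw_pw [:: true; true] a b e; rewrite /= => ->.
have := Dw_pw [:: false; false] a b e; rewrite /= => ->.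
rewrite !big_cons big_nil !mulr1 -mulrDl -!expr2 ab mul1r /pw.
have -> : e + 2 * (pi / 2) = e + pi by field.
by rewrite addrA cosDpi addNr.
Qed.

Lemma MW_ex : MW ex. Proof. by apply: MW_pw; rewrite expr1n expr0n /= addr0. Qed.
Lemma MW_ey : MW ey. Proof. by apply: MW_pw; rewrite expr1n expr0n /= addr0. Qed.

Lemma pd1_ex : pd1 ex = lin2 0 ex (-1) ey.
Proof.
have := Dw_pw [:: true] 1 0 0; rewrite /= -/ex => ->.
apply/funext => x; apply/funext => y; rewrite /lin2 /ex /ey /pw big_cons big_nil.
have -> : 1 * x + 0 * y + (0 + (size [:: true])%:R * (pi / 2)) = x + pi / 2 by rewrite /=; ring.
have -> : 1 * x + 0 * y + - (pi / 2) = x - pi / 2 by ring.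
by rewrite cosDpihalf cosBpihalf; ring.
Qed.

Lemma pd1_ey : pd1 ey = lin2 1 ex 0 ey.
Proof.
have := Dw_pw [:: true] 1 0 (- (pi / 2)); rewrite /= -/ey => ->.
apply/funext => x; apply/funext => y; rewrite /lin2 /ex /ey /pw big_cons big_nil.
have -> : 1 * x + 0 * y + (- (pi / 2) + (size [:: true])%:R * (pi / 2)) = 1 * x + 0 * y + 0.
  by rewrite /=; ring.
ring.
Qed.

Lemma pd2_ex : pd2 ex = (fun _ _ => 0).
Proof.
have := Dw_pw [:: false] 1 0 0; rewrite /= -/ex => ->.
by apply/funext => x; apply/funext => y; rewrite big_cons mul0r mul0r.
Qed.

Lemma pd2_ey : pd2 ey = (fun _ _ => 0).
Proof.
have := Dw_pw [:: false] 1 0 (- (pi / 2)); rewrite /= -/ey => ->.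
by apply/funext => x; apply/funext => y; rewrite big_cons mul0r mul0r.
Qed.

Lemma MW_Pe a b : MW (Pe a b). Proof. exact: MW_lin2 MW_ex MW_ey. Qed.
Lemma MW_Qe a b : MW (Qe a b). Proof. exact: MW_lin2 MW_ey MW_ex. Qed.

Lemma dre_sub a b f g : smooth f -> smooth g ->
  dre (lin2 1 f (-1) (Pe a b)) (lin2 1 g (-1) (Qe a b)) = lin2 1 (dre f g) (-1) (Pe (- b) a).
Proof.
move=> sf sg; have [sP _] := MW_Pe a b; have [sQ _] := MW_Qe a b.
have [sx _] := MW_ex; have [sy _] := MW_ey.
rewrite /dre (pd1_lin2 _ _ sf sP) (pd2_lin2 _ _ sg sQ).
rewrite (pd1_lin2 _ _ sx sy) (pd2_lin2 _ _ sy sx) pd1_ex pd1_ey pd2_ex pd2_ey.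
apply/funext => x; apply/funext => y; rewrite /Pe /lin2.
move: (pd1 f x y) (pd2 g x y) (ex x y) (ey x y) => *; ring.
Qed.

Lemma dim_sub a b f g : smooth f -> smooth g ->
  dim (lin2 1 f (-1) (Pe a b)) (lin2 1 g (-1) (Qe a b)) = lin2 1 (dim f g) (-1) (Qe (- b) a).
Proof.
move=> sf sg; have [sP _] := MW_Pe a b; have [sQ _] := MW_Qe a b.
have [sx _] := MW_ex; have [sy _] := MW_ey.
rewrite /dim (pd1_lin2 _ _ sg sQ) (pd2_lin2 _ _ sf sP).
rewrite (pd1_lin2 _ _ sy sx) (pd2_lin2 _ _ sx sy) pd1_ex pd1_ey pd2_ex pd2_ey.
apply/funext => x; apply/funext => y; rewrite /Qe /lin2.
move: (pd1 g x y) (pd2 f x y) (ex x y) (ey x y) => *; ring.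
Qed.

(* A Fourier mode in the angle of a monochromatic wave is determined up to a scalar:
   it is that of a multiple of [exp (i x)]. *)
Lemma mode_tends0 n f g : MW f -> MW g -> exists a b,
  tends0 (fun Q => Are n Q (lin2 1 f (-1) (Pe a b)) (lin2 1 g (-1) (Qe a b))) /\
  tends0 (fun Q => Aim n Q (lin2 1 f (-1) (Pe a b)) (lin2 1 g (-1) (Qe a b))).
Proof.
elim: n f g => [|n IHn] f g mf mg.
  have e00 : ex 0 0 = 1 by rewrite /ex /pw !mulr0 !addr0 cos0.
  have ey0 : ey 0 0 = 0 by rewrite /ey /pw !mulr0 !add0r cosN cos_pihalf.
  (* [exp (i x)] equals 1 at the origin, so subtracting this multiple makes both parts vanish there
     and [radial_tends0] applies. *)
  exists (f 0 0), (g 0 0).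
  have A h h' Q : Are 0 Q h h' = avg Q (fun=> 1) h.
    apply/funext => x; apply/funext => y; rewrite /Are /lin2 mul1r mul1r.
    rewrite [X in _ + X](_ : _ = 0) ?addr0; last first.
      by apply: big1 => k _; rewrite mul0r sin0 mul0r mul0r.
    by apply: eq_bigr => k _; rewrite mul0r cos0.
  have A' h h' Q : Aim 0 Q h h' = avg Q (fun=> 1) h'.
    apply/funext => x; apply/funext => y; rewrite /Aim /lin2 mul1r.
    rewrite [X in _ + _ * X](_ : _ = 0) ?mulr0 ?addr0; last first.
      by apply: big1 => k _; rewrite mul0r sin0 mul0r mul0r.
    by apply: eq_bigr => k _; rewrite mul0r cos0.
  split.
    under eq_fun do rewrite A; apply: radial_tends0; first exact: MW_lin2 mf (MW_Pe _ _).
    by rewrite /Pe /lin2 e00 ey0; ring.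
  under eq_fun do rewrite A'; apply: radial_tends0; first exact: MW_lin2 mg (MW_Qe _ _).
  by rewrite /Qe /lin2 e00 ey0; ring.
have [sf _] := mf; have [sg _] := mg.
have mdre : MW (dre f g) by apply: MW_lin2; [exact: MW_pd1 | exact: MW_pd2].
have mdim : MW (dim f g) by apply: MW_lin2; [exact: MW_pd1 | exact: MW_pd2].
have [a' [b' [H1 H2]]] := IHn _ _ mdre mdim.
(* [d_x - i d_y] multiplies [exp (i x)] by [i], so the coefficient at order [n + 1] is [a' + i b']
   divided by [i]. *)
exists b', (- a').
set f' := lin2 1 f (-1) (Pe b' (- a')); set g' := lin2 1 g (-1) (Qe b' (- a')).
have mf' : MW f' by exact: MW_lin2 mf (MW_Pe _ _).
have mg' : MW g' by exact: MW_lin2 mg (MW_Qe _ _).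
have [sf' _] := mf'; have [sg' _] := mg'.
have D1 : dre f' g' = lin2 1 (dre f g) (-1) (Pe a' b') by rewrite dre_sub// opprK.
have D2 : dim f' g' = lin2 1 (dim f g) (-1) (Qe a' b') by rewrite dim_sub// opprK.
rewrite -D1 -D2 in H1 H2.
have mA Q : MW (Are n.+1 Q f' g') by apply: MW_lin2; apply: MW_avg.
have mB Q : MW (Aim n.+1 Q f' g') by apply: MW_lin2; apply: MW_avg.
have sd1 : smooth (dre f' g') by apply: smooth_lin2; [exact: smooth_pd1 | exact: smooth_pd2].
have sd2 : smooth (dim f' g') by apply: smooth_lin2; [exact: smooth_pd1 | exact: smooth_pd2].
have sA Q : smooth (Are n Q (dre f' g') (dim f' g')) by apply: smooth_lin2; apply: smooth_avg.
have sB Q : smooth (Aim n Q (dre f' g') (dim f' g')) by apply: smooth_lin2; apply: smooth_avg.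
split.
  have E Q : Are n.+1 Q f' g' = lin2 (-1) (pd1 (Are n Q (dre f' g') (dim f' g')))
      1 (pd2 (Aim n Q (dre f' g') (dim f' g'))).
    by rewrite -(dre_A _ _ sf' sg') -(dim_A _ _ sf' sg'); apply: MW_re_dbar.
  under eq_fun do rewrite E.
  apply: tends0_lin2; [by move=> Q; exact: smooth_pd1 | by move=> Q; exact: smooth_pd2 | |].
    exact: (tends0_pd true H1).
  exact: (tends0_pd false H2).
have E Q : Aim n.+1 Q f' g' = lin2 (-1) (pd1 (Aim n Q (dre f' g') (dim f' g')))
    (-1) (pd2 (Are n Q (dre f' g') (dim f' g'))).
  by rewrite -(dre_A _ _ sf' sg') -(dim_A _ _ sf' sg'); apply: MW_im_dbar.
under eq_fun do rewrite E.
apply: tends0_lin2; [by move=> Q; exact: smooth_pd1 | by move=> Q; exact: smooth_pd2 | |].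
  exact: (tends0_pd true H2).
exact: (tends0_pd false H1).
Qed.

(** An entry is [(coefficient, (a, b, phase))]; the same encoding is used for the target [tg]
    further on. *)
Definition pws (s : seq (R * (R * R * R))) : R -> R -> R :=
  lc s fst (fun p => pw p.2.1.1 p.2.1.2 p.2.2).

Definition PWS h := exists2 s : seq (R * (R * R * R)),
  (forall p, p \in s -> p.2.1.1 ^+ 2 + p.2.1.2 ^+ 2 = 1) & h = pws s.

Lemma smooth_pws s : smooth (pws s).
Proof. by apply: smooth_lc => p; apply: smooth_pw. Qed.

Lemma smooth_PWS h : PWS h -> smooth h.
Proof. by case=> s _ ->; apply: smooth_pws. Qed.

Lemma PWS0 : PWS (fun _ _ => 0).
Proof. by exists [::] => //; rewrite /pws lc_nil. Qed.

Lemma PWS_pw a b e : a ^+ 2 + b ^+ 2 = 1 -> PWS (pw a b e).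
Proof.
move=> ab; exists [:: (1, (a, b, e))]; first by move=> p; rewrite inE => /eqP ->.
by apply/funext => x; apply/funext => y; rewrite /pws /lc big_seq1 mul1r.
Qed.

Lemma PWS_lin2 a f b g : PWS f -> PWS g -> PWS (lin2 a f b g).
Proof.
case=> s hs ->; case=> s' hs' ->.
exists ([seq (a * p.1, p.2) | p <- s] ++ [seq (b * p.1, p.2) | p <- s']).
  by move=> p; rewrite mem_cat => /orP[] /mapP[q qs ->] /=; [exact: hs | exact: hs'].
apply/funext => x; apply/funext => y; rewrite /lin2 /pws /lc big_cat !big_map !mulr_sumr.
by congr (_ + _); apply: eq_bigr => p _; rewrite mulrA.
Qed.

Lemma PWS_lc (I : Type) (s : seq I) (c : I -> R) G : (forall i, PWS (G i)) -> PWS (lc s c G).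
Proof.
move=> sF; elim: s => [|i s IHs]; first by rewrite lc_nil; apply: PWS0.
by rewrite lc_cons; apply: PWS_lin2.
Qed.

Lemma PWS_rotf t f : PWS f -> PWS (rotf t f).
Proof.
case=> s hs ->.
have -> : rotf t (pws s) = lc s fst (fun p => rotf t (pw p.2.1.1 p.2.1.2 p.2.2)) by [].
exists [seq (p.1, (p.2.1.1 * cos t + p.2.1.2 * sin t, - (p.2.1.1 * sin t) + p.2.1.2 * cos t, p.2.2)) | p <- s].
  move=> p /mapP[q qs ->] /=.
  rewrite -[RHS](hs _ qs); set a := q.2.1.1; set b := q.2.1.2.
  transitivity ((a ^+ 2 + b ^+ 2) * (cos t ^+ 2 + sin t ^+ 2)); first by ring.
  by rewrite cos2Dsin2 mulr1.
apply/funext => x; apply/funext => y; rewrite /pws /lc big_map.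
by apply: eq_bigr => p _; congr (_ * cos _) => /=; ring.
Qed.

Lemma PWS_avg Q v f : PWS f -> PWS (avg Q v f).
Proof. by move=> pf; apply: PWS_lc => k; apply: PWS_rotf. Qed.

Lemma Cn_approx n f k r e : MW f -> 0 < e -> exists Q0, forall Q, (Q0 <= Q)%N ->
  exists2 h, PWS h & forall w, (size w <= k)%N -> forall x y, `|x| <= r -> `|y| <= r ->
    `|Dw w h x y - Dw w (Cn n Q f) x y| <= e.
Proof.
move=> mf e0; have [a [b [H _]]] := mode_tends0 n mf (@MW0 R).
have [B _ HB] : exists2 B : R, 0 <= B & forall w, (size w <= k)%N ->
    forall Q : nat, B <= Q%:R -> forall x y, `|x| <= r -> `|y| <= r ->
    `|Dw w (Are n Q (lin2 1 f (-1) (Pe a b)) (lin2 1 (fun _ _ => 0) (-1) (Qe a b))) x y| <= e.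
  apply: words_bound.
    by move=> w B B' HB BB Q BQ x y; apply: HB; apply: le_trans BQ.
  move=> w; have [Q0 H0] := H w r e e0.
  by exists Q0%:R => // Q; rewrite ler_nat => /H0.
exists (Num.truncn B).+1 => Q QB.
have {}QB : B <= Q%:R by rewrite ltW// (lt_le_trans (truncnS_gt B))// ler_nat.
have pP : PWS (Pe a b).
  by apply: PWS_lin2; apply: PWS_pw; rewrite expr1n expr0n /= addr0.
have pQ : PWS (Qe a b).
  by apply: PWS_lin2; apply: PWS_pw; rewrite expr1n expr0n /= addr0.
have pP' : PWS (Cn n Q (Pe a b)) by exact: PWS_avg.
have pQ' : PWS (Sn n Q (Qe a b)) by exact: PWS_avg.
exists (lin2 1 (Cn n Q (Pe a b)) 1 (Sn n Q (Qe a b))); first exact: PWS_lin2.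
move=> w wk x y xr yr; have := HB w wk Q QB x y xr yr.
have -> : Are n Q (lin2 1 f (-1) (Pe a b)) (lin2 1 (fun _ _ => 0) (-1) (Qe a b)) =
   lin2 1 (Cn n Q f) (-1) (lin2 1 (Cn n Q (Pe a b)) 1 (Sn n Q (Qe a b))).
  apply/funext => x'; apply/funext => y'.
  rewrite /Are /Cn /Sn /avg /lc /lin2 /rotf /lcomp !mul1r mulN1r opprD addrA -!sumrN.
  rewrite -!big_split /= ; apply: eq_bigr => j _.
  by rewrite -!mulrA; ring.
have [sf _] := mf.
rewrite Dw_lin2; [|exact: smooth_avg|exact: smooth_PWS (PWS_lin2 _ _ pP' pQ')].
by rewrite /lin2 mul1r mulN1r distrC.
Qed.

End Approximation.

(** * Fejer summation *)

Section Fejer.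
Variable R : realType.
Implicit Types (f g F : R -> R -> R) (x y z t a b c d e r B : R) (w : seq bool).

Local Opaque pd1 pd2 smooth.

Definition fejC M t : R := \sum_(0 <= m < M.+1) cos (m%:R * t).
Definition fejS M t : R := \sum_(0 <= m < M.+1) sin (m%:R * t).
(** The Fejer kernel as the squared modulus of a geometric sum: nonnegativity is visible and no
    division by [sin (t / 2)] occurs. *)
Definition fej M t : R := (fejC M t ^+ 2 + fejS M t ^+ 2) / M.+1%:R.

Lemma fej_ge0 M t : 0 <= fej M t.
Proof. by rewrite divr_ge0// addr_ge0// sqr_ge0. Qed.

Lemma fej_sum M t : fej M t =
  \sum_(0 <= m < M.+1) \sum_(0 <= m' < M.+1) M.+1%:R^-1 * cos ((m%:Z - m'%:Z)%:~R * t).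
Proof.
rewrite /fej !expr2 {1}/fejC {1}/fejS !mulr_suml -big_split /= mulr_suml.
apply: eq_bigr => m _; rewrite /fejC /fejS !mulr_sumr -big_split /= mulr_suml.
apply: eq_bigr => m' _; rewrite mulrC; congr (_ * _).
by rewrite -cosB; congr cos; rewrite rmorphB /= mulrBl.
Qed.

(** The geometric sum times [1 - exp (i t)] telescopes to [1 - exp (i (M + 1) t)]; take squared
    moduli, the one of [1 - exp (i t)] being [2 * (1 - cos t)]. This concentration estimate serves
    both here and in Kronecker's theorem. *)
Lemma fej_one_minus_cos M t : fej M t * (1 - cos t) <= 2 / M.+1%:R.
Proof.
have [E1 E2] : fejC M t * (1 - cos t) + fejS M t * sin t = 1 - cos (M.+1%:R * t) /\
    fejS M t * (1 - cos t) - fejC M t * sin t = - sin (M.+1%:R * t).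
  elim: M => [|M [IH1 IH2]].
    by rewrite /fejC /fejS !big_nat1 mul0r cos0 sin0 [1%:R * t]mul1r; split; ring.
  have eC : fejC M.+1 t = fejC M t + cos (M.+1%:R * t) by rewrite /fejC big_nat_recr.
  have eS : fejS M.+1 t = fejS M t + sin (M.+1%:R * t) by rewrite /fejS big_nat_recr.
  have eM : M.+2%:R * t = M.+1%:R * t + t by rewrite -[M.+2%:R]natr1; ring.
  rewrite eC eS eM cosD sinD.
  by split; [move: IH1 | move: IH2]; lra.
rewrite /fej mulrAC ler_wpM2r ?invr_ge0//.
have cs := cos2Dsin2 t; have cs' := cos2Dsin2 (M.+1%:R * t).
have : (fejC M t ^+ 2 + fejS M t ^+ 2) * ((1 - cos t) ^+ 2 + sin t ^+ 2) =
   (1 - cos (M.+1%:R * t)) ^+ 2 + sin (M.+1%:R * t) ^+ 2.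
  rewrite -E1 -[sin (M.+1%:R * t)]opprK -E2. ring.
have -> : (1 - cos t) ^+ 2 + sin t ^+ 2 = 2 * (1 - cos t) by rewrite sin2cos2; ring.
have -> : (1 - cos (M.+1%:R * t)) ^+ 2 + sin (M.+1%:R * t) ^+ 2 = 2 * (1 - cos (M.+1%:R * t)).
  by rewrite sin2cos2; ring.
by have := cos_geN1 (M.+1%:R * t); lra.
Qed.

Lemma sum_tk Q (n : int) : (0 < Q)%N ->
  \sum_(0 <= k < Q) cos (n%:~R * tk R Q k) / Q%:R = ((Q%:Z %| n)%Z)%:R :> R.
Proof.
move=> Q0; have QR : Q%:R != 0 :> R by rewrite pnatr_eq0 -lt0n.
have E k : cos (n%:~R * tk R Q k) = cos (0 + 2 * pi * n%:~R / Q%:R * k%:R).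
  by congr cos; rewrite /tk add0r; ring.
rewrite -mulr_suml; under eq_bigr do rewrite E.
have [nQ|nQ] := boolP (Q%:Z %| n)%Z; last by rewrite sum_cos0// mul0r.
by rewrite sum_cos_dvd// cos0 mulr1 divff.
Qed.

(** Only the diagonal survives orthogonality: since [M < Q], distinct indices up to [M] are distinct
    modulo [Q]. *)
Lemma sum_fej M Q : (M < Q)%N -> \sum_(0 <= k < Q) fej M (tk R Q k) / Q%:R = 1.
Proof.
move=> MQ; have Q0 : (0 < Q)%N by apply: leq_trans MQ.
transitivity (\sum_(0 <= m < M.+1) \sum_(0 <= m' < M.+1) M.+1%:R^-1 *
   ((Q%:Z %| (m%:Z - m'%:Z))%Z)%:R : R).
  under eq_bigr do rewrite fej_sum mulr_suml.
  rewrite exchange_big /=; apply: eq_bigr => m _.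
  under eq_bigr do rewrite mulr_suml.
  rewrite exchange_big /=; apply: eq_bigr => m' _.
  by rewrite -sum_tk// mulr_sumr; apply: eq_bigr => k _; rewrite -mulrA.
transitivity (\sum_(0 <= m < M.+1) (M.+1%:R^-1 : R)); last first.
  rewrite sumr_const_nat subn0 -[LHS]mulr_natr mulVf ?pnatr_eq0 //.
rewrite !big_mkord; apply: eq_bigr => m _; rewrite big_mkord (bigD1 m)//= subrr dvdz0 mulr1.
rewrite big1 ?addr0// => m' mm'.
have -> : (Q%:Z %| (m%:Z - m'%:Z))%Z = false; last by rewrite mulr0.
apply: contraNF mm' => D; rewrite -val_eqE /=.
have : (m == m' %[mod Q])%Z by rewrite eqz_mod_dvd.
by rewrite !modz_nat eqz_nat !modn_small ?(leq_trans (ltn_ord _) MQ)// eq_sym.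
Qed.

Lemma absz_sub_le (m n M : nat) : (m <= M)%N -> (n <= M)%N -> (`|m%:Z - n%:Z| <= M)%N.
Proof. by move=> *; lia. Qed.

Lemma cos_absz (n : int) t : cos (`|n|%N%:R * t) = cos (n%:~R * t).
Proof.
case: n => n; first by rewrite absz_nat.
by rewrite NegzE abszN absz_nat mulrNz mulNr cosN.
Qed.

(* Averaging over rotations with Fejer weights; every angular mode is then matched by plane waves. *)
Lemma MW_approx f k r e : MW f -> 0 < e -> exists2 h, PWS h &
  forall w, (size w <= k)%N -> forall x y, `|x| <= r -> `|y| <= r ->
    `|Dw w h x y - Dw w f x y| <= e.
Proof.
move=> mf e0; have [sf _] := mf.
have [B B0 HB] : exists2 B : R, 0 <= B & forall w, (size w <= k)%N ->
    forall t t' x y, `|x| <= r -> `|y| <= r ->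
    `|Dw w (rotf t f) x y - Dw w (rotf t' f) x y| <= B * (`|cos t - cos t'| + `|sin t - sin t'|).
  apply: words_bound; last by move=> w; exact: rot_lip.
  move=> w B B' H BB t t' x y xr yr; apply: (le_trans (H t t' x y xr yr)).
  by rewrite ler_wpM2r// addr_ge0.
(* The angle [t] moves [f] by at most [B * (1 - cos t + |sin t|)], and
   [|sin t| <= eta + (1 - cos t) / (2 * eta)] because the square of the sine is at most
   [2 * (1 - cos t)]. Averaging with the Fejer kernel leaves [B * eta + K / (M + 1)], each term at
   most [e / 4]. *)
pose eta : R := e / (4 * (B + 1)).
have B1 : 0 < B + 1 by rewrite ltr_wpDl.
have eta0 : 0 < eta by rewrite divr_gt0// mulr_gt0.
pose K : R := B * (1 + 1 / (2 * eta)) * 2.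
have K0 : 0 <= K by rewrite mulr_ge0// mulr_ge0// addr_ge0// divr_ge0// mulr_ge0// ltW.
pose M := (Num.truncn (K / (e / 4))).+1.
have MK : K / M.+1%:R <= e / 4.
  rewrite ler_pdivrMr ?ltr0n// mulrC -ler_pdivrMr ?divr_gt0//.
  by rewrite ltW// (lt_trans (truncnS_gt _))// ltr_nat.
have MS0 : 0 < M.+1%:R :> R by rewrite ltr0n.
have e'0 : 0 < e / (2 * M.+1%:R) by rewrite divr_gt0// mulr_gt0.
have [Qf HQf] := choice (fun n => Cn_approx n k r mf e'0).
pose Q := (M.+1 + \max_(n < M.+1) Qf n)%N.
have MQ : (M < Q)%N by rewrite /Q addSn ltnS leq_addr.
have QR : 0 < Q%:R :> R by rewrite ltr0n (leq_trans _ MQ).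
have HQ n : (n <= M)%N -> (Qf n <= Q)%N.
  move=> nM; rewrite /Q (leq_trans _ (leq_addl _ _))//.
  have nM' : (n < M.+1)%N by [].
  exact: (@leq_bigmax _ (fun n : 'I_M.+1 => Qf n) (Ordinal nM')).
have /choice[H HH] : forall n, exists h, PWS h /\ ((n <= M)%N -> forall w, (size w <= k)%N ->
    forall x y, `|x| <= r -> `|y| <= r -> `|Dw w h x y - Dw w (Cn n Q f) x y| <= e / (2 * M.+1%:R)).
  move=> n; have [nM|nM] := leqP n M.
    by have [h ph Hh] := HQf n Q (HQ n nM); exists h.
  by exists (fun _ _ => 0); split => //; exact: PWS0.
pose nn (p : nat * nat) := `|p.1%:Z - p.2%:Z|%N.
pose s := [seq (m, m') | m <- index_iota 0 M.+1, m' <- index_iota 0 M.+1].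
pose c (p : nat * nat) : R := M.+1%:R^-1.
exists (lc s c (fun p => H (nn p))); first by apply: PWS_lc => p; case: (HH (nn p)).
move=> w wk x y xr yr.
rewrite Dw_lc; last by move=> p; apply: smooth_PWS; case: (HH (nn p)).
have sC n : smooth (Cn n Q f) by exact: smooth_avg.
(* Expanding the kernel turns the Fejer average into a combination of modes of order at most [M].
   Only cosines appear because the double sum over [m] and [m'] is symmetric, so [Cn] is enough. *)
have E : lc s c (fun p => Cn (nn p) Q f) = avg Q (fun j => fej M (tk R Q j)) f.
  apply/funext => x'; apply/funext => y'; rewrite /lc /avg /lc big_allpairs_dep /=.
  under [RHS]eq_bigr do rewrite fej_sum !mulr_suml.
  rewrite [RHS]exchange_big /=; apply: eq_bigr => m _.
  under [RHS]eq_bigr do rewrite !mulr_suml.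
  rewrite [RHS]exchange_big /=; apply: eq_bigr => m' _.
  rewrite /Cn /avg /lc mulr_sumr; apply: eq_bigr => j _.
  rewrite /c /nn /= cos_absz; set X := rotf _ f _ _; set C := cos _.
  by move: X C => X C; ring.
rewrite [X in `|X|](_ : _ = (lc s c (fun p => Dw w (H (nn p))) x y - lc s c (fun p => Dw w (Cn (nn p) Q f)) x y)
    + (Dw w (avg Q (fun j => fej M (tk R Q j)) f) x y - Dw w f x y)); last first.
  by rewrite -E Dw_lc// subrKA.
rewrite [leRHS](splitr e) (le_trans (ler_normD _ _))// lerD//.
  rewrite /lc -sumrB (le_trans (ler_norm_sum _ _ _))//.
  apply: (@le_trans _ _ (\sum_(p <- s) c p * (e / (2 * M.+1%:R)))).
    rewrite big_seq [leRHS]big_seq; apply: ler_sum => p ps.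
    rewrite -mulrBr normrM [`|c p|]ger0_norm ?invr_ge0// ler_wpM2l ?invr_ge0//.
    case: (HH (nn p)) => _; apply => //.
    move: ps => /allpairsP[[m m'] /= [+ + ->]]; rewrite !mem_index_iota /nn /= !ltnS => mM m'M.
    exact: absz_sub_le.
  rewrite /c big_allpairs_dep /=; under eq_bigr do rewrite sumr_const_nat.
  rewrite sumr_const_nat !subn0 -[_ *+ _ *+ _]mulr_natr -[_ *+ _]mulr_natr.
  by rewrite [leLHS](_ : _ = e / 2)//; field; rewrite gt_eqF//= gt_eqF.
have rot0 : rotf 0 f = f.
  by apply/funext => x'; apply/funext => y'; rewrite /rotf /lcomp cos0 sin0; congr f; ring.
have -> : Dw w f x y = \sum_(0 <= j < Q) fej M (tk R Q j) / Q%:R * Dw w (rotf 0 f) x y.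
  by rewrite -mulr_suml sum_fej// mul1r rot0.
rewrite /avg Dw_lc; last by move=> j; exact: smooth_rot.
rewrite /lc -sumrB (le_trans (ler_norm_sum _ _ _))//.
apply: (@le_trans _ _ (\sum_(0 <= j < Q) (fej M (tk R Q j) / Q%:R * (B * eta) + K / M.+1%:R / Q%:R))).
  apply: ler_sum => j _; rewrite -mulrBr normrM.
  set t := tk R Q j; have f0 := fej_ge0 M t.
  have fQ0 : 0 <= fej M t / Q%:R by rewrite divr_ge0.
  rewrite [`|fej M t / _|]ger0_norm//.
  apply: (@le_trans _ _ (fej M t / Q%:R * (B * (eta + (1 + 1 / (2 * eta)) * (1 - cos t))))).
    rewrite ler_wpM2l// (le_trans (HB w wk t 0 x y xr yr))// ler_wpM2l// cos0 sin0 subr0.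
    have c1 := cos_le1 t.
    rewrite distrC ger0_norm ?subr_ge0// mulrDl mul1r addrCA lerD2l.
    have sq : `|sin t| ^+ 2 = 1 - cos t ^+ 2 by rewrite real_normK ?num_real// sin2cos2.
    rewrite -(ler_pM2l eta0) mulrDr.
    have -> : eta * (1 / (2 * eta) * (1 - cos t)) = (1 - cos t) / 2 by field; rewrite gt_eqF.
    have cN := cos_geN1 t; have s0 := normr_ge0 (sin t).
    have d0 : 0 <= (2 * eta - `|sin t|) ^+ 2 by exact: sqr_ge0.
    move: sq d0 c1 cN; move: (cos t) `|sin t| => C S sq d0 c1 cN.
    have S2 : 0 <= 2 * (1 - C) - S ^+ 2.
      by rewrite sq [leRHS](_ : _ = (1 - C) ^+ 2) ?sqr_ge0//; ring.
    rewrite -subr_ge0 [leRHS](_ : _ = ((2 * eta - S) ^+ 2 + (2 * (1 - C) - S ^+ 2)) / 4).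
      by rewrite divr_ge0// addr_ge0.
    by field.
  have F1 := fej_one_minus_cos M t.
  have -> : fej M t / Q%:R * (B * (eta + (1 + 1 / (2 * eta)) * (1 - cos t))) =
    fej M t / Q%:R * (B * eta) + (B * (1 + 1 / (2 * eta))) * (fej M t * (1 - cos t)) / Q%:R by ring.
  rewrite lerD2l; apply: ler_wpM2r; first by rewrite invr_ge0 ltW.
  have -> : K / M.+1%:R = B * (1 + 1 / (2 * eta)) * (2 / M.+1%:R) by rewrite /K; ring.
  by apply: ler_wpM2l => //; rewrite mulr_ge0// addr_ge0// mulr_ge0// invr_ge0 mulr_ge0// ltW.
rewrite big_split /= -mulr_suml sum_fej// mul1r sumr_const_nat subn0 -[X in _ + X]mulr_natr.
rewrite divfK ?gt_eqF//.
have : B * eta <= e / 4.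
  rewrite /eta [leLHS](_ : _ = (B / (B + 1)) * (e / 4)); last by field; rewrite gt_eqF.
  by rewrite ler_piMl ?divr_ge0 ?(ltW e0)// ler_pdivrMr// mul1r lerDl.
move=> BE; have -> : e / 2 = e / 4 + e / 4 by field.
exact: lerD BE MK.
Qed.

End Fejer.

(** * Gaussian integers *)

(* The pair [(x, y)] stands for the Gaussian integer [x + i y]. *)
Definition gint : Type := (int * int)%type.
HB.instance Definition _ := GRing.Zmodule.copy gint (int * int)%type.

Definition gmul (z w : gint) : gint := (z.1 * w.1 - z.2 * w.2, z.1 * w.2 + z.2 * w.1).
Definition gone : gint := (1, 0).

Fact gmulA : associative gmul.
Proof. by move=> [a b] [c d] [e f]; congr pair => /=; ring. Qed.
Fact gmulC : commutative gmul.
Proof. by move=> [a b] [c d]; congr pair => /=; ring. Qed.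
Fact gmul1 : left_id gone gmul.
Proof. by move=> [a b]; congr pair => /=; ring. Qed.
Fact gmulDl : left_distributive gmul +%R.
Proof. by move=> [a b] [c d] [e f]; congr pair => /=; ring. Qed.
Fact gone_neq0 : gone != 0.
Proof. by []. Qed.
HB.instance Definition _ := GRing.Zmodule_isComNzRing.Build gint gmulA gmulC gmul1 gmulDl gone_neq0.

Definition gnorm (z : gint) : int := z.1 ^+ 2 + z.2 ^+ 2.
Definition gconj (z : gint) : gint := (z.1, - z.2).
Definition gofint (n : int) : gint := (n, 0).

Lemma gmulE (z w : gint) : z * w = (z.1 * w.1 - z.2 * w.2, z.1 * w.2 + z.2 * w.1).
Proof. by []. Qed.

Lemma gnormM z w : gnorm (z * w) = gnorm z * gnorm w.
Proof. by case: z w => [a b] [c d]; rewrite gmulE /gnorm /=; ring. Qed.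

Lemma gnormX z n : gnorm (z ^+ n) = gnorm z ^+ n.
Proof. by elim: n => [|n IHn]; rewrite ?expr0// !exprS gnormM IHn. Qed.

Lemma gnorm_ge0 z : 0 <= gnorm z. Proof. by rewrite addr_ge0 ?sqr_ge0. Qed.

Lemma gnorm_eq0 z : gnorm z = 0 -> z = 0.
Proof.
case: z => [a b]; rewrite /gnorm /= => /eqP.
by rewrite paddr_eq0 ?sqr_ge0// !sqrf_eq0 => /andP[/eqP -> /eqP ->].
Qed.

Lemma gmulI (x a b : gint) : gnorm x != 0 -> x * a = x * b -> a = b.
Proof.
move=> x0 e; apply/eqP; rewrite -subr_eq0; apply/eqP/gnorm_eq0.
have : gnorm x * gnorm (a - b) = 0 by rewrite -gnormM mulrBr e subrr.
by move/eqP; rewrite mulf_eq0 (negbTE x0) => /eqP.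
Qed.

Lemma gconjM z w : gconj (z * w) = gconj z * gconj w.
Proof. by case: z w => [a b] [c d]; rewrite !gmulE /gconj /=; congr pair; ring. Qed.

Lemma gconjX z n : gconj (z ^+ n) = gconj z ^+ n.
Proof. by elim: n => [|n IHn] //; rewrite !exprS gconjM IHn. Qed.

Lemma gconjK z : gconj (gconj z) = z.
Proof. by case: z => [a b]; rewrite /gconj /= opprK. Qed.

Lemma gnorm_conj z : gnorm (gconj z) = gnorm z.
Proof. by rewrite /gnorm /= sqrrN. Qed.

Lemma gmul_conj z : z * gconj z = gofint (gnorm z).
Proof. by case: z => [a b]; rewrite gmulE /gnorm /gofint /=; congr pair; ring. Qed.

Lemma prime_neq_sqr p n : prime p -> (n ^ 2)%N != p.
Proof.
move=> pp; apply: contraTneq pp => e; apply/negP => pp.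
have := lognX p n 2; rewrite e -{2}(expn1 p) pfactorK //; lia.
Qed.

Section GaussPrime.
Variables (p : nat) (q : gint).
Hypotheses (p_prime : prime p) (p_gt2 : (2 < p)%N) (q_norm : gnorm q = p%:Z).

Let pZ0 : (p%:Z != 0). Proof. by rewrite eqz_nat -lt0n prime_gt0. Qed.

Lemma gprime_neq0 : gnorm q != 0. Proof. by rewrite q_norm. Qed.

Lemma gprime_re_ndvd : ~~ (p %| `|q.1|)%N.
Proof.
apply/negP => D; case: q q_norm D => [x y]; rewrite /gnorm /= => e D.
have [x0|x0] := posnP `|x|%N.
  have {}x0 : x = 0 by apply/eqP; rewrite -absz_eq0 x0.
  have e2 : (`|y| ^ 2 = p)%N.
    by apply/eqP; rewrite -eqz_nat -e x0 expr0n add0r PoszM -abszX -exprnP || lia.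
  by have := prime_neq_sqr `|y|%N p_prime; rewrite e2 eqxx.
have xp : (p <= `|x|)%N by apply: dvdn_leq.
have h := leq_mul xp xp.
have : (`|x| * `|x| <= p)%N.
  by rewrite -lez_nat -e PoszM -expr2 abszE real_normK ?num_real// lerDl sqr_ge0.
move/(leq_trans h); rewrite leqNgt ltn_Pmull ?prime_gt0//; exact: ltnW.
Qed.

(** Modulo [q], [conj q] is congruent to the integer [2 * q.1], which is prime to [p]. So [q]
    divides [g] times a power of this integer, and taking norms yields the claim. *)
Lemma gdvd_conjX g w n : q * w = g * gconj q ^+ n -> (p %| `|gnorm g|)%N.
Proof.
move=> e.
have [u Hu] : exists u, gconj q ^+ n = gofint ((2 * q.1) ^+ n) + q * u.
  elim: n {e} => [|n [u IHn]]; first by exists 0; rewrite mulr0 addr0.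
  have c1 : gconj q = gofint (2 * q.1) - q.
    by case: (q) => [x y]; congr pair => /=; ring.
  exists (gofint (2 * q.1) * u - gofint ((2 * q.1) ^+ n) - q * u).
  have -> : gofint ((2 * q.1) ^+ n.+1) = gofint (2 * q.1) * gofint ((2 * q.1) ^+ n).
    by rewrite gmulE /gofint /= exprS; congr pair; ring.
  rewrite exprS IHn c1; ring.
have e2 : g * gofint ((2 * q.1) ^+ n) = q * (w - g * u).
  by rewrite mulrBr e Hu; ring.
have := f_equal (fun z => `|gnorm z|%N) e2.
rewrite !gnormM q_norm !abszM absz_nat => e3.
have : (p %| `|gnorm g| * `|gnorm (gofint ((2 * q.1) ^+ n))|)%N by rewrite e3 dvdn_mulr.
rewrite Euclid_dvdM// => /orP[//|].
rewrite /gnorm /= expr0n addr0 !abszX => D; exfalso.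
have {}D : (p %| `|(2 * q.1)%R|)%N.
  by move: D; rewrite !Euclid_dvdX// => /andP[/andP[]].
move: D; rewrite abszM Euclid_dvdM// (negbTE gprime_re_ndvd) orbF /=.
by move/dvdn_leq => /(_ isT); rewrite leqNgt p_gt2.
Qed.

(* Reduction modulo the Gaussian prime [q] kills all terms of the sum but the first. *)
Lemma gprime_indep a (g : nat -> gint) :
  (forall j, (j <= a)%N -> gnorm (g j) < p%:Z) ->
  \sum_(0 <= j < a.+1) g j * q ^+ j * gconj q ^+ (a - j) = 0 ->
  forall j, (j <= a)%N -> g j = 0.
Proof.
elim: a g => [|a IHa] g gp.
  rewrite big_nat1 !expr0 !mulr1 => g0 j; rewrite leqn0 => /eqP -> //.
rewrite big_nat_recl// expr0 mulr1 subn0 => e.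
have e1 : \sum_(0 <= j < a.+1) g j.+1 * q ^+ j.+1 * gconj q ^+ (a.+1 - j.+1) =
    q * \sum_(0 <= j < a.+1) g j.+1 * q ^+ j * gconj q ^+ (a - j).
  by rewrite mulr_sumr; apply: eq_bigr => j _; rewrite subSS exprS; ring.
rewrite e1 in e; set S := \sum_(0 <= j < a.+1) _ in e.
have D : (p %| `|gnorm (g 0%N)|)%N.
  by apply: (@gdvd_conjX _ (- S) a.+1); rewrite mulrN; apply/eqP; rewrite eq_sym -addr_eq0 e.
have g00 : g 0%N = 0.
  apply: gnorm_eq0; apply/eqP; rewrite -absz_eq0 -leqn0 leqNgt; apply/negP => h.
  have := dvdn_leq h D; rewrite leqNgt => /negP; apply.
  by rewrite -ltz_nat gez0_abs ?gnorm_ge0// gp.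
have S0 : S = 0.
  by apply: (gmulI gprime_neq0); rewrite mulr0 -e g00 mul0r add0r.
by move=> [|j] //= ja; apply: (IHa (fun j => g j.+1)) => // i ia; apply: gp.
Qed.

(** The imaginary parts of [conj q * w] and [q * w] have a product divisible by [p]. Once [p]
    divides the imaginary part of [conj r * w], where [r] is [q] or [conj q], it divides the real
    part too, by the norm, and then [r] divides [w]. *)
Lemma gprime_div w (T : int) : gnorm w = T * p%:Z ->
  exists w', (w = q * w' \/ w = gconj q * w') /\ gnorm w' = T.
Proof.
move=> e.
have e' : w.1 ^+ 2 + w.2 ^+ 2 = T * p%:Z := e.
have eq' : q.1 ^+ 2 + q.2 ^+ 2 = p%:Z := q_norm.
have key (r : gint) : gnorm r = p%:Z -> (p%:Z %| r.1 * w.2 - w.1 * r.2)%Z ->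
    exists w', w = r * w' /\ gnorm w' = T.
  move=> nr /dvdzP[v ev].
  have nr' : r.1 ^+ 2 + r.2 ^+ 2 = p%:Z := nr.
  have : (p %| `|(w.1 * r.1 + w.2 * r.2)%R| ^ 2)%N.
    have E : (w.1 * r.1 + w.2 * r.2) ^+ 2 = p%:Z * (T * p%:Z - v ^+ 2 * p%:Z).
      have -> : (w.1 * r.1 + w.2 * r.2) ^+ 2 =
        (w.1 ^+ 2 + w.2 ^+ 2) * (r.1 ^+ 2 + r.2 ^+ 2) - (r.1 * w.2 - w.1 * r.2) ^+ 2 by ring.
      by rewrite e' nr' ev; ring.
    by rewrite -abszX E abszM absz_nat dvdn_mulr.
  rewrite Euclid_dvdX// andbT => D.
  have /dvdzP[u eu] : (p%:Z %| w.1 * r.1 + w.2 * r.2)%Z by rewrite dvdzE absz_nat.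
  have er : w = r * (u, v).
    apply: (@gmulI (gconj r)); first by rewrite gnorm_conj nr.
    have -> : gconj r * (r * (u, v)) = gofint p%:Z * (u, v) by rewrite mulrA (mulrC (gconj r)) gmul_conj nr.
    rewrite !gmulE /=; congr pair; first by rewrite mul0r subr0 [RHS]mulrC -eu; ring.
    by rewrite mul0r addr0 [RHS]mulrC -ev; ring.
  exists (u, v); split=> //.
  apply: (mulIf pZ0); rewrite -e er gnormM nr mulrC //.
have : (p %| `|((q.1 * w.2 - w.1 * q.2) * (q.1 * w.2 + w.1 * q.2))%R|)%N.
  have -> : (q.1 * w.2 - w.1 * q.2) * (q.1 * w.2 + w.1 * q.2) = p%:Z * (q.1 ^+ 2 * T - w.1 ^+ 2).
    have -> : p%:Z * (q.1 ^+ 2 * T - w.1 ^+ 2) = q.1 ^+ 2 * (T * p%:Z) - w.1 ^+ 2 * p%:Z by ring.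
    by rewrite -e' -eq'; ring.
  by rewrite abszM absz_nat dvdn_mulr.
rewrite abszM Euclid_dvdM// => /orP[] D.
  have [|w' [-> <-]] := key q q_norm; first by rewrite dvdzE absz_nat.
  by exists w'; split; [left|].
have [||w' [-> <-]] := key (gconj q); first by rewrite gnorm_conj.
  by rewrite dvdzE absz_nat /= mulrN opprK.
by exists w'; split; [right|].
Qed.

Lemma gprime_reps a w (T : int) : gnorm w = T * p%:Z ^+ a ->
  exists z j, [/\ (j <= a)%N, w = z * (q ^+ j * gconj q ^+ (a - j)) & gnorm z = T].
Proof.
elim: a w => [|a IHa] w.
  by rewrite expr0 mulr1 => e; exists w, 0%N; rewrite !expr0 !mulr1.
rewrite exprSr mulrA => /gprime_div[w' [ew nw]].
have [z [j [ja e nz]]] := IHa _ nw.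
case: ew => ->; rewrite e.
  exists z, j.+1; split => //; rewrite subSS exprS; ring.
exists z, j; split => //; first by rewrite leqW.
rewrite subSn// exprS; ring.
Qed.

Lemma gprime_reps_uniq a z z' j j' : ~~ (p %| `|gnorm z|)%N -> ~~ (p %| `|gnorm z'|)%N ->
  (j <= a)%N -> (j' <= a)%N ->
  z * (q ^+ j * gconj q ^+ (a - j)) = z' * (q ^+ j' * gconj q ^+ (a - j')) ->
  z = z' /\ j = j'.
Proof.
have nX n : gnorm (q ^+ n) != 0 by rewrite gnormX expf_neq0// gprime_neq0.
have nY n : gnorm (gconj q ^+ n) != 0 by rewrite gnormX gnorm_conj expf_neq0// gprime_neq0.
wlog : z z' j j' / (j <= j')%N => [H|jj'] nz nz' ja j'a e.
  have [jj|jj] := leqP j j'; first exact: H.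
  by have [|-> ->] := H z' z j' j _ nz' nz j'a ja (esym e); first exact: ltnW.
have [jj|jj] := eqVneq j j'.
  split => //; rewrite -jj in e; apply: (@gmulI (q ^+ j * gconj q ^+ (a - j))).
    by rewrite gnormM mulf_neq0.
  by rewrite mulrC e mulrC.
have lj : (j < j')%N by rewrite ltn_neqAle jj.
exfalso; move/negP: nz; apply.
have e2 : q * (z' * q ^+ (j' - j).-1) = z * gconj q ^+ (j' - j).
  apply: (@gmulI (q ^+ j * gconj q ^+ (a - j'))); first by rewrite gnormM mulf_neq0.
  have -> : q ^+ j * gconj q ^+ (a - j') * (z * gconj q ^+ (j' - j)) =
     z * (q ^+ j * gconj q ^+ (a - j)).
    have -> : (a - j = (a - j') + (j' - j))%N by lia.
    rewrite exprD; ring.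
  have -> : q ^+ j * gconj q ^+ (a - j') * (q * (z' * q ^+ (j' - j).-1)) =
     z' * (q ^+ j' * gconj q ^+ (a - j')).
    have -> : q ^+ j' = q ^+ j * (q * q ^+ (j' - j).-1).
      by rewrite -exprS -exprD; congr (_ ^+ _); lia.
    ring.
  by rewrite e.
exact: (gdvd_conjX e2).
Qed.

End GaussPrime.

Lemma sqr_sub_le (a b r : nat) : (a <= r)%N -> (b <= r)%N -> (a%:Z - b%:Z) ^+ 2 <= (r ^ 2)%:Z.
Proof.
move=> ar br; have h : (`|a%:Z - b%:Z| <= r)%N by lia.
by rewrite -[leLHS]gez0_abs ?sqr_ge0// abszX lez_nat leq_sqr.
Qed.

Lemma nat_sqrt p : exists2 r, (r ^ 2 <= p)%N & (p < r.+1 ^ 2)%N.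
Proof.
elim: p => [|p [r h1 h2]]; first by exists 0%N.
have [h|h] := leqP (r.+1 ^ 2) p.+1; last by exists r => //; rewrite (leq_trans h1).
by exists r.+1 => //; rewrite (leq_ltn_trans h2)// ltn_sqr.
Qed.

(* Thue's pigeonhole argument. *)
Lemma prime_sum_squares p k : prime p -> (p %| k ^ 2 + 1)%N -> exists z : gint, gnorm z = p%:Z.
Proof.
move=> pp D.
have p0 := prime_gt0 pp.
have [r r1 r2] := nat_sqrt p.
pose F (x : 'I_r.+1 * 'I_r.+1) : 'I_p := Ordinal (ltn_pmod (x.1 + k * x.2) p0).
have /injectivePn[[a b] [[c d] ne eF]] : ~~ injectiveb F.
  apply/negP => /injectiveP /leq_card; rewrite card_prod !card_ord leqNgt; case/negP; nia.
have {}eF : (a + k * b = c + k * d %[mod p])%N by have := f_equal val eF.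
pose x : int := a%:Z - c%:Z; pose y : int := b%:Z - d%:Z.
have D1 : (p%:Z %| x + k%:Z * y)%Z.
  have -> : x + k%:Z * y = (a + k * b)%:Z - (c + k * d)%:Z by rewrite /x /y !PoszD !PoszM; ring.
  by rewrite -eqz_mod_dvd !modz_nat eF.
have D2 : (p%:Z %| x ^+ 2 + y ^+ 2)%Z.
  have -> : x ^+ 2 + y ^+ 2 = (x + k%:Z * y) * (x - k%:Z * y) + (k ^ 2 + 1)%:Z * y ^+ 2.
    by rewrite PoszD -mulnn PoszM; ring.
  by apply: rpredD; apply: dvdz_mulr => //; rewrite dvdzE.
exists (x, y); rewrite /gnorm /=.
have xr : x ^+ 2 <= (r ^ 2)%:Z by apply: sqr_sub_le; rewrite -ltnS ltn_ord.
have yr : y ^+ 2 <= (r ^ 2)%:Z by apply: sqr_sub_le; rewrite -ltnS ltn_ord.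
have rp : (r ^ 2 < p)%N by rewrite ltn_neqAle r1 prime_neq_sqr.
have pos : 0 < x ^+ 2 + y ^+ 2.
  rewrite lt_neqAle addr_ge0 ?sqr_ge0// andbT eq_sym paddr_eq0 ?sqr_ge0// !sqrf_eq0.
  apply: contra ne => /andP[]; rewrite /x /y !subr_eq0 !eqz_nat => /eqP e1 /eqP e2.
  by apply/eqP; congr pair; apply: val_inj.
have /dvdzP[m em] := D2.
have pz : 0 < p%:Z by rewrite ltz_nat.
have m0 : 0 < m by rewrite -(pmulr_lgt0 _ pz) -em.
have m2 : m < 2.
  rewrite -(ltr_pM2r pz) -em (le_lt_trans (lerD xr yr))//.
  by rewrite -ltz_nat in rp; rewrite mulr_natl mulr2n; apply: ltrD.
have m1 : m = 1 by lia.
by rewrite em m1 mul1r.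
Qed.

(** A prime factor of [B! ^ 2 + 1] exceeds [B] and has [- 1] as a square by construction, so neither
    residues modulo 4 nor primes in progressions enter. *)
Lemma gprime_exists B : exists p z, [/\ prime p, (B < p)%N & gnorm z = p%:Z].
Proof.
pose p := pdiv ((B`!) ^ 2 + 1).
have pp : prime p by rewrite pdiv_prime// addn1 ltnS expn_gt0 fact_gt0.
have D : (p %| (B`!) ^ 2 + 1)%N by exact: pdiv_dvd.
have [z nz] := prime_sum_squares pp D.
exists p, z; split => //; rewrite ltnNge; apply/negP => pB.
have D2 : (p %| B`! ^ 2)%N by rewrite dvdn_exp// dvdn_fact// prime_gt0.
by move: D; rewrite dvdn_addr// dvdn1 => /eqP p1; move: pp; rewrite p1.
Qed.

(** * Dense directions on a circle of odd radius *)

Section DenseDirections.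
Variable R : realType.

Lemma tan_half_lip (t u : R) : 0 <= t -> t <= u -> u <= 1 ->
  `|(1 - t ^+ 2) / (1 + t ^+ 2) - (1 - u ^+ 2) / (1 + u ^+ 2)| <= 4 * (u - t) /\
  `|2 * t / (1 + t ^+ 2) - 2 * u / (1 + u ^+ 2)| <= 4 * (u - t).
Proof.
move=> t0 tu u1.
have pt : 1 <= 1 + t ^+ 2 by rewrite lerDl sqr_ge0.
have pu : 1 <= 1 + u ^+ 2 by rewrite lerDl sqr_ge0.
have nt : 1 + t ^+ 2 != 0 by rewrite gt_eqF// (lt_le_trans _ pt).
have nu : 1 + u ^+ 2 != 0 by rewrite gt_eqF// (lt_le_trans _ pu).
have P : 1 <= (1 + t ^+ 2) * (1 + u ^+ 2) by apply: mulr_ege1.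
have P0 : 0 < (1 + t ^+ 2) * (1 + u ^+ 2) by apply: lt_le_trans P.
have ut : 0 <= u - t by rewrite subr_ge0.
have key (N : R) : `|N| <= 4 * (u - t) -> `|N / ((1 + t ^+ 2) * (1 + u ^+ 2))| <= 4 * (u - t).
  move=> H; rewrite normrM normfV (gtr0_norm P0) ler_pdivrMr// (le_trans H)// ler_peMr//.
  by rewrite mulr_ge0.
split.
  have -> : (1 - t ^+ 2) / (1 + t ^+ 2) - (1 - u ^+ 2) / (1 + u ^+ 2) =
     (2 * ((u - t) * (u + t))) / ((1 + t ^+ 2) * (1 + u ^+ 2)).
    by field; rewrite nt nu.
  have ut2 : u + t <= 2 by lra.
  have utp : 0 <= u + t by lra.
  apply: key; rewrite ger0_norm; last by rewrite mulr_ge0// mulr_ge0.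
  have : (u - t) * (u + t) <= (u - t) * 2 by rewrite ler_wpM2l.
  by lra.
have -> : 2 * t / (1 + t ^+ 2) - 2 * u / (1 + u ^+ 2) =
   - ((2 * ((u - t) * (1 - t * u))) / ((1 + t ^+ 2) * (1 + u ^+ 2))).
  by field; rewrite nt nu.
have tu1 : t * u <= 1 by rewrite mulr_ile1//; lra.
have tu0 : 0 <= t * u by rewrite mulr_ge0//; lra.
rewrite normrN; apply: key; rewrite ger0_norm; last by rewrite mulr_ge0// mulr_ge0// subr_ge0.
have : (u - t) * (1 - t * u) <= (u - t) * 1 by rewrite ler_wpM2l// lerBlDr lerDl.
by lra.
Qed.

(* The directions come from the rational parametrisation of the circle, with parameters
   [2 u / v] having a common odd denominator. *)
Lemma dense_lattice_circle (delta : R) : 0 < delta -> exists D : nat, odd D /\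
  forall X Y : R, X ^+ 2 + Y ^+ 2 = 1 -> exists z : gint, gnorm z = (D ^ 2)%:Z /\
    (`|z.1%:~R / D%:R - X| <= delta /\ `|z.2%:~R / D%:R - Y| <= delta).
Proof.
move=> d0.
pose v := (Num.truncn (8 / delta)).*2.+1.
have v0 : (0 < v)%N by [].
have vR : 0 < v%:R :> R by rewrite ltr0n.
have vd : 8 / v%:R <= delta.
  rewrite ler_pdivrMr// mulrC -ler_pdivrMr// ltW// (lt_le_trans (truncnS_gt _))//.
  by rewrite ler_nat /v ltnS -addnn leq_addr.
(* The common denominator of both coordinates for the parameter [2 * u / v], odd because [v] is. The
   product of all of them is one radius that serves every direction. *)
pose F (u : 'I_v) := (v ^ 2 + 4 * u ^ 2)%N.
pose D := (\prod_(u < v) F u)%N.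
have F0 u : (0 < F u)%N by rewrite /F addn_gt0 expn_gt0 v0.
have Dodd : odd D.
  rewrite /D; elim/big_ind: _ => // [x y ox oy|u _]; first by rewrite oddM ox.
  by rewrite /F oddD oddX oddM /= odd_double.
have D0 : 0 < D%:R :> R by rewrite ltr0n odd_gt0.
exists D; split=> //.
have pos (X Y : R) : 0 <= X -> 0 <= Y -> X ^+ 2 + Y ^+ 2 = 1 -> exists z : gint, gnorm z = (D ^ 2)%:Z /\
    (`|z.1%:~R / D%:R - X| <= delta /\ `|z.2%:~R / D%:R - Y| <= delta).
  move=> X0 Y0 XY.
  have X1 : 0 < 1 + X by rewrite ltr_wpDr.
  (* The tangent of half the angle of [(X, Y)]. Parameters [2 * u / v] have spacing [2 / v], and the
     Lipschitz constant 4 turns this into the error [8 / v]. *)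
  pose tau := Y / (1 + X).
  have tau0 : 0 <= tau by rewrite divr_ge0// ltW.
  have Y1 : Y <= 1 by have := sqr_ge0 X; nra.
  have tau1 : tau <= 1 by rewrite ler_pdivrMr// mul1r (le_trans Y1)// lerDl.
  pose u := Num.truncn (tau * v%:R / 2).
  have a0 : 0 <= tau * v%:R / 2 by rewrite divr_ge0// mulr_ge0// ltW.
  have /andP[u1 u2] := truncn_itv a0; rewrite -/u in u1 u2.
  have uv : (u < v)%N.
    rewrite -(ltr_nat R) (le_lt_trans u1)// ltr_pdivrMr// mulrC ltr_pM2l//; lra.
  pose t : R := 2 * u%:R / v%:R.
  have t0 : 0 <= t by rewrite divr_ge0// mulr_ge0.
  have tt : t <= tau.
    rewrite /t ler_pdivrMr//; move: u1; rewrite ler_pdivlMr//; lra.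
  have tt2 : tau - t <= 2 / v%:R.
    rewrite -(ler_pM2r vR) mulrBl /t !divfK ?gt_eqF//.
    by move: u2; rewrite ltr_pdivrMr// -natr1; lra.
  have [H1 H2] := tan_half_lip t0 tt tau1.
  have le8 : 4 * (tau - t) <= delta.
    rewrite (le_trans _ vd)//; have -> : 8 / v%:R = 4 * (2 / v%:R) :> R by field; rewrite gt_eqF.
    by rewrite ler_wpM2l.
  have nX : 1 + X != 0 by rewrite gt_eqF.
  have Y2 : Y ^+ 2 = (1 - X) * (1 + X).
    have -> : Y ^+ 2 = 1 - X ^+ 2 by rewrite -XY; ring.
    by ring.
  have tau2 : tau ^+ 2 = (1 - X) / (1 + X).
    by rewrite /tau expr_div_n Y2; field.
  have ptau : 1 + tau ^+ 2 = 2 / (1 + X) by rewrite tau2; field.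
  have eX : (1 - tau ^+ 2) / (1 + tau ^+ 2) = X.
    by rewrite ptau tau2; field; rewrite nX.
  have eY : 2 * tau / (1 + tau ^+ 2) = Y by rewrite ptau /tau; field; rewrite nX.
  pose u' := Ordinal uv.
  pose c := (\prod_(j < v | j != u') F j)%N.
  have DE : D = (c * (v ^ 2 + 4 * u ^ 2))%N.
    by rewrite /D (bigD1 u')//= mulnC.
  exists (c%:Z * (v%:Z ^+ 2 - 4 * u%:Z ^+ 2), c%:Z * (4 * u%:Z * v%:Z)).
  split.
    have X2 (m : nat) : (m ^ 2)%:Z = m%:Z ^+ 2 by rewrite expr2 -PoszM mulnn.
    have DZ : D%:Z = c%:Z * (v%:Z ^+ 2 + 4 * u%:Z ^+ 2) by rewrite DE PoszM PoszD PoszM !X2.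
    rewrite X2.
    by rewrite DZ /gnorm /=; ring.
  have FR : v%:R ^+ 2 + 4 * u%:R ^+ 2 != 0 :> R.
    by rewrite gt_eqF// ltr_pwDl ?exprn_gt0// mulr_ge0// sqr_ge0.
  have FR2 : v%:R ^+ 2 + (2 * u%:R) ^+ 2 != 0 :> R.
    by rewrite [X in X != _](_ : _ = v%:R ^+ 2 + 4 * u%:R ^+ 2)//; ring.
  have cR : c%:R != 0 :> R.
    by apply: contraTneq D0 => c0; rewrite DE natrM c0 mul0r ltxx.
  have DR : D%:R = c%:R * (v%:R ^+ 2 + 4 * u%:R ^+ 2) :> R by rewrite DE natrM natrD natrM !natrX.
  rewrite eX in H1; rewrite eY in H2.
  have v0' : v%:R != 0 :> R by rewrite gt_eqF.
  split; rewrite /= DR.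
    rewrite [X in `|X - _|](_ : _ = (1 - t ^+ 2) / (1 + t ^+ 2)); first exact: le_trans H1 le8.
    rewrite /t !rmorphM /= !rmorphB /= !rmorphM /= -!pmulrn; field.
    by rewrite ?v0' ?FR2 ?cR ?FR.
  rewrite [X in `|X - _|](_ : _ = 2 * t / (1 + t ^+ 2)); first exact: le_trans H2 le8.
  rewrite /t !rmorphM /= -!pmulrn; field.
  by rewrite ?v0' ?FR2 ?cR ?FR.
move=> X Y XY.
have [z [nz [H1 H2]]] : exists z : gint, gnorm z = (D ^ 2)%:Z /\
    (`|z.1%:~R / D%:R - `|X| | <= delta /\ `|z.2%:~R / D%:R - `|Y| | <= delta).
  by apply: pos => //; rewrite !real_normK ?num_real.
have flip (a : int) (Z : R) : `|a%:~R / D%:R - `|Z| | <= delta ->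
    exists b : int, b ^+ 2 = a ^+ 2 /\ `|b%:~R / D%:R - Z| <= delta.
  have [Z0|Z0] := leP 0 Z; first by rewrite (ger0_norm Z0) => H; exists a.
  rewrite (ltr0_norm Z0) => H; exists (- a); rewrite sqrrN; split=> //.
  by rewrite rmorphN /= mulNr -opprD normrN -[Z]opprK.
have [b1 [e1 K1]] := flip _ _ H1; have [b2 [e2 K2]] := flip _ _ H2.
by exists (b1, b2); split; [rewrite /gnorm /= e1 e2 -nz | split].
Qed.

End DenseDirections.

(** * Simultaneous approximation *)

Section Kronecker.
Variable R : realType.
Implicit Types (t a b : R).

Lemma near_int (kappa : R) : 0 < kappa -> exists2 eta : R, 0 < eta &
  forall a, 1 - eta < cos (2 * pi * a) -> exists N : int, `|a - N%:~R| <= kappa.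
Proof.
move=> k0; pose k := Num.min kappa (1 / 4).
have kp : 0 < k by rewrite lt_min k0 divr_gt0.
have kk : k <= kappa by rewrite ge_min lexx.
have k4 : k <= 1 / 4 by rewrite ge_min lexx orbT.
have p0 := pi_gt0 R.
have kin : 2 * pi * k \in `[0, pi].
  rewrite in_itv /= mulr_ge0 ?(ltW kp) ?mulr_ge0 ?(ltW p0)//= mulrAC ler_piMl ?(ltW p0)//; lra.
exists (1 - cos (2 * pi * k)).
  rewrite subr_gt0 -[X in _ < X]cos0 ltr_cos//; first by rewrite mulr_gt0// mulr_gt0.
  by rewrite in_itv /= lexx ltW.
move=> a; rewrite subKr => H; exists (Num.floor (a + 1 / 2)).
set N := Num.floor _; have /andP[N1 N2] := floor_itv (a + 1 / 2); rewrite -/N in N1 N2.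
set r := a - N%:~R; rewrite leNgt; apply/negP => kr.
have ar : a = r + N%:~R by rewrite /r subrK.
have r2 : `|r| <= 1 / 2.
  rewrite ler_norml /r; move: N2; rewrite rmorphD /= => N2; apply/andP; split; lra.
have a2 : 2 * pi * a = 2 * pi * r + 2 * pi * N%:~R by rewrite [in LHS]ar; ring.
move: H; rewrite a2 cosDz.
have -> : cos (2 * pi * r) = cos (2 * pi * `|r|).
  by rewrite -[LHS]cos_norm normrM ger0_norm// mulr_ge0// ltW.
rewrite ltr_cos//; last first.
  rewrite in_itv /= mulr_ge0 ?mulr_ge0 ?(ltW p0)//= mulrAC ler_piMl ?(ltW p0)//; lra.
rewrite ltr_pM2l ?mulr_gt0// => /lt_le_trans - /(_ _ kk) /lt_trans - /(_ _ kr).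
by rewrite ltxx.
Qed.

Section Independent.
Variables (n K Q : nat) (f : 'I_n -> int) (beta : 'I_n -> R).
Hypothesis f_indep : forall c : 'I_n -> int, (forall i, (`|c i| <= K)%N) ->
  \sum_i c i * f i = 0 -> forall i, c i = 0.
Hypothesis Q_gt : (K * \sum_i `|f i| < Q)%N.

Let ph i (k : nat) : R := 2 * pi * ((f i)%:~R * (k%:R / Q%:R) - beta i).
Let prodf s k : R := \prod_(i <- s) fej K (ph i k).

Let Q0 : (0 < Q)%N. Proof. exact: leq_trans Q_gt. Qed.

(** Expanding one kernel at a time adds a multiple [d * f i], with [|d| <= K], to the frequency; the
    induction therefore ranges over all [l] and all phases. In the end each frequency is nonzero
    modulo [Q] and averages to zero. *)
Lemma avg_prod0 (s : seq 'I_n) (l : int) a : uniq s ->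
  (forall c : 'I_n -> int, (forall i, (`|c i| <= K)%N) -> (forall i, i \notin s -> c i = 0) ->
     ~~ (Q%:Z %| (l + \sum_i c i * f i))%Z) ->
  \sum_(0 <= k < Q) cos (a + 2 * pi * l%:~R / Q%:R * k%:R) * prodf s k = 0.
Proof.
elim: s l a => [|i s IHs] l a /=.
  move=> _ H; under eq_bigr do rewrite /prodf big_nil mulr1.
  apply: sum_cos0 => //; have := H (fun=> 0).
  by rewrite big1 ?addr0; [apply | move=> i _; rewrite mul0r].
move=> /andP[is_ us] H.
have QR : Q%:R != 0 :> R by rewrite pnatr_eq0 -lt0n.
have step (d : int) b : (`|d| <= K)%N ->
    \sum_(0 <= k < Q) cos (b + 2 * pi * (l + d * f i)%:~R / Q%:R * k%:R) * prodf s k = 0.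
  move=> dK; apply: IHs => // c cK cs.
  have := H (fun j => if j == i then d else c j).
  rewrite (bigD1 i)//= eqxx.
  have -> : \sum_(j < n | j != i) (if j == i then d else c j) * f j = \sum_j c j * f j.
    rewrite [RHS](bigD1 i)//= (cs i is_) mul0r add0r.
    by apply: eq_bigr => j /negbTE ->.
  rewrite addrA; apply.
    by move=> j; case: eqP.
  by move=> j; rewrite inE negb_or => /andP[/negbTE -> /cs].
under eq_bigr => k _.
  rewrite /prodf big_cons -/(prodf s k) fej_sum mulr_suml mulr_sumr; over.
rewrite exchange_big big_nat_cond big1// => m /andP[/andP[_ mK] _].
under eq_bigr do rewrite mulr_suml mulr_sumr.
rewrite exchange_big big_nat_cond big1// => m' /andP[/andP[_ m'K] _].
set d := m%:Z - m'%:Z.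
have dK : (`|d| <= K)%N by apply: absz_sub_le; rewrite -ltnS.
have dK' : (`|- d| <= K)%N by rewrite abszN.
transitivity (\sum_(0 <= k < Q) (K.+1%:R^-1 / 2) *
   (cos (a - d%:~R * (2 * pi * beta i) + 2 * pi * (l + d * f i)%:~R / Q%:R * k%:R) * prodf s k +
    cos (a + d%:~R * (2 * pi * beta i) + 2 * pi * (l + - d * f i)%:~R / Q%:R * k%:R) * prodf s k)).
  apply: eq_bigr => k _.
  set th := a + _; set A := d%:~R * ph i k.
  have -> : a - d%:~R * (2 * pi * beta i) + 2 * pi * (l + d * f i)%:~R / Q%:R * k%:R = th + A.
    rewrite /th /A /ph intrD intrM; field; exact: QR.
  have -> : a + d%:~R * (2 * pi * beta i) + 2 * pi * (l + - d * f i)%:~R / Q%:R * k%:R = th - A.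
    rewrite /th /A /ph intrD intrM mulrNz; field; exact: QR.
  rewrite cosD cosB -/(prodf s k); move: (K.+1%:R^-1) (prodf s k) (cos th) (sin th) (cos A) (sin A) => *.
  by field.
by rewrite -mulr_sumr big_split /= !step// addr0 mulr0.
Qed.

Lemma avg_prod1 (s : seq 'I_n) : uniq s -> \sum_(0 <= k < Q) prodf s k = Q%:R.
Proof.
elim: s => [|i s IHs] /=.
  by move=> _; under eq_bigr do rewrite /prodf big_nil; rewrite sumr_const_nat subn0.
move=> /andP[is_ us].
have QR : Q%:R != 0 :> R by rewrite pnatr_eq0 -lt0n.
under eq_bigr => k _.
  rewrite /prodf big_cons -/(prodf s k) fej_sum mulr_suml; over.
rewrite exchange_big /=.
transitivity (\sum_(0 <= m < K.+1) K.+1%:R^-1 * (Q%:R : R)); last first.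
  by rewrite sumr_const_nat subn0 -[LHS]mulr_natr mulrAC mulVf ?mul1r// pnatr_eq0.
rewrite !big_nat; apply: eq_bigr => m /andP[_ mK].
under eq_bigr do rewrite mulr_suml.
rewrite exchange_big /= (bigD1_seq m) ?mem_index_iota ?iota_uniq//=.
rewrite [X in _ + X]big1_seq ?addr0.
  rewrite -(IHs us) mulr_sumr; apply: eq_bigr => k _.
  by rewrite subrr mul0r cos0 mulr1.
move=> m' /andP[mm']; rewrite mem_index_iota => /andP[_ m'K].
set d := m%:Z - m'%:Z.
have dK : (`|d| <= K)%N by apply: absz_sub_le; rewrite -ltnS.
have d0 : d != 0 by rewrite subr_eq0 eqz_nat eq_sym.
transitivity (K.+1%:R^-1 * \sum_(0 <= k < Q)
    cos (- (d%:~R * (2 * pi * beta i)) + 2 * pi * (d * f i)%:~R / Q%:R * k%:R) * prodf s k).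
  rewrite mulr_sumr; apply: eq_bigr => k _; rewrite [RHS]mulrA -/(prodf s k).
  congr (_ * cos _ * _); rewrite /ph intrM; field; exact: QR.
rewrite avg_prod0 ?mulr0// => c cK cs; apply/negP => D.
pose c' j := if j == i then d else c j.
have c'K j : (`|c' j| <= K)%N by rewrite /c'; case: eqP.
have E : d * f i + \sum_j c j * f j = \sum_j c' j * f j.
  rewrite [RHS](bigD1 i)//= {1}/c' eqxx; congr (_ + _).
  rewrite (bigD1 i)//= (cs i is_) mul0r add0r.
  by apply: eq_bigr => j /negbTE ji; rewrite /c' ji.
rewrite E in D.
(* A relation modulo [Q] is a true relation: by [Q_gt] the sum is smaller than [Q] in absolute
   value. *)
have S0 : \sum_j c' j * f j = 0.
  apply/eqP; rewrite -absz_eq0 -leqn0 leqNgt; apply/negP => S0.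
  have := dvdn_leq S0 D; rewrite leqNgt => /negP; apply; apply: leq_ltn_trans Q_gt.
  rewrite -lez_nat abszE (le_trans (ler_norm_sum _ _ _))//.
  have -> : (K * \sum_i `|f i|)%:Z = \sum_i K%:Z * `|f i|.
    by rewrite PoszM -mulr_sumr; congr (_ * _); elim/big_rec2: _ => // j x y _ <-; rewrite PoszD abszE.
  by apply: ler_sum => j _; rewrite normrM ler_wpM2r// -abszE lez_nat.
by have := f_indep c'K S0 i; rewrite /c' eqxx; apply/eqP.
Qed.

(** If every grid point failed, the sum of the [1 - cos (ph i k)] would be at least [eta]
    everywhere. Weight it with the product of the kernels, which has mean 1. Each [1 - cos] is
    absorbed by its own kernel at the cost [2 / (K + 1)], and the remaining product again has mean
    1; so [eta <= 2 * n / (K + 1)]. *)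
Lemma kronecker_grid (eta : R) : 0 < eta -> 2 * n%:R / K.+1%:R < eta ->
  exists k, (k < Q)%N /\ forall i, 1 - eta < cos (2 * pi * ((f i)%:~R * (k%:R / Q%:R) - beta i)).
Proof.
move=> eta0 nK; apply: contrapT => H.
have QR : 0 < Q%:R :> R by rewrite ltr0n.
have prod_ge0 s k : 0 <= prodf s k by apply: prodr_ge0 => i _; exact: fej_ge0.
have uE : uniq (enum 'I_n) := enum_uniq _.
have L k : (k < Q)%N -> eta * prodf (enum 'I_n) k <= \sum_i (1 - cos (ph i k)) * prodf (enum 'I_n) k.
  move=> kQ; have [i Hi] : exists i, cos (ph i k) <= 1 - eta.
    apply: contrapT => H2; apply: H; exists k; split => // i; rewrite ltNge; apply/negP => H3.
    by apply: H2; exists i.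
  rewrite (bigD1 i)//=; apply: (@le_trans _ _ ((1 - cos (ph i k)) * prodf (enum 'I_n) k)).
    by rewrite ler_wpM2r//; lra.
  by rewrite lerDl sumr_ge0// => j _; rewrite mulr_ge0// subr_ge0 cos_le1.
have U i k : (1 - cos (ph i k)) * prodf (enum 'I_n) k <= 2 / K.+1%:R * prodf (rem i (enum 'I_n)) k.
  rewrite {1}/prodf (perm_big _ (perm_to_rem (_ : i \in enum 'I_n))) ?mem_enum//= big_cons.
  rewrite mulrA -/(prodf _ k) ler_wpM2r// mulrC; exact: fej_one_minus_cos.
have : eta * Q%:R <= \sum_(i < n) 2 / K.+1%:R * Q%:R.
  rewrite -(avg_prod1 uE) mulr_sumr.
  apply: (@le_trans _ _ (\sum_(0 <= k < Q) \sum_i (1 - cos (ph i k)) * prodf (enum 'I_n) k)).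
    by apply: ler_sum_nat => k /andP[_ kQ]; apply: L.
  rewrite exchange_big /=; apply: ler_sum => i _.
  rewrite avg_prod1// -(avg_prod1 (rem_uniq i uE)) mulr_sumr.
  by apply: ler_sum => k _; exact: U.
rewrite sumr_const card_ord -[X in _ <= X]mulr_natl mulrA ler_pM2r// leNgt => /negP; apply.
by apply: le_lt_trans nK; rewrite mulrA (mulrC n%:R).
Qed.

End Independent.

Lemma kronecker (n : nat) (kappa : R) : 0 < kappa -> exists C : nat,
  forall f : 'I_n -> int,
  (forall c : 'I_n -> int, (forall i, (`|c i| <= C)%N) -> \sum_i c i * f i = 0 -> forall i, c i = 0) ->
  forall beta : 'I_n -> R, exists t, 0 <= t <= 1 /\ exists2 tau : R, 0 < tau &
  forall t', `|t' - t| < tau -> forall i, exists N : int, `|(f i)%:~R * t' - beta i - N%:~R| <= kappa.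
Proof.
move=> k0; have [eta eta0 Heta] := near_int k0.
have e2 : 0 < eta / 2 by rewrite divr_gt0.
pose C := Num.truncn (2 * n%:R / (eta / 2)).
exists C => f find beta.
have nC : 2 * n%:R / C.+1%:R < eta / 2.
  by rewrite ltr_pdivrMr ?ltr0n// [ltRHS]mulrC -ltr_pdivrMr//; exact: truncnS_gt.
pose Q := (C * \sum_i `|f i|).+1%N.
have [k [kQ Hk]] := kronecker_grid beta find (ltnSn _ : (_ < Q)%N) e2 nC.
have QR : 0 < Q%:R :> R by rewrite ltr0n.
pose F : R := \sum_i `|(f i)%:~R|.
have F0 : 0 <= F by apply: sumr_ge0.
have p0 := pi_gt0 R.
have P0 : 0 < 2 * pi * (F + 1) by rewrite mulr_gt0 ?mulr_gt0// ltr_wpDl.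
exists (k%:R / Q%:R); split.
  by apply/andP; split; [rewrite divr_ge0 | rewrite ler_pdivrMr// mul1r ler_nat ltnW].
exists (eta / 2 / (2 * pi * (F + 1))); first by rewrite divr_gt0.
move=> t' tt i; apply: Heta.
have := Hk i; set A := 2 * pi * (_ - _); set A' := 2 * pi * (_ - _) => HA.
have : `|cos A - cos A'| < eta / 2.
  rewrite (le_lt_trans (cos_lip _ _))//.
  have -> : A - A' = - (2 * pi * (f i)%:~R * (t' - k%:R / Q%:R)) by rewrite /A /A'; ring.
  rewrite normrN !normrM (ger0_norm (ler0n _ 2)) (gtr0_norm p0).
  have Fi : `|(f i)%:~R| <= F + 1 :> R.
    apply: (@le_trans _ _ F); last by rewrite lerDl.
    by rewrite /F (bigD1 i)//= lerDl sumr_ge0.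
  apply: (@le_lt_trans _ _ (2 * pi * (F + 1) * `|t' - k%:R / Q%:R|)).
    by rewrite ler_wpM2r// ler_wpM2l// mulr_ge0// ltW.
  by rewrite mulrC -ltr_pdivlMr.
by rewrite ltr_norml => /andP[_]; lra.
Qed.

End Kronecker.

(** * Blocks of waves *)

Section Alternation.
Variable R : realType.

(** Consecutive angles get opposite signs, so a pair costs at most [L] times its gap; the gaps add
    up to at most [hi - lo], and one unpaired term costs [B]. The signs do not depend on [f]. *)
Lemma alternate_sorted (J : eqType) (th : J -> R) (lo hi : R) (s : seq J) :
  uniq s -> sorted (fun i j => th i <= th j) s -> (forall j, j \in s -> lo <= th j <= hi) -> lo <= hi ->
  exists eps : J -> bool, forall (f : R -> R) (B L : R), 0 <= B -> 0 <= L ->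
    (forall x, `|f x| <= B) -> (forall x y, `|f x - f y| <= L * `|x - y|) ->
    `|\sum_(j <- s) (-1) ^+ eps j * f (th j)| <= B + L * (hi - lo).
Proof.
have [n] := ubnP (size s); elim: n s lo => // n IHn [|j1 [|j2 s]] lo sn us so sin lohi.
- exists (fun=> false) => f B L B0 L0 _ _; rewrite big_nil normr0 addr_ge0// mulr_ge0// subr_ge0//.
- exists (fun=> false) => f B L B0 L0 fB _; rewrite big_seq1 mul1r (le_trans (fB _))// lerDl.
  by rewrite mulr_ge0// subr_ge0.
have /andP[l1 h1] := sin j1 (mem_head _ _).
have j2in : j2 \in [:: j1, j2 & s] by rewrite !inE eqxx orbT.
have /andP[l2 h2] := sin j2 j2in.
move: so => /= /andP[t12 pt].
have us' : uniq s by move: us => /= /andP[_ /andP[_]].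
have tr : transitive (fun i j => th i <= th j) by move=> a b c; exact: le_trans.
have := pt; rewrite (path_sortedE tr) => /andP[/allP al ss].
have [||eps H] := IHn s (th j2) _ us' ss _ h2; first exact: ltnW.
  move=> j js; rewrite al//=; have /sin/andP[] // : j \in [:: j1, j2 & s].
  by rewrite !inE js !orbT.
exists (fun j => if j == j1 then false else if j == j2 then true else eps j) => f B L B0 L0 fB fL.
have j12 : (j2 == j1) = false.
  by move: us; rewrite /= inE negb_or eq_sym => /andP[/andP[/negbTE]].
rewrite !big_cons eqxx j12 eqxx mul1r expr1 mulN1r.
rewrite (eq_big_seq (fun j => (-1) ^+ eps j * f (th j))); last first.
  move=> j js; have -> : (j == j1) = false.
    by apply/negP => /eqP ej; move: us; rewrite /= inE -ej js orbT.
  have -> // : (j == j2) = false.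
  by apply/negP => /eqP ej; move: us; rewrite /= -ej js andbF.
rewrite addrA (le_trans (ler_normD _ _))//.
have E1 := H f B L B0 L0 fB fL.
have E2 : `|f (th j1) - f (th j2)| <= L * (th j2 - th j1).
  by rewrite (le_trans (fL _ _))// distrC ger0_norm// subr_ge0.
have E3 : L * (th j2 - th j1) <= L * (th j2 - lo) by rewrite ler_wpM2l// lerD2l lerN2.
have -> : B + L * (hi - lo) = L * (th j2 - lo) + (B + L * (hi - th j2)) by ring.
by apply: lerD => //; apply: le_trans E3.
Qed.

Lemma alternate (J : eqType) (th : J -> R) (hi : R) (s : seq J) :
  uniq s -> (forall j, 0 <= th j <= hi) -> 0 <= hi ->
  exists eps : J -> bool, forall (f : R -> R) (B L : R), 0 <= B -> 0 <= L ->
    (forall x, `|f x| <= B) -> (forall x y, `|f x - f y| <= L * `|x - y|) ->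
    `|\sum_(j <- s) (-1) ^+ eps j * f (th j)| <= B + L * hi.
Proof.
move=> us h h0; pose le i j := th i <= th j.
have tot : total le by move=> i j; exact: le_total.
have [||||eps H] := @alternate_sorted J th 0 hi (sort le s) => //.
- by rewrite sort_uniq.
- exact: sort_sorted.
exists eps => f B L B0 L0 fB fL; have := H f B L B0 L0 fB fL.
by rewrite subr0 (perm_big s)// perm_sort.
Qed.

(** A block depends on its sign pattern as well as on its angle, so the alternation is carried out
    within each pattern class. *)
Lemma alternate_classes (J : eqType) (K : finType) (kap : J -> K) (th : J -> R) (hi : R) (s : seq J) :
  uniq s -> (forall j, 0 <= th j <= hi) -> 0 <= hi ->
  exists eps : J -> bool, forall (f : K -> R -> R) (B L : R), 0 <= B -> 0 <= L ->
    (forall k x, `|f k x| <= B) -> (forall k x y, `|f k x - f k y| <= L * `|x - y|) ->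
    `|\sum_(j <- s) (-1) ^+ eps j * f (kap j) (th j)| <= #|K|%:R * (B + L * hi).
Proof.
move=> us h h0.
have /choice[ep Hep] k := alternate (filter_uniq (fun j => kap j == k) us) h h0.
exists (fun j => ep (kap j) j) => f B L B0 L0 fB fL.
rewrite (eq_bigr (fun j => \sum_(k : K | kap j == k) (-1) ^+ ep k j * f k (th j))); last first.
  by move=> j _; rewrite (big_pred1 (kap j))// => k; rewrite eq_sym.
rewrite (exchange_big_dep predT)//=.
rewrite (le_trans (ler_norm_sum _ _ _))// -sum1_card natr_sum mulr_suml.
by apply: ler_sum => k _; rewrite mul1r -big_filter; apply: Hep.
Qed.

End Alternation.

(** * Blocks and their quadrature formula *)

Section Core.
Variable R : realType.

(* [P] and [Q] abstract the values at a fixed point of a fixed partial derivative of the plane waves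
   with frequency [(a, b)] and phase [0], resp. [pi / 2]; [ev] is then its value for phase [e]. *)
Definition ev (P Q : R -> R -> R) a b e := cos e * P a b + sin e * Q a b.

(** The choice of the blocks relies on these properties only, so a single choice works for every
    derivative and every point with the common constant [L]. *)
Record wavefun (L : R) (P Q : R -> R -> R) : Prop := {
  wf_even : forall a b, P (- a) (- b) = P a b;
  wf_odd : forall a b, Q (- a) (- b) = - Q a b;
  wf_bP : forall a b, a ^+ 2 + b ^+ 2 = 1 -> `|P a b| <= 1;
  wf_bQ : forall a b, a ^+ 2 + b ^+ 2 = 1 -> `|Q a b| <= 1;
  wf_lP : forall a b a' b', a ^+ 2 + b ^+ 2 = 1 -> a' ^+ 2 + b' ^+ 2 = 1 ->
    `|P a b - P a' b'| <= L * (`|a - a'| + `|b - b'|);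
  wf_lQ : forall a b a' b', a ^+ 2 + b ^+ 2 = 1 -> a' ^+ 2 + b' ^+ 2 = 1 ->
    `|Q a b - Q a' b'| <= L * (`|a - a'| + `|b - b'|) }.

Lemma ev_le2 L P Q a b e : wavefun L P Q -> a ^+ 2 + b ^+ 2 = 1 -> `|ev P Q a b e| <= 2.
Proof.
move=> H ab; have bP := wf_bP H ab; have bQ := wf_bQ H ab.
rewrite /ev (le_trans (ler_normD _ _))// !normrM.
have -> : 2 = 1 * 1 + 1 * 1 :> R by ring.
by apply: lerD; apply: ler_pM => //; [exact: cos_max | exact: sin_max].
Qed.

Lemma ev_lip L P Q a b a' b' e : wavefun L P Q -> a ^+ 2 + b ^+ 2 = 1 -> a' ^+ 2 + b' ^+ 2 = 1 ->
  `|ev P Q a b e - ev P Q a' b' e| <= 2 * L * (`|a - a'| + `|b - b'|).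
Proof.
move=> H ab ab'; have lP := wf_lP H ab ab'; have lQ := wf_lQ H ab ab'.
have -> : ev P Q a b e - ev P Q a' b' e = cos e * (P a b - P a' b') + sin e * (Q a b - Q a' b').
  by rewrite /ev; ring.
rewrite (le_trans (ler_normD _ _))// !normrM.
have -> : 2 * L * (`|a - a'| + `|b - b'|) = 1 * (L * (`|a - a'| + `|b - b'|)) + 1 * (L * (`|a - a'| + `|b - b'|)) by ring.
by apply: lerD; apply: ler_pM => //; [exact: cos_max | exact: sin_max].
Qed.

Lemma ev_phase L P Q a b e e' : wavefun L P Q -> a ^+ 2 + b ^+ 2 = 1 ->
  `|ev P Q a b e - ev P Q a b e'| <= 2 * `|e - e'|.
Proof.
move=> H ab; have bP := wf_bP H ab; have bQ := wf_bQ H ab.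
have -> : ev P Q a b e - ev P Q a b e' = (cos e - cos e') * P a b + (sin e - sin e') * Q a b.
  by rewrite /ev; ring.
rewrite (le_trans (ler_normD _ _))// !normrM.
have -> : 2 * `|e - e'| = `|e - e'| * 1 + `|e - e'| * 1 by ring.
by apply: lerD; apply: ler_pM => //; [exact: cos_lip | exact: sin_lip].
Qed.

Lemma grid_orth (Q : nat) (m n : int) (al : R) : (0 < Q)%N ->
  \sum_(0 <= g1 < Q) \sum_(0 <= g2 < Q) cos (al + 2 * pi * (m%:~R * (g1%:R / Q%:R) + n%:~R * (g2%:R / Q%:R))) =
  ((Q%:Z %| m)%Z && (Q%:Z %| n)%Z)%:R * (Q%:R ^+ 2 * cos al).
Proof.
move=> Q0; have QR : Q%:R != 0 :> R by rewrite pnatr_eq0 -lt0n.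
have E g1 g2 : al + 2 * pi * (m%:~R * (g1%:R / Q%:R) + n%:~R * (g2%:R / Q%:R)) =
  (al + 2 * pi * m%:~R / Q%:R * g1%:R) + 2 * pi * n%:~R / Q%:R * g2%:R :> R by field.
under eq_bigr do under eq_bigr do rewrite E.
have [nQ|nQ] := boolP (Q%:Z %| n)%Z; last first.
  by rewrite andbF mul0r big1// => g1 _; rewrite sum_cos0.
rewrite andbT; under eq_bigr do rewrite sum_cos_dvd//.
rewrite -mulr_sumr; have [mQ|mQ] := boolP (Q%:Z %| m)%Z; last by rewrite sum_cos0// mulr0 mul0r.
by rewrite sum_cos_dvd// mul1r mulrA expr2.
Qed.

Variables (I : finType) (z : I -> gint) (ng : I -> I) (D : nat).
Hypotheses (D_gt0 : (0 < D)%N) (z_norm : forall l, gnorm (z l) = (D ^ 2)%:Z)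
  (z_inj : injective z) (z_ng : forall l, z (ng l) = - z l)
  (z_odd : forall l, exists m : int, (z l).1 - (z l).2 = 2 * m + 1).

(* [z l] runs through the Gaussian integers of norm [D ^ 2]; [dir1 + i dir2 = z l * exp (i t) / D],
   and [ph] is [2 * pi * Re (z l * W)] for [W] read as a complex number. *)
Definition dir1 l (t : R) : R := ((z l).1%:~R * cos t - (z l).2%:~R * sin t) / D%:R.
Definition dir2 l (t : R) : R := ((z l).1%:~R * sin t + (z l).2%:~R * cos t) / D%:R.
Definition ph l (W : R * R) : R := 2 * pi * ((z l).1%:~R * W.1 - (z l).2%:~R * W.2).

Definition blk P Q (pt : {ffun I -> bool}) t W : R :=
  \sum_l (-1) ^+ pt l * ev P Q (dir1 l t) (dir2 l t) (ph l W).

Let DR : 0 < D%:R :> R. Proof. by rewrite ltr0n. Qed.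

Lemma z_normR l : (z l).1%:~R ^+ 2 + (z l).2%:~R ^+ 2 = D%:R ^+ 2 :> R.
Proof.
have := f_equal (fun n : int => n%:~R : R) (z_norm l).
by rewrite /gnorm rmorphD /= !rmorphXn /= -pmulrn natrX.
Qed.

Lemma z_le1 l : `|(z l).1%:~R| <= D%:R :> R.
Proof.
rewrite -(@ler_pXn2r _ 2) ?nnegrE// real_normK ?num_real// -(z_normR l) lerDl sqr_ge0 //.
Qed.

Lemma z_le2 l : `|(z l).2%:~R| <= D%:R :> R.
Proof.
rewrite -(@ler_pXn2r _ 2) ?nnegrE// real_normK ?num_real// -(z_normR l) lerDr sqr_ge0 //.
Qed.

Lemma dir_unit l t : dir1 l t ^+ 2 + dir2 l t ^+ 2 = 1.
Proof.
rewrite /dir1 /dir2 !expr_div_n -mulrDl.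
have -> : ((z l).1%:~R * cos t - (z l).2%:~R * sin t) ^+ 2 + ((z l).1%:~R * sin t + (z l).2%:~R * cos t) ^+ 2
  = ((z l).1%:~R ^+ 2 + (z l).2%:~R ^+ 2) * (cos t ^+ 2 + sin t ^+ 2) :> R by ring.
by rewrite cos2Dsin2 mulr1 z_normR divff// expf_neq0// gt_eqF.
Qed.

Lemma dir_lip l t t' : `|dir1 l t - dir1 l t'| + `|dir2 l t - dir2 l t'| <= 4 * `|t - t'|.
Proof.
have K (p q A B : R) : `|p| <= D%:R -> `|q| <= D%:R -> `|A| <= `|t - t'| -> `|B| <= `|t - t'| ->
    `|(p * A + q * B) / D%:R| <= 2 * `|t - t'|.
  move=> hp hq hA hB; rewrite normrM normfV (gtr0_norm DR) ler_pdivrMr//.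
  rewrite (le_trans (ler_normD _ _))// !normrM.
  have -> : 2 * `|t - t'| * D%:R = D%:R * `|t - t'| + D%:R * `|t - t'| by ring.
  by apply: lerD; apply: ler_pM.
have -> : dir1 l t - dir1 l t' = ((z l).1%:~R * (cos t - cos t') + - (z l).2%:~R * (sin t - sin t')) / D%:R.
  by rewrite /dir1; ring.
have -> : dir2 l t - dir2 l t' = ((z l).1%:~R * (sin t - sin t') + (z l).2%:~R * (cos t - cos t')) / D%:R.
  by rewrite /dir2; ring.
have -> : 4 * `|t - t'| = 2 * `|t - t'| + 2 * `|t - t'| by ring.
by apply: lerD; apply: K; rewrite ?normrN ?z_le1 ?z_le2 ?cos_lip ?sin_lip.
Qed.

Lemma dir_ng l t : dir1 (ng l) t = - dir1 l t /\ dir2 (ng l) t = - dir2 l t.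
Proof. by rewrite /dir1 /dir2 z_ng /= !rmorphN /=; split; ring. Qed.

(* Since the coordinates of [z l] have opposite parities, a shift by a half period changes the sign. *)
Lemma blk_half P Q pt t (W : R * R) : blk P Q pt t (W.1 + 1 / 2, W.2 + 1 / 2) = - blk P Q pt t W.
Proof.
rewrite /blk -sumrN; apply: eq_bigr => l _; rewrite -mulrN; congr (_ * _).
have [m Hm] := z_odd l.
have -> : ph l (W.1 + 1 / 2, W.2 + 1 / 2) = ph l W + pi + 2 * pi * m%:~R.
  have e : (z l).1%:~R = (z l).2%:~R + 2 * m%:~R + 1 :> R.
    have -> : (z l).1 = (z l).2 + (2 * m + 1) by rewrite -Hm; ring.
    by rewrite !rmorphD /= rmorphM /= addrA.
  by rewrite /ph /= e; field.
by rewrite /ev cosDz sinDz cosDpi sinDpi; ring.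
Qed.

Lemma blk_le L P Q pt t W : wavefun L P Q -> `|blk P Q pt t W| <= #|I|%:R * 2.
Proof.
move=> H; rewrite (le_trans (ler_norm_sum _ _ _))// -sum1_card natr_sum mulr_suml.
apply: ler_sum => l _; rewrite mul1r normrM normrX normrN1 expr1n mul1r.
exact: ev_le2 H (dir_unit _ _).
Qed.

Lemma blk_lip L P Q pt t t' W : wavefun L P Q -> 0 <= L ->
  `|blk P Q pt t W - blk P Q pt t' W| <= #|I|%:R * (8 * L) * `|t - t'|.
Proof.
move=> H L0; rewrite /blk -sumrB (le_trans (ler_norm_sum _ _ _))// -mulrA -sum1_card natr_sum mulr_suml.
apply: ler_sum => l _; rewrite mul1r -mulrBr normrM normrX normrN1 expr1n mul1r.
rewrite (le_trans (ev_lip _ H (dir_unit _ _) (dir_unit _ _)))//.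
have -> : 8 * L * `|t - t'| = 2 * L * (4 * `|t - t'|) by ring.
by rewrite ler_wpM2l ?mulr_ge0// dir_lip.
Qed.

Lemma sum_indicator (i : I) (G : I -> R) : \sum_l (l == i)%:R * G l = G i.
Proof.
rewrite (bigD1 i)//= eqxx mul1r big1 ?addr0// => l /negbTE ->; by rewrite mul0r.
Qed.

(** The weight, multiplied by a wave of the block, splits into a sum and a difference of phases.
    Orthogonality keeps the wave of [z i] from one and that of [- z i] from the other, and together
    they form [ev] with the prescribed phase [e]. Frequencies differ by at most [2 * D] in each
    coordinate, hence [2 * D < N] excludes aliasing. *)
Lemma blk_grid L P Q (pt : {ffun I -> bool}) (t : R) (N : nat) i e : wavefun L P Q -> (2 * D < N)%N ->
  (forall l, pt (ng l) = pt l) ->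
  \sum_(0 <= g1 < N) \sum_(0 <= g2 < N)
    cos (e - ph i (g1%:R / N%:R, g2%:R / N%:R)) * blk P Q pt t (g1%:R / N%:R, g2%:R / N%:R) =
  N%:R ^+ 2 * ((-1) ^+ pt i * ev P Q (dir1 i t) (dir2 i t) e).
Proof.
move=> H ND ptng; have N0 : (0 < N)%N by apply: leq_ltn_trans ND.
have small (x y : int) : `|x%:~R : R| <= D%:R -> `|y%:~R : R| <= D%:R -> (N%:Z %| (x - y))%Z = (x == y).
  move=> hx hy; apply/idP/eqP => [|->]; last by rewrite subrr dvdz0.
  move=> dv; apply/eqP; rewrite -subr_eq0 -absz_eq0 -leqn0 leqNgt; apply/negP => pos.
  have := dvdn_leq pos dv; rewrite leqNgt => /negP; apply; apply: leq_ltn_trans ND.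
  rewrite -(ler_nat R) pmulrn abszE intr_norm rmorphB /= (le_trans (ler_normB _ _))//.
  by rewrite mul2n -addnn natrD lerD.
pose g a b : R * R := (a%:R / N%:R, b%:R / N%:R).
pose P' l := P (dir1 l t) (dir2 l t); pose Q' l := Q (dir1 l t) (dir2 l t).
have orth1 l al : \sum_(0 <= a < N) \sum_(0 <= b < N) cos (al - ph i (g a b) + ph l (g a b)) =
    (l == i)%:R * (N%:R ^+ 2 * cos al).
  have E a b : al - ph i (g a b) + ph l (g a b) = al + 2 * pi *
    (((z l).1 - (z i).1)%:~R * (a%:R / N%:R) + ((z i).2 - (z l).2)%:~R * (b%:R / N%:R)).
    by rewrite /ph !rmorphB /=; ring.
  under eq_bigr do under eq_bigr do rewrite E.
  rewrite grid_orth// !small ?z_le1 ?z_le2// [in X in _ && X]eq_sym; congr (_%:R * _).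
  by rewrite -(inj_eq z_inj); case: (z l) (z i) => ? ? [? ?].
have orth2 l al : \sum_(0 <= a < N) \sum_(0 <= b < N) cos (al - ph i (g a b) - ph l (g a b)) =
    (l == ng i)%:R * (N%:R ^+ 2 * cos al).
  have E a b : al - ph i (g a b) - ph l (g a b) = al + 2 * pi *
    (((- z i).1 - (z l).1)%:~R * (a%:R / N%:R) + ((z l).2 - (- z i).2)%:~R * (b%:R / N%:R)).
    by rewrite /ph /= !rmorphB /= !rmorphN /=; ring.
  under eq_bigr do under eq_bigr do rewrite E.
  rewrite grid_orth// !small ?z_le1 ?z_le2 /= ?rmorphN ?normrN ?z_le1 ?z_le2//.
  rewrite [in X in X && _]eq_sym; congr (_%:R * _).
  by rewrite -(inj_eq z_inj) z_ng; case: (z l) (z i) => ? ? [? ?].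
transitivity (\sum_l (-1) ^+ pt l * (N%:R ^+ 2 / 2 * (
   (l == i)%:R * (cos e * P' l + sin e * Q' l) + (l == ng i)%:R * (cos e * P' l - sin e * Q' l)))).
  under eq_bigr do under eq_bigr do rewrite /blk mulr_sumr.
  under eq_bigr do rewrite exchange_big /=.
  rewrite exchange_big /=; apply: eq_bigr => l _.
  transitivity ((-1) ^+ pt l / 2 * (
     P' l * (\sum_(0 <= a < N) \sum_(0 <= b < N) cos (e - ph i (g a b) + ph l (g a b)) +
             \sum_(0 <= a < N) \sum_(0 <= b < N) cos (e - ph i (g a b) - ph l (g a b))) +
     Q' l * (\sum_(0 <= a < N) \sum_(0 <= b < N) cos (e - pi / 2 - ph i (g a b) + ph l (g a b)) -
             \sum_(0 <= a < N) \sum_(0 <= b < N) cos (e - pi / 2 - ph i (g a b) - ph l (g a b))))).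
    rewrite -big_split -sumrB /= !mulr_sumr -big_split /= mulr_sumr.
    apply: eq_bigr => a _; rewrite -big_split -sumrB /= !mulr_sumr -big_split /= mulr_sumr.
    apply: eq_bigr => b _; rewrite -/(g a b) /ev -/(P' l) -/(Q' l).
    have -> : e - pi / 2 - ph i (g a b) + ph l (g a b) = (e - ph i (g a b) + ph l (g a b)) - pi / 2 by ring.
    have -> : e - pi / 2 - ph i (g a b) - ph l (g a b) = (e - ph i (g a b) - ph l (g a b)) - pi / 2 by ring.
    rewrite !cosBpihalf (cosD (_ - _)) (cosB (_ - _) (ph l _)) (sinD (_ - _)) (sinB (_ - _) (ph l _)).
    move: (cos (e - _)) (sin (e - _)) (cos (ph l _)) (sin (ph l _)) (P' l) (Q' l) ((-1) ^+ _) => *.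
    by field.
  rewrite !orth1 !orth2 cosBpihalf.
  by move: (_ == i)%:R (_ == ng i)%:R ((-1) ^+ _) => *; field.
have alg (s p q : R) (x y : R) : s * (N%:R ^+ 2 / 2 * (x * p + y * q)) =
  x * (N%:R ^+ 2 / 2 * (s * p)) + y * (N%:R ^+ 2 / 2 * (s * q)) by ring.
under eq_bigr do rewrite alg.
rewrite big_split /= !sum_indicator ptng /P' /Q'; have [-> ->] := dir_ng i t.
by rewrite (wf_even H) (wf_odd H) /ev; field.
Qed.

End Core.

(** * Approximation by blocks with uncontrolled angles and signs *)

Section Assembly.
Variable R : realType.
Variables (I : finType) (z : I -> gint) (ng : I -> I) (D : nat).
Hypotheses (D_gt0 : (0 < D)%N) (z_norm : forall l, gnorm (z l) = (D ^ 2)%:Z)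
  (z_inj : injective z) (z_ng : forall l, z (ng l) = - z l)
  (z_odd : forall l, exists m : int, (z l).1 - (z l).2 = 2 * m + 1).

Local Notation dir1 := (@dir1 R I z D).
Local Notation dir2 := (@dir2 R I z D).
Local Notation blk := (@blk R I z D).
Local Notation ph := (@ph R I z).

Lemma pigeonhole_real (K : finType) n (kap : 'I_n -> K) (x : R) :
  #|K|%:R * x < n%:R -> exists k, x <= #|[pred j | kap j == k]|%:R.
Proof.
move=> H; apply: contrapT => H2; move: H; apply/negP; rewrite -leNgt.
have -> : n%:R = \sum_k #|[pred j | kap j == k]|%:R :> R.
  rewrite -natr_sum; congr _%:R; rewrite -[LHS](card_ord n) -sum1_card.
  rewrite (partition_big kap predT)//=; apply: eq_bigr => k _.
  by rewrite -sum1_card; apply: eq_bigl => j.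
rewrite mulr_natl -sumr_const; apply: ler_sum => k _.
by rewrite leNgt; apply/negP => h; apply: H2; exists k; exact: ltW.
Qed.

Lemma cell_dist (x c d : R) : c * d <= x -> x < (c + 1) * d -> `|x - c * d| <= d.
Proof. by move=> c1 c2; rewrite ger0_norm; lra. Qed.

Lemma sum_jobs (A B : Type) (s : seq A) (m : A -> nat) (x : A -> B) (G : B -> R) :
  \sum_(W <- flatten [seq nseq (m q) (x q) | q <- s]) G W = \sum_(q <- s) (m q)%:R * G (x q).
Proof.
rewrite big_flatten big_map; apply: eq_bigr => q _.
by rewrite big_nseq iter_addr addr0 mulr_natl.
Qed.

Lemma assign (n : nat) (G : seq 'I_n) (Ls : seq (R * R)) (W0 : 'I_n -> R * R) :
  uniq G -> (size Ls <= size G)%N -> exists W : 'I_n -> R * R,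
  [seq W j | j <- take (size Ls) G] = Ls /\ forall j, j \notin take (size Ls) G -> W j = W0 j.
Proof.
move=> uG sLG; set G1 := take (size Ls) G.
have uG1 : uniq G1 by rewrite take_uniq.
have sz : size G1 = size Ls by rewrite size_takel.
exists (fun j => if j \in G1 then nth (0, 0) Ls (index j G1) else W0 j); split.
  apply: (@eq_from_nth _ (0, 0)); first by rewrite size_map.
  move=> i; rewrite size_map => iG.
  have [j0 _] : exists j0 : 'I_n, true by move: iG; case: (G1) => // j0; exists j0.
  by rewrite (nth_map j0)// mem_nth// index_uniq.
by move=> j /negbTE ->.
Qed.

Lemma sum_split_seq (n : nat) (G1 : seq 'I_n) (f : 'I_n -> R) : uniq G1 ->
  \sum_j f j = \sum_(j <- G1) f j + \sum_(j <- [seq j <- enum 'I_n | j \notin G1]) f j.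
Proof.
move=> uG; rewrite -[LHS]big_enum (bigID (mem G1))/= -[X in _ + X]big_filter -[X in X + _]big_filter.
congr (_ + _); apply: perm_big; apply: uniq_perm => //; first by rewrite filter_uniq// enum_uniq.
by move=> j; rewrite mem_filter mem_enum andbT.
Qed.

(** [n0] is uniform in the angles and signs, which are known only after [p]. The factor under the
    root is the number of index pairs: the [#|I| * n] lattice points come in fours. *)
Theorem approx_blocks (L eps delta : R) (tg : seq (R * (R * R * R))) :
  0 <= L -> 0 < eps ->
  (forall p, p \in tg -> p.2.1.1 ^+ 2 + p.2.1.2 ^+ 2 = 1) ->
  (forall t X Y, X ^+ 2 + Y ^+ 2 = 1 -> exists l, `|dir1 l t - X| + `|dir2 l t - Y| <= delta) ->
  (\sum_(p <- tg) `|p.1|) * (2 * L * delta) <= eps / 4 ->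
  exists n0, forall n, (n0 <= n)%N -> forall (th : 'I_n -> R) (pt : 'I_n -> {ffun I -> bool}),
  (forall j, 0 <= th j <= 2 * pi) -> (forall j l, pt j (ng l) = pt j l) ->
  exists W : 'I_n -> R * R, forall P Q, wavefun L P Q ->
    `|(Num.sqrt (#|I|%:R * n%:R / 4))^-1 * (\sum_j blk P Q (pt j) (th j) (W j))
      - \sum_(p <- tg) p.1 * ev P Q p.2.1.1 p.2.1.2 p.2.2| <= eps.
Proof.
move=> L0 eps0 tgu dens small.
have e4 : 0 < eps / 4 by rewrite divr_gt0.
set Ct := \sum_(p <- tg) `|p.1| in small.
have Ct0 : 0 <= Ct by apply: sumr_ge0.
have I0 : (0 < #|I|)%N.
  have [|l _] := dens 0 1 0; first by rewrite expr1n expr0n /= addr0.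
  by apply/card_gt0P; exists l.
have IR : 0 < #|I|%:R :> R by rewrite ltr0n.
(* The angles lie in [[0, 8]], cut into [H] cells. Moving an angle to the left end of its cell
   changes the at most [nu * Ct] blocks in use by at most [nu * eps / 4] altogether. *)
pose H := (Num.truncn (Ct * (#|I|%:R * (8 * L) * 8) / (eps / 4))).+1.
have HR : 0 < H%:R :> R by rewrite ltr0n.
have HH : Ct * (#|I|%:R * (8 * L) * (8 / H%:R)) <= eps / 4.
  have -> : Ct * (#|I|%:R * (8 * L) * (8 / H%:R)) = Ct * (#|I|%:R * (8 * L) * 8) / H%:R.
    by field; rewrite gt_eqF.
  rewrite ler_pdivrMr// [leRHS]mulrC -ler_pdivrMr//; apply: ltW; exact: truncnS_gt.
pose N := (2 * D).+1.
have NR : 0 < N%:R :> R by rewrite ltr0n.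
pose K := ({ffun I -> bool} * 'I_H)%type.
have p0 := pi_gt0 R.
(* [E3] pays for rounding the quadrature multiplicities to integers, less than one block for each
   plane wave and grid point; [E4] is the bound of [alternate_classes] for the remaining blocks.
   Neither grows with [n]. *)
pose E3 : R := (size tg)%:R * N%:R ^+ 2 * (#|I|%:R * 2).
pose E4 : R := #|{ffun I -> bool}|%:R * (#|I|%:R * 2 + #|I|%:R * (8 * L) * (2 * pi)).
have E30 : 0 <= E3 by rewrite !mulr_ge0// exprn_ge0.
have E40 : 0 <= E4 by rewrite !mulr_ge0// addr_ge0 ?mulr_ge0// ltW.
(* Since [nu] is of order [sqrt n], [A1 < n] yields a class with at least [nu * (Ct + 1)] blocks,
   and [A2 < n] makes [E3 + E4] at most [nu * eps / 4]. *)
pose A1 : R := (#|{: K}|%:R * (Ct + 1)) ^+ 2 * #|I|%:R.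
pose A2 : R := ((E3 + E4) / (eps / 4)) ^+ 2 * 4.
have A10 : 0 <= A1 by rewrite mulr_ge0// sqr_ge0.
have A20 : 0 <= A2 by rewrite mulr_ge0// sqr_ge0.
exists (Num.truncn (A1 + A2)).+1 => n nn th pt thr ptng.
have nA : A1 + A2 < n%:R by rewrite (lt_le_trans (truncnS_gt _))// ler_nat.
have nR : 0 < n%:R :> R by apply: le_lt_trans nA; exact: addr_ge0.
set nu := Num.sqrt _.
have nu2 : nu ^+ 2 = #|I|%:R * n%:R / 4 by rewrite sqr_sqrtr// divr_ge0// mulr_ge0// ltW.
have nu0 : 0 < nu by rewrite sqrtr_gt0 divr_gt0// mulr_gt0.
have small34 : E3 + E4 <= nu * (eps / 4).
  rewrite -ler_pdivrMr// -(@ler_pXn2r _ 2) ?nnegrE ?divr_ge0 ?addr_ge0 ?(ltW nu0) ?(ltW eps0)//.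
  rewrite nu2 ler_pdivlMr// -/A2 (@le_trans _ _ n%:R)//.
    by rewrite (le_trans _ (ltW nA))// lerDr.
  by rewrite ler_peMl ?(ltW nR)// (ler_nat R 1).
have cellP j : (Num.truncn (th j * H%:R / 8) < H)%N.
  have /andP[t0 t2] := thr j.
  rewrite -(ltr_nat R) (le_lt_trans (y := th j * H%:R / 8))//.
    by rewrite truncn_le divr_ge0// mulr_ge0// ltW.
  rewrite ltr_pdivrMr// mulrC ltr_pM2l//.
  have := pihalf_lt2 R; lra.
pose kap j : K := (pt j, Ordinal (cellP j)).
(* Blocks with equal signs and nearly equal angles: enough of them to produce the target. *)
have [[pts cs] Hcard] : exists k, nu * (Ct + 1) <= #|[pred j | kap j == k]|%:R.
  apply: pigeonhole_real.
  rewrite -(@ltr_pXn2r _ 2) ?nnegrE ?(ltW nR)//; last first.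
    by rewrite mulr_ge0// mulr_ge0 ?(ltW nu0)// addr_ge0.
  have -> : (#|{: K}|%:R * (nu * (Ct + 1))) ^+ 2 = A1 * n%:R / 4.
    rewrite mulrCA exprMn nu2 /A1; by field.
  rewrite expr2 ltr_pdivrMr//.
  have h1 : A1 * n%:R < n%:R * n%:R by rewrite ltr_pM2r// (le_lt_trans _ nA)// lerDl.
  by have := mulr_gt0 nR nR; move: h1; lra.
pose G := enum [pred j | kap j == (pts, cs)].
have uG : uniq G := enum_uniq _.
have GP j : j \in G -> pt j = pts /\ Num.truncn (th j * H%:R / 8) = cs.
  by rewrite mem_enum inE /kap => /eqP[-> <-].
have Gsz : nu * (Ct + 1) <= (size G)%:R by rewrite -cardE.
have [j0 j0G] : exists j, j \in G.
  have : 0 < (size G)%:R :> R by rewrite (lt_le_trans _ Gsz)// mulr_gt0// ltr_wpDl.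
  by rewrite ltr0n; case: (G) => // j s _; exists j; rewrite mem_head.
have ptsng l : pts (ng l) = pts l by have [<- _] := GP _ j0G.
pose ts : R := cs%:R * 8 / H%:R.
have near j : j \in G -> `|th j - ts| <= 8 / H%:R.
  move=> /GP[_ ej]; have /andP[t0 t2] := thr j.
  have a0 : 0 <= th j * H%:R / 8 by rewrite divr_ge0// mulr_ge0// ltW.
  have /andP[c1 c2] := truncn_itv a0; rewrite ej in c1 c2.
  rewrite ler_pdivlMr// -[X in _ * X](gtr0_norm HR) -normrM mulrBl /ts divfK ?gt_eqF//.
  move: c1 c2; rewrite ler_pdivlMr// ltr_pdivrMr// -(natr1 cs) => c1 c2.
  exact: cell_dist.
have /choice[lf Hlf] : forall p : R * (R * R * R), exists l, p \in tg ->
    `|dir1 l ts - p.2.1.1| + `|dir2 l ts - p.2.1.2| <= delta.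
  move=> p; case: (boolP (p \in tg)) => [ptg|_].
    by have [l Hl] := dens ts _ _ (tgu p ptg); exists l.
  by have /card_gt0P[l _] := I0; exists l.
pose gd := [seq (a, b) | a <- index_iota 0 N, b <- index_iota 0 N].
pose idx := [seq (p, g) | p <- tg, g <- gd].
pose pnt (g : nat * nat) : R * R := (g.1%:R / N%:R, g.2%:R / N%:R).
(* The grid point [pnt g] gets [tau] blocks by the quadrature formula [blk_grid]; a negative number
   of blocks is realised by a half-period shift. *)
pose tau (q : (R * (R * R * R)) * (nat * nat)) : R :=
  nu * (q.1.1 * (-1) ^+ pts (lf q.1) * cos (q.1.2.2 - ph (lf q.1) (pnt q.2)) / N%:R ^+ 2).
pose jobW q : R * R := if 0 <= tau q then pnt q.2 else ((pnt q.2).1 + 1 / 2, (pnt q.2).2 + 1 / 2).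
pose Ls := flatten [seq nseq (Num.truncn `|tau q|) (jobW q) | q <- idx].
have sgd : size gd = (N * N)%N by rewrite size_allpairs size_iota subn0.
have tau_sum : \sum_(q <- idx) `|tau q| <= nu * Ct.
  rewrite big_allpairs_dep /= /Ct mulr_sumr; apply: ler_sum => p _.
  apply: (@le_trans _ _ (\sum_(g <- gd) nu * `|p.1| / N%:R ^+ 2)).
    apply: ler_sum => g _; rewrite /tau /= !normrM normrX normrN1 expr1n mulr1 normfV.
    rewrite (gtr0_norm nu0) [`|N%:R ^+ 2|]ger0_norm ?exprn_ge0// -!mulrA ler_wpM2l ?(ltW nu0)//.
    by rewrite ler_wpM2l// ler_piMl ?invr_ge0 ?exprn_ge0// cos_max.
  rewrite big_const_seq count_predT sgd iter_addr addr0 -[X in X <= _]mulr_natr natrM -expr2.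
  by rewrite divfK// expf_neq0// gt_eqF.
have Lsz : (size Ls)%:R <= nu * Ct.
  rewrite (le_trans _ tau_sum)//.
  have -> : (size Ls)%:R = \sum_(W <- Ls) (1 : R).
    by rewrite big_const_seq count_predT iter_addr addr0 //.
  rewrite sum_jobs; apply: ler_sum => q _; rewrite mulr1.
  by rewrite truncn_le.
have LsG : (size Ls <= size G)%N.
  by rewrite -(ler_nat R) (le_trans Lsz)// (le_trans _ Gsz)// ler_wpM2l ?(ltW nu0)// lerDl.
have thr' j : 0 <= th j <= 2 * pi := thr j.
have p20 : 0 <= 2 * pi :> R by rewrite mulr_ge0// ltW.
pose G1 := take (size Ls) G.
have uG1 : uniq G1 by rewrite take_uniq.
(* The remaining blocks have alternating signs along increasing angles, hence a bounded sum. *)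
have [alt Halt] := alternate_classes pt (filter_uniq (fun j => j \notin G1) (enum_uniq 'I_n)) thr' p20.
pose Wa j : R * R := if alt j then (0 + 1 / 2, 0 + 1 / 2) else (0, 0).
have [W [HW1 HW2]] := assign Wa uG LsG.
exists W => P Q wf.
have [S2 HS2 ES2] : exists2 S2, `|S2| <= E4 &
    S2 = \sum_(j <- [seq j <- enum 'I_n | j \notin G1]) blk P Q (pt j) (th j) (W j).
  eexists; last reflexivity.
  have -> : \sum_(j <- [seq j <- enum 'I_n | j \notin G1]) blk P Q (pt j) (th j) (W j) =
     \sum_(j <- [seq j <- enum 'I_n | j \notin G1]) (-1) ^+ alt j * blk P Q (pt j) (th j) (0, 0).
    apply: eq_big_seq => j; rewrite mem_filter => /andP[jG _]; rewrite HW2// /Wa.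
    case: (alt j); last by rewrite mul1r.
    by rewrite (blk_half D z_odd P Q (pt j) (th j) (0, 0)) expr1 mulN1r.
  apply: (Halt (fun k t => blk P Q k t (0, 0))).
  - by rewrite mulr_ge0.
  - by rewrite mulr_ge0// mulr_ge0.
  - by move=> k t; exact: (blk_le D_gt0 z_norm _ _ _ wf).
  - by move=> k t t'; exact: (blk_lip D_gt0 z_norm _ _ _ _ wf L0).
pose S1 := \sum_(W <- Ls) blk P Q pts ts W.
have HS1 : `|\sum_(j <- G1) blk P Q (pt j) (th j) (W j) - S1| <= nu * Ct * (#|I|%:R * (8 * L) * (8 / H%:R)).
  rewrite /S1 -HW1 big_map -sumrB (le_trans (ler_norm_sum _ _ _))//.
  apply: (@le_trans _ _ (\sum_(j <- G1) #|I|%:R * (8 * L) * (8 / H%:R))).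
    rewrite big_seq [leRHS]big_seq; apply: ler_sum => j /mem_take jG.
    have [-> _] := GP _ jG.
    rewrite (le_trans (blk_lip D_gt0 z_norm _ _ _ _ wf L0))// ler_wpM2l// ?near//.
    by rewrite mulr_ge0// mulr_ge0.
  rewrite big_const_seq count_predT iter_addr addr0 -[X in X <= _]mulr_natl.
  by rewrite size_takel// ler_wpM2r// mulr_ge0 ?divr_ge0// mulr_ge0// mulr_ge0.
have b0 W' : `|blk P Q pts ts W'| <= #|I|%:R * 2 by exact: (blk_le D_gt0 z_norm _ _ _ wf).
pose T := \sum_(q <- idx) tau q * blk P Q pts ts (pnt q.2).
have HT : `|S1 - T| <= E3.
  rewrite /S1 /Ls sum_jobs /T -sumrB (le_trans (ler_norm_sum _ _ _))//.
  apply: (@le_trans _ _ (\sum_(q <- idx) #|I|%:R * 2)); last first.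
    rewrite big_const_seq count_predT iter_addr addr0 -[X in X <= _]mulr_natl size_allpairs sgd.
    by rewrite !natrM -expr2 /E3.
  apply: ler_sum => q _.
  have t0 : (0 : R) <= `|tau q| by [].
  have /andP[c1 c2] := truncn_itv t0.
  have -> : (Num.truncn `|tau q|)%:R * blk P Q pts ts (jobW q) - tau q * blk P Q pts ts (pnt q.2) =
     (if 0 <= tau q then 1 else -1) * ((Num.truncn `|tau q|)%:R - `|tau q|) * blk P Q pts ts (pnt q.2).
    rewrite /jobW; case: (leP 0 (tau q)) => tq; first by rewrite (ger0_norm tq); ring.
    by rewrite (ltr0_norm tq) (blk_half D z_odd); ring.
  have i1 : `|if 0 <= tau q then 1 else -1 : R| = 1 by case: ifP; rewrite ?normrN1 ?normr1.
  move: i1 c1 c2 {t0}; rewrite -(natr1 (Num.truncn _)); move: (if 0 <= tau q then _ else _ : R) (`|tau q|) (Num.truncn _)%:R => sg x c i1 c1 c2.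
  rewrite !normrM i1 mul1r -[leRHS]mul1r; apply: ler_pM => //.
  by have := @cell_dist x c 1; rewrite !mulr1 distrC; exact.
have ET : T = nu * \sum_(p <- tg) p.1 * ev P Q (dir1 (lf p) ts) (dir2 (lf p) ts) p.2.2.
  rewrite /T big_allpairs_dep /= mulr_sumr; apply: eq_bigr => p _.
  rewrite big_allpairs_dep /=.
  transitivity (nu * (p.1 * (-1) ^+ pts (lf p) / N%:R ^+ 2) *
     \sum_(0 <= g1 < N) \sum_(0 <= g2 < N) cos (p.2.2 - ph (lf p) (g1%:R / N%:R, g2%:R / N%:R)) *
         blk P Q pts ts (g1%:R / N%:R, g2%:R / N%:R)).
    rewrite mulr_sumr; apply: eq_bigr => a _; rewrite mulr_sumr; apply: eq_bigr => b _.
    by rewrite /tau /pnt /=; ring.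
  rewrite (blk_grid z_norm z_inj z_ng _ _ _ wf)//.
  have -> : nu * (p.1 * (-1) ^+ pts (lf p) / N%:R ^+ 2) *
    (N%:R ^+ 2 * ((-1) ^+ pts (lf p) * ev P Q (dir1 (lf p) ts) (dir2 (lf p) ts) p.2.2)) =
    nu * (p.1 * ev P Q (dir1 (lf p) ts) (dir2 (lf p) ts) p.2.2) *
    ((-1) ^+ pts (lf p) * (-1) ^+ pts (lf p)) * (N%:R ^+ 2 / N%:R ^+ 2) by ring.
  rewrite -expr2 sqrr_sign divff ?mulr1// expf_neq0// gt_eqF//.
have Hdir : `|\sum_(p <- tg) p.1 * ev P Q (dir1 (lf p) ts) (dir2 (lf p) ts) p.2.2 -
    \sum_(p <- tg) p.1 * ev P Q p.2.1.1 p.2.1.2 p.2.2| <= eps / 4.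
  rewrite (le_trans _ small)// -sumrB (le_trans (ler_norm_sum _ _ _))// /Ct mulr_suml.
  rewrite big_seq [leRHS]big_seq; apply: ler_sum => p ptg.
  rewrite -mulrBr normrM ler_wpM2l//.
  rewrite (le_trans (ev_lip _ wf (dir_unit D_gt0 z_norm _ _) (tgu p ptg)))// ler_wpM2l ?Hlf//.
  by rewrite mulr_ge0.
rewrite (sum_split_seq _ uG1) -ES2.
set S0 := \sum_(j <- G1) _ in HS1 *.
set X := \sum_(p <- tg) p.1 * ev P Q (dir1 _ _) _ _ in ET Hdir.
set Y := \sum_(p <- tg) _ in Hdir *.
have -> : nu^-1 * (S0 + S2) - Y = nu^-1 * ((S0 - S1) + ((S1 - T) + S2)) + (X - Y).
  by rewrite ET; field; rewrite gt_eqF.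
have -> : eps = (eps / 4 + eps / 4) + eps / 4 + eps / 4 by field.
rewrite (le_trans (ler_normD _ _))//; apply: (@le_trans _ _ (eps / 4 + eps / 4 + eps / 4)); last by rewrite lerDl ltW.
apply: lerD => //.
rewrite normrM normfV (gtr0_norm nu0) ler_pdivrMl// mulrDr.
rewrite (le_trans (ler_normD _ _))//; apply: lerD.
  rewrite (le_trans HS1)// -mulrA ler_wpM2l ?(ltW nu0)//.
by rewrite (le_trans _ small34)// (le_trans (ler_normD _ _))// lerD.
Qed.

End Assembly.

(** * Lattice points *)

Section LatticePoints.
Variable R : realType.

(** The minus sign in [sin A * sin B = (cos (A - B) - cos (A + B)) / 2] belongs to the lattice
    points whose coordinates have equal signs. *)
Definition wsign (bc : BC) (w : gint) : bool := if bc is Dir then 0 < w.1 * w.2 else false.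

(* The partial derivatives of [x, y |-> u_eig bc s (z1 + x / (pi sqrt s)) (z2 + y / (pi sqrt s))]
   have this form, by the product formulas for sines and cosines. *)
Definition usum (bc : BC) (s : nat) (z1 z2 : R) (P Q : R -> R -> R) : R :=
  4 / Num.sqrt (#|Nset bc s|%:R) * \sum_(p in Nset bc s)
    (1 / 2 * (ev P Q ((p.1 : nat)%:R / Num.sqrt s%:R) (- ((p.2 : nat)%:R / Num.sqrt s%:R))
                ((p.1 : nat)%:R * pi * z1 - (p.2 : nat)%:R * pi * z2) +
             (-1) ^+ (if bc is Dir then true else false) *
              ev P Q ((p.1 : nat)%:R / Num.sqrt s%:R) ((p.2 : nat)%:R / Num.sqrt s%:R)
                ((p.1 : nat)%:R * pi * z1 + (p.2 : nat)%:R * pi * z2))).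

Definition wave (bc : BC) (T : nat) (z1 z2 : R) P Q (w : gint) : R :=
  (-1) ^+ wsign bc w * ev P Q (w.1%:~R / Num.sqrt T%:R) (w.2%:~R / Num.sqrt T%:R)
     (2 * pi * (w.1%:~R * z1 + w.2%:~R * z2)).

(** Squares are 0 or 1 modulo 4. With even indices the phases [m * pi * z1] are [2 * pi * z1] times
    an integer, as Kronecker's theorem needs. *)
Lemma even_of_sum_squares (a b T : nat) : (a ^ 2 + b ^ 2 = 4 * T)%N ->
  a = (2 * a./2)%N /\ b = (2 * b./2)%N.
Proof.
move=> e; have ea := odd_double_half a; have eb := odd_double_half b.
move: ea eb; rewrite -!muln2; move: (a./2) (b./2) => x y.
case: (odd a); case: (odd b) => /= ea eb; split; try lia.
all: exfalso; move: e; rewrite -ea -eb; lia.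
Qed.

Lemma signed_nat_inj (x y : bool) (m n : nat) : (0 < m)%N -> (0 < n)%N ->
  (-1) ^+ x * m%:Z = (-1) ^+ y * n%:Z -> x = y /\ m = n.
Proof. by case: x; case: y; rewrite ?expr0 ?expr1 ?mul1r ?mulN1r => ? ?; split=> //; lia. Qed.

Variables (bc : BC) (T : nat).
Hypothesis T_nsq : forall m : nat, (m ^ 2)%N != T.

Let half (p : 'I_(4 * T).+1 * 'I_(4 * T).+1) : gint := ((p.1 : nat)./2%:Z, (p.2 : nat)./2%:Z).
Let flip (p : 'I_(4 * T).+1 * 'I_(4 * T).+1) (e : bool * bool) : gint :=
  ((-1) ^+ e.1 * (half p).1, (-1) ^+ e.2 * (half p).2).
Let signs := [:: (false, false); (true, false); (false, true); (true, true)].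

Let NsetP p : p \in Nset bc (4 * T) ->
  [/\ (p.1 : nat) = (2 * (p.1 : nat)./2)%N, (p.2 : nat) = (2 * (p.2 : nat)./2)%N,
      ((p.1 : nat)./2 ^ 2 + (p.2 : nat)./2 ^ 2 = T)%N, (0 < (p.1 : nat)./2)%N & (0 < (p.2 : nat)./2)%N].
Proof.
rewrite inE => /andP[_ /eqP e]; have [e1 e2] := even_of_sum_squares e.
have eT : ((p.1 : nat)./2 ^ 2 + (p.2 : nat)./2 ^ 2 = T)%N.
  by move: e; rewrite {1}e1 {1}e2; lia.
split => //; rewrite lt0n; apply/negP => /eqP h0; rewrite h0 in eT.
  by move/eqP: (T_nsq (p.2 : nat)./2); apply; exact: eT.
by move/eqP: (T_nsq (p.1 : nat)./2); apply; rewrite -[LHS]addn0; exact: eT.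
Qed.

Let S2 := [seq flip p e | p <- enum (Nset bc (4 * T)), e <- signs].

Lemma natz_inj (m n : nat) : m%:Z = n%:Z -> m = n.
Proof. by case. Qed.

Let S2_uniq : uniq S2.
Proof.
apply: allpairs_uniq => //; first exact: enum_uniq.
move=> pe pe' Hx Hy; case/allpairsP: Hx => -[u ue] [/= uN _ ->]; case/allpairsP: Hy => -[v ve] [/= vN _ ->].
rewrite !mem_enum in uN vN; have [a1 a2 _ a3 a4] := NsetP uN; have [b1 b2 _ b3 b4] := NsetP vN.
rewrite /flip /half /= => -[h1 h2].
have [h3 h4] := signed_nat_inj a3 b3 h1; have [h5 h6] := signed_nat_inj a4 b4 h2.
congr pair; last by rewrite (surjective_pairing ue) (surjective_pairing ve) h3 h5.
rewrite (surjective_pairing u) (surjective_pairing v); congr pair; apply: val_inj => /=.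
  by rewrite a1 b1 h4.
by rewrite a2 b2 h6.
Qed.

Let S2_mem w : (w \in S2) = (gnorm w == T%:Z).
Proof.
apply/allpairsP/eqP => [[[p e] /= [+ _ ->]]|nw].
  rewrite mem_enum => /NsetP[_ _ eT _ _].
  rewrite /gnorm /flip /half /= !exprMn !sqrr_sign !mul1r !expr2 -!PoszM !mulnn -PoszD.
  exact: (f_equal Posz eT).
have eT : (`|w.1| ^ 2 + `|w.2| ^ 2 = T)%N.
  by apply: natz_inj; rewrite -nw /gnorm PoszD -!mulnn !PoszM -!expr2 !abszE !real_normK ?num_real.
have w1 : (0 < `|w.1|)%N.
  by rewrite lt0n; apply/negP => /eqP h; have := T_nsq `|w.2|%N; rewrite -eT h eqxx.
have w2 : (0 < `|w.2|)%N.
  by rewrite lt0n; apply/negP => /eqP h; have := T_nsq `|w.1|%N; rewrite -eT h addn0 eqxx.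
have lt1 : (2 * `|w.1| < (4 * T).+1)%N by rewrite -eT; nia.
have lt2 : (2 * `|w.2| < (4 * T).+1)%N by rewrite -eT; nia.
exists ((Ordinal lt1, Ordinal lt2), (w.1 < 0, w.2 < 0)); split => /=.
- rewrite mem_enum inE /=; apply/andP; split; first by case: (bc) => //=; rewrite !muln_gt0 w1.
  by rewrite -eT !expnMn -mulnDr eqxx.
- by case: (w.1 < 0); case: (w.2 < 0).
- rewrite /flip /half /= !mul2n !doubleK (surjective_pairing w) /=; congr pair.
    by case: ltP => h /=; lia.
  by case: ltP => h /=; lia.
Qed.

(** [T] is not a square, so no coordinate vanishes and each index pair yields four distinct lattice
    points. Opposite points carry equal waves: the four terms are twice the bracket of [usum], which
    matches its factor [4 * (1 / 2)]. *)
Lemma usum_lattice (Lam : seq gint) z1 z2 (L : R) P Q : (0 < T)%N -> wavefun L P Q ->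
  uniq Lam -> (forall w, (w \in Lam) = (gnorm w == T%:Z)) ->
  size Lam = (4 * #|Nset bc (4 * T)|)%N /\
  usum bc (4 * T) z1 z2 P Q =
    (Num.sqrt (#|Nset bc (4 * T)|%:R))^-1 * \sum_(w <- Lam) wave bc T z1 z2 P Q w.
Proof.
move=> T0 wf uL memL.
have pL : perm_eq Lam S2 by apply: uniq_perm => // w; rewrite memL S2_mem.
split; first by rewrite (perm_size pL) size_allpairs -cardE mulnC.
rewrite /usum (perm_big _ pL) big_allpairs_dep /= big_enum [4 / _]mulrC -[LHS]mulrA.
congr (_ * _); rewrite mulr_sumr; apply: eq_bigr => p pN.
have [e1 e2 eT m0 n0] := NsetP pN.
have TR : 0 < T%:R :> R by rewrite ltr0n.
have sT : Num.sqrt T%:R != 0 :> R by rewrite gt_eqF// sqrtr_gt0.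
have s4 : Num.sqrt (4 * T)%:R = 2 * Num.sqrt T%:R :> R.
  by rewrite natrM sqrtrM// (_ : 4%:R = 2 ^+ 2) ?sqrtr_sqr ?ger0_norm// expr2 -natrM.
rewrite s4 e1 e2 !natrM.
move: m0 n0; rewrite !big_cons big_nil /wave /flip /half /= !expr0 !expr1 !mul1r !mulN1r.
set m := (p.1 : nat)./2; set n := (p.2 : nat)./2 => m0 n0.
rewrite !rmorphN /= -!pmulrn.
set a := m%:R / Num.sqrt T%:R; set b := n%:R / Num.sqrt T%:R.
have -> : 2 * m%:R / (2 * Num.sqrt T%:R) = a by rewrite /a; field.
have -> : 2 * n%:R / (2 * Num.sqrt T%:R) = b by rewrite /b; field.
rewrite !mulNr -/a -/b.
set al : R := 2 * m%:R * pi * z1; set be : R := 2 * n%:R * pi * z2.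
have -> : 2 * pi * (m%:R * z1 + n%:R * z2) = al + be by rewrite /al /be; ring.
have -> : 2 * pi * (- (m%:R * z1) + n%:R * z2) = - (al - be) by rewrite /al /be; ring.
have -> : 2 * pi * (m%:R * z1 - n%:R * z2) = al - be by rewrite /al /be; ring.
have -> : 2 * pi * (- (m%:R * z1) - n%:R * z2) = - (al + be) by rewrite /al /be; ring.
have flipE x y e : ev P Q (- x) (- y) (- e) = ev P Q x y e.
  by rewrite /ev (wf_even wf) (wf_odd wf) cosN sinN mulrNN.
have -> : ev P Q (- a) b (- (al - be)) = ev P Q a (- b) (al - be) by rewrite -[b]opprK flipE opprK.
rewrite flipE.
have mn : 0 < m%:Z * n%:Z by rewrite mulr_gt0.
have -> : wsign bc (m%:Z, n%:Z) = (if bc is Dir then true else false).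
  by rewrite /wsign /= mn; case: (bc).
have -> : wsign bc (- m%:Z, - n%:Z) = (if bc is Dir then true else false).
  by rewrite /wsign /= mulrNN mn; case: (bc).
have -> : wsign bc (- m%:Z, n%:Z) = false.
  by rewrite /wsign /= mulNr oppr_gt0 ltNge ltW//; case: (bc).
have -> : wsign bc (m%:Z, - n%:Z) = false.
  by rewrite /wsign /= mulrN oppr_gt0 ltNge ltW//; case: (bc).
rewrite expr0; move: (ev P Q a b _) (ev P Q a (- b) _) => x y.
by case: (bc); rewrite /= ?expr1 ?expr0; field.
Qed.

End LatticePoints.

(** * Independence of the frequencies *)

Section Frequencies.
Variables (p : nat) (q : gint).
Hypotheses (p_prime : prime p) (p_gt2 : (2 < p)%N) (q_norm : gnorm q = p%:Z).

Definition gpow (a j : nat) : gint := q ^+ j * gconj q ^+ (a - j).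

Lemma gpow_conj a j : (j <= a)%N -> gpow a (a - j) = gconj (gpow a j).
Proof. by move=> ja; rewrite /gpow gconjM !gconjX gconjK subKn// mulrC. Qed.

Lemma gnorm_gpow a j : (j <= a)%N -> gnorm (gpow a j) = p%:Z ^+ a.
Proof. by move=> ja; rewrite gnormM !gnormX gnorm_conj q_norm -exprD subnKC. Qed.

(** Twice the real part of [(c - i d) V_j] is a Gaussian combination of [V_j] and its conjugate
    [V_(a - j)]. With [a = 2 * h + 1] this fills all indices without a middle term, and the
    coefficients have norm at most [2 * C ^ 2 < p], as [gprime_indep] requires. *)
Lemma gpow_indep (h C : nat) (c d : nat -> int) : (2 * C ^ 2 < p)%N ->
  (forall j, (`|c j| <= C)%N) -> (forall j, (`|d j| <= C)%N) ->
  \sum_(0 <= j < h.+1) (c j * (gpow (h + h.+1) j).1 + d j * (gpow (h + h.+1) j).2) = 0 ->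
  forall j, (j <= h)%N -> c j = 0 /\ d j = 0.
Proof.
move=> Cp cC dC S0; set a := (h + h.+1)%N in S0 *.
pose g j : gint := if (j <= h)%N then (c j, - d j) else (c (a - j)%N, d (a - j)%N).
have bound (x y : int) : (`|x| <= C)%N -> (`|y| <= C)%N -> x ^+ 2 + y ^+ 2 < p%:Z.
  move=> hx hy; apply: le_lt_trans (_ : (2 * C ^ 2)%:Z < _); last by rewrite ltz_nat.
  rewrite mul2n -addnn PoszD -[x ^+ 2]gez0_abs ?sqr_ge0// -[y ^+ 2]gez0_abs ?sqr_ge0// !abszX.
  by rewrite lerD// lez_nat leq_sqr.
have gp j : (j <= a)%N -> gnorm (g j) < p%:Z.
  by move=> _; rewrite /g /gnorm; case: ifP => _ /=; rewrite ?sqrrN; apply: bound.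
have gs : \sum_(0 <= j < a.+1) g j * q ^+ j * gconj q ^+ (a - j) = 0.
  have G j : g j * q ^+ j * gconj q ^+ (a - j) = g j * gpow a j by rewrite mulrA.
  under eq_bigr do rewrite G.
  rewrite (@big_cat_nat _ _ _ h.+1)//=; last by rewrite /a; lia.
  have -> : \sum_(h.+1 <= j < a.+1) g j * gpow a j = \sum_(0 <= j < h.+1) g (a - j)%N * gpow a (a - j).
    rewrite -{1}(add0n h.+1) big_addn big_nat_rev /=.
    have -> : (a.+1 - h.+1 = h.+1)%N by rewrite /a; lia.
    rewrite !big_nat; apply: eq_bigr => j /andP[_ jh].
    by have -> : (0 + h.+1 - j.+1 + h.+1 = a - j)%N by rewrite /a; lia.
  rewrite -big_split /= big_nat.
  under eq_bigr => j /andP[_ jh].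
    have -> : g j * gpow a j + g (a - j)%N * gpow a (a - j) =
        gofint (2 * (c j * (gpow a j).1 + d j * (gpow a j).2)).
      have ja : (j <= a)%N by rewrite /a; lia.
      have njh : (a - j <= h)%N = false by rewrite /a; lia.
      rewrite gpow_conj// /g njh -ltnS jh subKn// !gmulE /gconj /gofint /=.
      by congr pair => /=; ring.
    over.
  rewrite -big_nat.
  have -> : \sum_(0 <= j < h.+1) gofint (2 * (c j * (gpow a j).1 + d j * (gpow a j).2)) =
     gofint (\sum_(0 <= j < h.+1) 2 * (c j * (gpow a j).1 + d j * (gpow a j).2)).
    by elim/big_rec2: _ => // j x y _ ->; rewrite /gofint; congr pair => //=; rewrite addr0.
  by rewrite -mulr_sumr S0 mulr0.
move=> j jh; have ja : (j <= a)%N by rewrite /a; lia.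
have := gprime_indep p_prime p_gt2 q_norm gp gs ja; rewrite /g jh => e.
have e1 : c j = 0 := f_equal fst e; have e2 : - d j = 0 := f_equal snd e.
by split => //; apply/eqP; rewrite -oppr_eq0 e2.
Qed.

End Frequencies.

(** * Realisation by a rescaled eigenfunction *)

Section Realization.
Variable R : realType.

Definition circle_points (D : nat) : seq gint :=
  undup [seq w <- [seq ((x%:Z - D%:Z, y%:Z - D%:Z) : gint) | x <- iota 0 (2 * D).+1, y <- iota 0 (2 * D).+1]
    | gnorm w == (D ^ 2)%:Z].

Lemma mem_circle_points D w : (w \in circle_points D) = (gnorm w == (D ^ 2)%:Z).
Proof.
rewrite mem_undup mem_filter andb_idr// => /eqP nw.
have le (x y : int) : x ^+ 2 + y ^+ 2 = (D ^ 2)%:Z -> (`|x| <= D)%N.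
  move=> e; rewrite -leq_sqr -lez_nat -e -abszX gez0_abs ?sqr_ge0// lerDl sqr_ge0 //.
have l1 : (`|w.1| <= D)%N by apply: (le _ w.2).
have l2 : (`|w.2| <= D)%N by apply: (le _ w.1); rewrite addrC.
apply/allpairsP; exists (`|(w.1 + D%:Z)%R|%N, `|(w.2 + D%:Z)%R|%N) => /=.
rewrite -[_ :: _]/(iota 0 (2 * D).+1) !mem_iota; split; [lia | lia |].
case: w nw l1 l2 => x y /= nw l1 l2; apply: (@f_equal2 int int (int * int) pair); lia.
Qed.

(** An odd [D ^ 2] forces coordinates of opposite parity; this is what makes a half-period shift
    flip the sign of a block. *)
Lemma sum_squares_odd (D : nat) (x y : int) : odd D -> x ^+ 2 + y ^+ 2 = (D ^ 2)%:Z ->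
  exists m : int, x - y = 2 * m + 1.
Proof.
move=> oD e; exists ((x - y) %/ 2)%Z.
have := divz_eq (x - y) 2; have : (0 <= (x - y) %% 2)%Z by apply: modz_ge0.
have : ((x - y) %% 2 < 2)%Z by apply: ltz_pmod.
set d := ((x - y) %/ 2)%Z; set r := ((x - y) %% 2)%Z => r2 r0 E.
have [r1|rn] := eqVneq r 1; first by rewrite E r1 mulrC.
have rz : r = 0 by lia.
exfalso; have : (2 %| D ^ 2)%N; last by rewrite dvdn2 oddX oD.
have -> : (2 %| D ^ 2)%N = (2%:Z %| (D ^ 2)%:Z)%Z by rewrite dvdzE.
rewrite -e; have -> : x ^+ 2 + y ^+ 2 = (2 * d ^+ 2 + x * y) * 2.
  have -> : x = y + 2 * d by move: E; rewrite rz; lia.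
  by ring.
exact: dvdz_mull.
Qed.

Lemma wsignN bc w : wsign bc (- w) = wsign bc w.
Proof. by case: bc => //=; rewrite mulrNN. Qed.

Lemma not_square (D p h : nat) : prime p -> (0 < D)%N -> (D < p)%N ->
  forall m : nat, (m ^ 2)%N != (D ^ 2 * p ^ (h + h.+1))%N.
Proof.
move=> pp D0 Dp m; apply/eqP => e.
have nD : logn p D = 0%N by apply/eqP; rewrite -leqn0 leqNgt logn_gt0 mem_primes pp D0 gtnNdvd.
have := f_equal (logn p) e; rewrite lognX lognM ?expn_gt0 ?D0 ?prime_gt0// !lognX nD (logn_prime p pp) eqxx.
lia.
Qed.

Lemma ev_shift (P Q : R -> R -> R) x y e (n : int) : ev P Q x y (e + 2 * pi * n%:~R) = ev P Q x y e.
Proof. by rewrite /ev cosDz sinDz. Qed.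

Lemma open_interval (t tau : R) : 0 <= t <= 1 -> 0 < tau ->
  exists a b, [/\ 0 <= a, a < b, b <= 1 & forall x, a < x -> x < b -> `|x - t| < tau].
Proof.
move=> /andP[t0 t1] tau0; exists (Num.max 0 (t - tau)), (Num.min 1 (t + tau)); split.
- by rewrite le_max lexx.
- by rewrite gt_max !lt_min ltr01 /=; apply/and3P; split; try apply/andP; try split; lra.
- by rewrite ge_min lexx.
- move=> x; rewrite gt_max lt_min => /andP[_ x1] /andP[_ x2].
  by rewrite ltr_norml; apply/andP; split; lra.
Qed.

(** Integral translations of [W] change the phases by multiples of [2 * pi], so a block sees only
    the errors modulo integers, amplified by coordinates of size at most [D]. *)
Lemma blk_close (I : finType) (z : I -> gint) (D : nat) (L kappa : R) P Q pt t (W W' : R * R) (N1 N2 : int) :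
  (0 < D)%N -> (forall l, gnorm (z l) = (D ^ 2)%:Z) -> wavefun L P Q -> 0 <= kappa ->
  `|W'.1 - W.1 - N1%:~R| <= 2 * kappa -> `|W'.2 - W.2 - N2%:~R| <= 2 * kappa ->
  `|blk z D P Q pt t W' - blk z D P Q pt t W| <= #|I|%:R * (16 * pi * D%:R * kappa).
Proof.
move=> D0 zn wf k0 h1 h2; have p0 := pi_gt0 R.
rewrite /blk -sumrB (le_trans (ler_norm_sum _ _ _))// -sum1_card natr_sum mulr_suml.
apply: ler_sum => l _; rewrite mul1r -mulrBr normrM normrX normrN1 expr1n mul1r.
set u := (z l).1; set v := (z l).2.
set e1 := W'.1 - _ - _ in h1; set e2 := W'.2 - _ - _ in h2.
pose d : R := 2 * pi * (u%:~R * e1 - v%:~R * e2).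
have -> : ph z l W' = (ph z l W + d) + 2 * pi * (u * N1 - v * N2)%:~R.
  by rewrite /ph /d /e1 /e2 rmorphB !rmorphM /= -/u -/v; ring.
rewrite ev_shift (le_trans (ev_phase _ _ wf (dir_unit D0 zn l t)))//.
have -> : ph z l W + d - ph z l W = d by ring.
have -> : 16 * pi * D%:R * kappa = 2 * (2 * pi * (D%:R * (2 * kappa) + D%:R * (2 * kappa))) by ring.
rewrite ler_wpM2l// normrM gtr0_norm ?mulr_gt0// ler_wpM2l ?mulr_ge0 ?(ltW p0)//.
rewrite (le_trans (ler_normB _ _))// !normrM.
by apply: lerD; apply: ler_pM; rewrite ?(z_le1 R zn) ?(z_le2 R zn).
Qed.

Lemma approx_add (x y b c k : R) (m n : int) : `|x - b - m%:~R| <= k -> `|y - c - n%:~R| <= k ->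
  exists N : int, `|(x + y) - (b + c) - N%:~R| <= 2 * k.
Proof.
move=> h1 h2; exists (m + n); rewrite rmorphD /=.
have -> : x + y - (b + c) - (m%:~R + n%:~R) = (x - b - m%:~R) + (y - c - n%:~R) by ring.
by rewrite (le_trans (ler_normD _ _))// mulr_natl mulr2n lerD.
Qed.

Lemma approx_opp (x b k : R) (m : int) : `|x - b - m%:~R| <= k ->
  `|- x - - b - (- m)%:~R| <= k.
Proof. by rewrite rmorphN /= -!opprD normrN. Qed.

Lemma ltn_sum3 (a b c n : nat) : (a + b + c < n)%N -> [/\ (a < n)%N, (b < n)%N & (c < n)%N].
Proof. by split; lia. Qed.

Lemma half_complement (h j : nat) : (h < j)%N -> (h + h.+1 - j <= h)%N.
Proof. lia. Qed.

Lemma PoszX (p a : nat) : (p ^ a)%:Z = p%:Z ^+ a.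
Proof. by elim: a => // a IH; rewrite expnS exprS PoszM IH. Qed.

Lemma close_combine (nu S1 S2 S3 e : R) : 0 < nu -> `|S1 - S2| <= e / 2 * nu ->
  `|nu^-1 * S2 - S3| <= e / 2 -> `|nu^-1 * S1 - S3| <= e.
Proof.
move=> nu0 H1 H2.
have -> : nu^-1 * S1 - S3 = nu^-1 * (S1 - S2) + (nu^-1 * S2 - S3) by ring.
have -> : e = e / 2 + e / 2 by field.
rewrite (le_trans (ler_normD _ _))// lerD// normrM normfV (gtr0_norm nu0).
by rewrite mulrC ler_pdivrMr.
Qed.

Theorem realize_waves (bc : BC) (L eps : R) (tg : seq (R * (R * R * R))) :
  0 <= L -> 0 < eps ->
  (forall p, p \in tg -> p.2.1.1 ^+ 2 + p.2.1.2 ^+ 2 = 1) ->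
  exists s, is_eig bc s /\ (0 < s)%N /\ exists a1 b1 a2 b2 : R,
    [/\ 0 <= a1, a1 < b1 & b1 <= 1] /\ [/\ 0 <= a2, a2 < b2 & b2 <= 1] /\
    forall z1 z2, a1 < z1 -> z1 < b1 -> a2 < z2 -> z2 < b2 ->
    forall P Q, wavefun L P Q ->
      `|usum bc s z1 z2 P Q - \sum_(p <- tg) p.1 * ev P Q p.2.1.1 p.2.1.2 p.2.2| <= eps.
Proof.
move=> L0 eps0 tgu.
have e20 : 0 < eps / 2 by rewrite divr_gt0.
set Ct := \sum_(p <- tg) `|p.1|.
have Ct0 : 0 <= Ct by apply: sumr_ge0.
have c0 : 0 < 2 * L * Ct + 1 by rewrite ltr_wpDl// !mulr_ge0.
pose delta : R := eps / 8 / (2 * L * Ct + 1).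
have delta0 : 0 < delta by rewrite !divr_gt0.
have small : Ct * (2 * L * delta) <= eps / 2 / 4.
  have -> : Ct * (2 * L * delta) = (2 * L * Ct) / (2 * L * Ct + 1) * (eps / 8).
    by rewrite /delta; field; rewrite gt_eqF.
  have -> : eps / 2 / 4 = 1 * (eps / 8) by field.
  by rewrite ler_wpM2r ?divr_ge0 ?(ltW eps0)// ler_pdivrMr// mul1r lerDl.
have d40 : 0 < delta / 4 by rewrite divr_gt0.
have [D [Dodd dens]] := dense_lattice_circle d40.
have D0 : (0 < D)%N by apply: odd_gt0.
have DR : 0 < D%:R :> R by rewrite ltr0n.
pose I : finType := seq_sub (circle_points D).
pose z (l : I) : gint := ssval l.
have z_norm l : gnorm (z l) = (D ^ 2)%:Z by apply/eqP; rewrite -mem_circle_points; exact: ssvalP.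
have z_inj : injective z by exact: val_inj.
have z_surj w : gnorm w = (D ^ 2)%:Z -> exists l, z l = w.
  by move=> /eqP; rewrite -mem_circle_points => wD; exists (SeqSub wD).
have /choice[ng z_ng] : forall l, exists l', z l' = - z l.
  by move=> l; apply: z_surj; rewrite -(z_norm l) /gnorm /= !sqrrN.
have z_odd l : exists m : int, (z l).1 - (z l).2 = 2 * m + 1.
  by apply: (sum_squares_odd Dodd); exact: z_norm.
have densr t X Y : X ^+ 2 + Y ^+ 2 = 1 -> exists l, `|dir1 z D l t - X| + `|dir2 z D l t - Y| <= delta.
  move=> XY; set c := cos t; set s := sin t.
  have cs : c ^+ 2 + s ^+ 2 = 1 := cos2Dsin2 t.
  have cir : (X * c + Y * s) ^+ 2 + (- X * s + Y * c) ^+ 2 = 1.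
    have -> : (X * c + Y * s) ^+ 2 + (- X * s + Y * c) ^+ 2 = (X ^+ 2 + Y ^+ 2) * (c ^+ 2 + s ^+ 2) by ring.
    by rewrite cs XY mulr1.
  have [w [nw [H1 H2]]] := dens _ _ cir.
  have [l zl] := z_surj w nw; exists l; rewrite /dir1 /dir2 zl -/c -/s.
  set A := w.1%:~R / D%:R - _ in H1; set B := w.2%:~R / D%:R - _ in H2.
  have Xe : X = (X * c + Y * s) * c - (- X * s + Y * c) * s.
    by rewrite -[LHS]mulr1 -cs; ring.
  have Ye : Y = (X * c + Y * s) * s + (- X * s + Y * c) * c.
    by rewrite -[LHS]mulr1 -cs; ring.
  have -> : (w.1%:~R * c - w.2%:~R * s) / D%:R - X = A * c + B * - s.
    by rewrite [in LHS]Xe /A /B; ring.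
  have -> : (w.1%:~R * s + w.2%:~R * c) / D%:R - Y = A * s + B * c.
    by rewrite [in LHS]Ye /A /B; ring.
  have K (x y : R) : `|x| <= 1 -> `|y| <= 1 -> `|A * x + B * y| <= delta / 2.
    move=> x1 y1; rewrite (le_trans (ler_normD _ _))// !normrM.
    have -> : delta / 2 = delta / 4 * 1 + delta / 4 * 1 by field.
    by apply: lerD; apply: ler_pM.
  have -> : delta = delta / 2 + delta / 2 by field.
  by apply: lerD; apply: K; rewrite ?normrN ?cos_max ?sin_max.
have [n0 Hn0] := approx_blocks D0 z_norm z_inj z_ng z_odd L0 e20 tgu densr small.
(* There will be [a + 1 = 2 * (h + 1)] blocks, in conjugate pairs, at least the [n0] that
   [approx_blocks] demands. *)
pose h := n0; pose a := (h + h.+1)%N.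
have na : (n0 <= a.+1)%N by rewrite /a /h leqW// leq_addr.
have p0 := pi_gt0 R.
have I0 : (0 < #|I|)%N.
  by have [|l _] := densr 0 1 0; [rewrite expr1n expr0n /= addr0 | apply/card_gt0P; exists l].
have nu0 : 0 < Num.sqrt (#|I|%:R * a.+1%:R / 4) :> R by rewrite sqrtr_gt0 divr_gt0// mulr_gt0 ?ltr0n.
pose Kq : R := a.+1%:R * (#|I|%:R * (16 * pi * D%:R)).
have Kq0 : 0 <= Kq by rewrite !mulr_ge0// ltW.
have Kq1 : 0 < Kq + 1 by rewrite ltr_wpDl.
pose kappa : R := eps / 2 * Num.sqrt (#|I|%:R * a.+1%:R / 4) / (Kq + 1).
have kappa0 : 0 < kappa by rewrite divr_gt0// mulr_gt0.
have Kkap : Kq * kappa <= eps / 2 * Num.sqrt (#|I|%:R * a.+1%:R / 4).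
  rewrite /kappa mulrCA -[leRHS]mulr1 (ler_wpM2l (mulr_ge0 (ltW e20) (ltW nu0)))//.
  by rewrite ler_pdivrMr// mul1r lerDl.
have [C HC] := kronecker (h.+1 + h.+1) kappa0.
(* [2 * C ^ 2 < p] is for [gpow_indep]; [D < p] makes the norm [D ^ 2] prime to [p], so that lattice
   points factor uniquely; [2 < p] keeps 2 invertible modulo [q]. *)
have [p [q [pp pB nq]]] := gprime_exists (2 * C ^ 2 + D + 2).
have [pC pD p2] := ltn_sum3 pB.
pose T := (D ^ 2 * p ^ a)%N.
have Tnsq : forall m : nat, (m ^ 2)%N != T by apply: not_square.
have T0 : (0 < T)%N by rewrite muln_gt0 !expn_gt0 D0 prime_gt0.
pose V (j : nat) : gint := gpow q a j.
have nV j : (j <= a)%N -> gnorm (V j) = (p ^ a)%:Z.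
  by move=> ja; rewrite (gnorm_gpow nq ja) PoszX.
have TZ : T%:Z = (D ^ 2)%:Z * p%:Z ^+ a by rewrite /T PoszM (PoszX p a).
pose rV : R := Num.sqrt (p ^ a)%:R.
have pa0 : 0 < (p ^ a)%:R :> R by rewrite ltr0n expn_gt0 prime_gt0.
have rV0 : 0 < rV by rewrite sqrtr_gt0.
have sT : Num.sqrt T%:R = D%:R * rV :> R.
  rewrite /T natrM [in LHS]natrX sqrtrM ?exprn_ge0// sqrtr_sqr. by rewrite gtr0_norm.
have /choice[th Hth] : forall j : 'I_a.+1, exists t : R, [/\ 0 <= t <= 2 * pi,
    (V j).1%:~R = rV * cos t & (V j).2%:~R = rV * sin t].
  move=> j; have ja : (j <= a)%N by rewrite -ltnS.
  have [|t [t0 t2 ct st]] := @angle_exists R ((V j).1%:~R / rV) ((V j).2%:~R / rV).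
    rewrite !expr_div_n -mulrDl sqr_sqrtr ?(ltW pa0)//.
    have := f_equal (fun n : int => n%:~R : R) (nV j ja).
    rewrite /gnorm rmorphD /= !rmorphXn /= => ->.
    by rewrite divff// -natrX gt_eqF.
  exists t; split; first by rewrite t0.
    by rewrite ct mulrC divfK// gt_eqF.
  by rewrite st mulrC divfK// gt_eqF.
pose pt (j : 'I_a.+1) : {ffun I -> bool} := [ffun l => wsign bc (z l * V j)].
have thr j : 0 <= th j <= 2 * pi by case: (Hth j).
have ptng j l : pt j (ng l) = pt j l by rewrite !ffunE z_ng mulNr wsignN.
have [W HW] := Hn0 _ na th pt thr ptng.
pose Lam : seq gint := [seq z l * V j | l : I <- enum I, j : 'I_a.+1 <- enum 'I_a.+1].
have ndvd l : ~~ (p %| `|gnorm (z l)|)%N.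
  by rewrite z_norm absz_nat Euclid_dvdX// negb_and gtnNdvd.
have uL : uniq Lam.
  apply: allpairs_uniq; [exact: enum_uniq | exact: enum_uniq |].
  move=> x y Hx Hy /= e; move: e.
  case: x Hx => l j _; case: y Hy => l' j' _ /= e.
  have ja : (j <= a)%N by rewrite -ltnS.
  have j'a : (j' <= a)%N by rewrite -ltnS.
  have [e1 e2] := gprime_reps_uniq pp p2 nq (ndvd l) (ndvd l') ja j'a e.
  by rewrite (z_inj _ _ e1) (val_inj e2).
have memL w : (w \in Lam) = (gnorm w == T%:Z).
  apply/allpairsP/eqP => [[[l j] /= [_ _ ->]]|nw].
    have ja : (j <= a)%N by rewrite -ltnS.
    rewrite gnormM z_norm (nV j ja) TZ (PoszX p a); reflexivity.
  rewrite TZ in nw; have [w' [j [ja ew nw']]] := gprime_reps pp nq nw.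
  have [l zl] := z_surj w' nw'.
  have jn : (j < a.+1)%N by [].
  by exists (l, Ordinal jn); rewrite /= !mem_enum zl.
exists (4 * T)%N.
have [l0 _] : exists l : I, true by move/card_gt0P: I0 => [l _]; exists l.
split.
  pose w := z l0 * V 0%N.
  have nw : gnorm w = T%:Z.
    rewrite gnormM z_norm (nV _ (leq0n a)) TZ (PoszX p a); reflexivity.
  have eT : (`|w.1| ^ 2 + `|w.2| ^ 2 = T)%N.
    by apply: natz_inj; rewrite -nw /gnorm PoszD -!mulnn !PoszM -!expr2 !abszE !real_normK ?num_real.
  exists (2 * `|w.1|)%N, (2 * `|w.2|)%N; split; last by rewrite -eT !expnMn mulnDr.
  case: (bc) => //=; rewrite !muln_gt0 /= !lt0n; apply/andP; split; apply/negP => /eqP h0; rewrite h0 in eT.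
    by move/eqP: (Tnsq `|w.2|%N); apply; rewrite -eT.
  by move/eqP: (Tnsq `|w.1|%N); apply; rewrite -eT addn0.
split; first by rewrite muln_gt0.
(* Real parts, then imaginary parts, of the [V i] with [i <= h]; the other half are their
   conjugates. *)
pose f (i : 'I_(h.+1 + h.+1)) : int := if (i < h.+1)%N then (V i).1 else (V (i - h.+1)%N).2.
have f_indep (c : 'I_(h.+1 + h.+1) -> int) : (forall i, (`|c i| <= C)%N) ->
    \sum_i c i * f i = 0 -> forall i, c i = 0.
  move=> cC; rewrite big_split_ord /= => S0.
  have H := @gpow_indep p q pp p2 nq h C (fun j => c (lshift _ (inord j))) (fun j => c (rshift _ (inord j)))
    pC (fun j => cC _) (fun j => cC _).
  have {}H : forall j, (j <= h)%N -> c (lshift h.+1 (inord j)) = 0 /\ c (rshift h.+1 (inord j)) = 0.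
    apply: H; rewrite big_mkord -[RHS]S0 -[RHS]big_split /=; apply: eq_bigr => i _.
    rewrite inord_val /f /= ltn_ord ltnNge leq_addr /= addKn //.
  move=> i; have [j ->|j ->] := split_ordP i.
    by have [+ _] := H j (ltn_ord j : (j <= h)%N); rewrite inord_val.
  by have [_ +] := H j (ltn_ord j : (j <= h)%N); rewrite inord_val.
pose W' (j : nat) : R * R := W (inord j).
(* With [V i = x + i y], prescribing the blocks [i] and [a - i] means prescribing [x * z1 + y * z2],
   [x * z1 - y * z2], [y * z1 - x * z2] and [- y * z1 - x * z2]. Half sums and half differences
   isolate the four products: those with [z1] give [be1], those with [z2] give [be2], and the two
   coordinates decouple. *)
pose be1 (i : 'I_(h.+1 + h.+1)) : R := if (i < h.+1)%N then ((W' i).1 + (W' (a - i)%N).1) / 2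
  else ((W' (i - h.+1)%N).2 - (W' (a - (i - h.+1))%N).2) / 2.
pose be2 (i : 'I_(h.+1 + h.+1)) : R := if (i < h.+1)%N then - ((W' i).2 + (W' (a - i)%N).2) / 2
  else ((W' (i - h.+1)%N).1 - (W' (a - (i - h.+1))%N).1) / 2.
have [t1 [t1in [tau1 tau10 Ht1]]] := HC f f_indep be1.
have [t2 [t2in [tau2 tau20 Ht2]]] := HC f f_indep be2.
have [a1 [b1 [a10 ab1 b11 Hab1]]] := open_interval t1in tau10.
have [a2 [b2 [a20 ab2 b21 Hab2]]] := open_interval t2in tau20.
exists a1, b1, a2, b2; do 2 (split; first by split).
move=> z1 z2 az1 bz1 az2 bz2 P Q wf.
have K1 := Ht1 z1 (Hab1 z1 az1 bz1); have K2 := Ht2 z2 (Hab2 z2 az2 bz2).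
(* The product of [V j] with [z1 - i z2], so that [ph z l (Wz j)] is the phase at [(z1, z2)] of the
   lattice point [z l * V j]. *)
pose Wz (j : nat) : R * R := ((V j).1%:~R * z1 + (V j).2%:~R * z2, (V j).2%:~R * z1 - (V j).1%:~R * z2).
have Wclose (j : 'I_a.+1) : (exists N1 : int, `|(Wz j).1 - (W j).1 - N1%:~R| <= 2 * kappa) /\
    (exists N2 : int, `|(Wz j).2 - (W j).2 - N2%:~R| <= 2 * kappa).
  have W'j : W j = W' j by rewrite /W' inord_val.
  have G (i : nat) : (i <= h)%N ->
    [/\ exists N : int, `|(V i).1%:~R * z1 - ((W' i).1 + (W' (a - i)%N).1) / 2 - N%:~R| <= kappa,
        exists N : int, `|(V i).2%:~R * z1 - ((W' i).2 - (W' (a - i)%N).2) / 2 - N%:~R| <= kappa,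
        exists N : int, `|(V i).1%:~R * z2 - - ((W' i).2 + (W' (a - i)%N).2) / 2 - N%:~R| <= kappa &
        exists N : int, `|(V i).2%:~R * z2 - ((W' i).1 - (W' (a - i)%N).1) / 2 - N%:~R| <= kappa].
    move=> ih; have ih1 : (i < h.+1)%N by [].
    have A1 := K1 (lshift h.+1 (Ordinal ih1)); have A2 := K2 (lshift h.+1 (Ordinal ih1)).
    have B1 := K1 (rshift h.+1 (Ordinal ih1)); have B2 := K2 (rshift h.+1 (Ordinal ih1)).
    have F : (h.+1 + i < h.+1)%N = false by rewrite ltnNge leq_addr.
    rewrite /f /be1 /be2 /= ih1 in A1 A2; rewrite /f /be1 /be2 /= F addKn in B1 B2.
    by split.
  have eqle (x y : R) : x = y -> `|y| <= 2 * kappa -> `|x| <= 2 * kappa by move=> ->.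
  rewrite W'j; have ja : (j <= a)%N by rewrite -ltnS.
  have [jh|hj] := leqP j h.
    have [[n1 H1] [n2 H2] [n3 H3] [n4 H4]] := G j jh.
    split; [have [N HN] := approx_add H1 H4 | have [N HN] := approx_add H2 (approx_opp H3)];
      exists N; apply: eqle HN;
      rewrite /Wz /=; move: (W' j) (W' (a - j)%N) => u v; by field.
  have ih : (a - j <= h)%N by exact: half_complement hj.
  have [[n1 H1] [n2 H2] [n3 H3] [n4 H4]] := G _ ih.
  have Vj : V j = gconj (V (a - j)%N) by rewrite /V -gpow_conj ?leq_subr// subKn.
  have V1 : (V j).1 = (V (a - j)%N).1 by rewrite Vj.
  have V2 : (V j).2 = - (V (a - j)%N).2 by rewrite Vj.
  rewrite subKn// in H1 H2 H3 H4.
  split; [have [N HN] := approx_add H1 (approx_opp H4) | have [N HN] := approx_add (approx_opp H2) (approx_opp H3)];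
    exists N; apply: eqle HN;
    rewrite /Wz V1 V2 rmorphN /=; move: (W' j) (W' (a - j)%N) => u v; by field.
have waveE (l : I) (j : 'I_a.+1) : wave bc T z1 z2 P Q (z l * V j) =
    (-1) ^+ pt j l * ev P Q (dir1 z D l (th j)) (dir2 z D l (th j)) (ph z l (Wz j)).
  have [_ c1 c2] := Hth j; rewrite /wave ffunE sT gmulE /= !rmorphB !rmorphD /= !rmorphM /= c1 c2.
  congr (_ * ev P Q _ _ _).
  - by rewrite /dir1; field; rewrite !gt_eqF.
  - by rewrite /dir2; field; rewrite !gt_eqF.
  - by rewrite /ph /Wz /= c1 c2; ring.
have [szL ->] := usum_lattice bc Tnsq z1 z2 T0 wf uL memL.
have N4 : #|Nset bc (4 * T)|%:R = #|I|%:R * a.+1%:R / 4 :> R.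
  move: szL; rewrite size_allpairs -!cardE card_ord => szL.
  by rewrite -natrM szL natrM mulrAC divff ?mul1r.
have -> : \sum_(w <- Lam) wave bc T z1 z2 P Q w = \sum_j blk z D P Q (pt j) (th j) (Wz j).
  rewrite big_allpairs_dep exchange_big /= big_enum; apply: eq_bigr => j _.
  rewrite big_enum; apply: eq_bigr => l _; exact: waveE.
have Bclose : `|\sum_j blk z D P Q (pt j) (th j) (Wz j) - \sum_j blk z D P Q (pt j) (th j) (W j)| <=
    eps / 2 * Num.sqrt (#|I|%:R * a.+1%:R / 4).
  apply: le_trans Kkap; rewrite -sumrB (le_trans (ler_norm_sum _ _ _))//.
  have -> : Kq * kappa = \sum_(j < a.+1) #|I|%:R * (16 * pi * D%:R * kappa).
    by rewrite sumr_const card_ord -[RHS]mulr_natl /Kq !mulrA.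
  apply: ler_sum => j _; have [[N1 H1] [N2 H2]] := Wclose j.
  exact: blk_close D0 z_norm wf (ltW kappa0) H1 H2.
rewrite N4; exact: close_combine nu0 Bclose (HW P Q wf).
Qed.

End Realization.

(** * Universality *)

Section Universality.
Variable R : realType.

Lemma Dw_pw_cons i w a b e x y : Dw (i :: w) (@pw R a b e) x y =
  (if i then a else b) * Dw w (pw a b (e + pi / 2)) x y.
Proof. by rewrite !Dw_pw big_cons -mulrA /= -natr1; congr (_ * (_ * pw _ _ _ x y)); ring. Qed.

Lemma Dw_pw_ev w (a b e x y : R) : Dw w (pw a b e) x y =
  ev (fun a b => Dw w (pw a b 0) x y) (fun a b => Dw w (pw a b (pi / 2)) x y) a b e.
Proof.
have -> : pw a b e = lin2 (cos e) (pw a b 0) (sin e) (pw a b (pi / 2)).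
  apply/funext => u; apply/funext => v; rewrite /pw /lin2 addr0 cosD cosDpihalf; ring.
by rewrite Dw_lin2; [ | exact: smooth_pw | exact: smooth_pw].
Qed.

Lemma unit_le1 (a b : R) : a ^+ 2 + b ^+ 2 = 1 -> `|a| <= 1 /\ `|b| <= 1.
Proof.
have K (u v : R) : u ^+ 2 + v ^+ 2 = 1 -> `|u| <= 1.
  by move=> uv; rewrite -(@ler_pXn2r _ 2) ?nnegrE// real_normK ?num_real// expr1n -uv lerDl sqr_ge0.
by move=> ab; split; [apply: (K _ b) | apply: (K _ a); rewrite addrC].
Qed.

Lemma lip_mul (c c' q q' d L : R) : `|c - c'| <= d -> `|q| <= 1 -> `|c'| <= 1 -> `|q - q'| <= L * d ->
  `|c * q - c' * q'| <= (L + 1) * d.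
Proof.
move=> h1 h2 h3 h4; have -> : c * q - c' * q' = c' * (q - q') + (c - c') * q by ring.
rewrite (le_trans (ler_normD _ _))// !normrM.
have -> : (L + 1) * d = 1 * (L * d) + d * 1 by ring.
by apply: lerD; apply: ler_pM.
Qed.

(* Prepending a letter exchanges [P] and [Q] up to sign and multiplies by a coordinate. *)
Lemma wavefun_Dw w (x y r : R) : `|x| <= r -> `|y| <= r ->
  wavefun (r + (size w)%:R) (fun a b => Dw w (pw a b 0) x y) (fun a b => Dw w (pw a b (pi / 2)) x y).
Proof.
move=> xr yr; elim: w => [|i w [eP oQ bP bQ lP lQ]].
  have K (a b a' b' e : R) : `|pw a b e x y - pw a' b' e x y| <= (r + 0) * (`|a - a'| + `|b - b'|).
    rewrite /pw (le_trans (cos_lip _ _))// addr0.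
    have -> : a * x + b * y + e - (a' * x + b' * y + e) = (a - a') * x + (b - b') * y by ring.
    rewrite (le_trans (ler_normD _ _))// !normrM mulrDr ![r * _]mulrC.
    by apply: lerD; rewrite ler_wpM2l.
  split=> /=; rewrite /pw.
  - by move=> a b; rewrite -[RHS]cosN; congr cos; ring.
  - move=> a b; have -> : - a * x + - b * y = - (a * x + b * y) by ring.
    by rewrite !cosDpihalf sinN.
  - by move=> a b _; exact: cos_max.
  - by move=> a b _; exact: cos_max.
  - by move=> a b a' b' _ _; exact: K.
  - by move=> a b a' b' _ _; exact: K.
have EP a b : Dw (i :: w) (pw a b 0) x y = (if i then a else b) * Dw w (pw a b (pi / 2)) x y.
  by rewrite Dw_pw_cons add0r.
have EQ a b : Dw (i :: w) (pw a b (pi / 2)) x y = (if i then a else b) * - Dw w (pw a b 0) x y.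
  rewrite Dw_pw_cons Dw_pw_ev /ev; have -> : pi / 2 + pi / 2 = pi :> R by field.
  by rewrite cospi sinpi mul0r addr0 mulN1r.
have cu (a b : R) : a ^+ 2 + b ^+ 2 = 1 -> `|if i then a else b| <= 1.
  by move=> /unit_le1[]; case: (i).
have cl (a b a' b' : R) : `|(if i then a else b) - (if i then a' else b')| <= `|a - a'| + `|b - b'|.
  by case: (i); rewrite ?lerDl ?lerDr.
have nE : r + (size (i :: w))%:R = (r + (size w)%:R) + 1 by rewrite /= -natr1 addrA.
rewrite nE; split.
- by move=> a b; rewrite !EP oQ; case: (i); rewrite mulrNN.
- by move=> a b; rewrite !EQ eP; case: (i); rewrite mulNr.
- move=> a b ab; rewrite EP normrM -[leRHS]mulr1; apply: ler_pM => //; [exact: cu | exact: bQ].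
- move=> a b ab; rewrite EQ normrM normrN -[leRHS]mulr1; apply: ler_pM => //; [exact: cu | exact: bP].
- by move=> a b a' b' ab ab'; rewrite !EP; apply: lip_mul; [exact: cl | exact: bQ | exact: cu | exact: lQ].
- move=> a b a' b' ab ab'; rewrite !EQ; apply: lip_mul; [exact: cl | | exact: cu | ].
    by rewrite normrN; exact: bP.
  by rewrite -opprD normrN; exact: lP.
Qed.

Lemma wavefun_le (L L' : R) P Q : L <= L' -> wavefun L P Q -> wavefun L' P Q.
Proof.
move=> LL [eP oQ bP bQ lP lQ]; split=> // a b a' b' h h'.
  by rewrite (le_trans (lP _ _ _ _ h h'))// ler_wpM2r// addr_ge0.
by rewrite (le_trans (lQ _ _ _ _ h h'))// ler_wpM2r// addr_ge0.
Qed.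

Lemma product_formula (bc : BC) (A B : R) :
  (if bc is Dir then sin A * sin B else cos A * cos B) =
  1 / 2 * (cos (A - B) + (-1) ^+ (if bc is Dir then true else false) * cos (A + B)).
Proof. by rewrite cosB cosD; case: bc => /=; rewrite ?expr1 ?expr0; field. Qed.

Section Rescaled.
Variables (bc : BC) (s : nat) (z1 z2 : R).
Hypothesis s_gt0 : (0 < s)%N.

Definition rescaled (x y : R) : R :=
  u_eig bc s (z1 + x / Num.sqrt (pi ^+ 2 * s%:R)) (z2 + y / Num.sqrt (pi ^+ 2 * s%:R)).

Let F (p : 'I_s.+1 * 'I_s.+1) : R -> R -> R := let m := (p.1 : nat)%:R in let n := (p.2 : nat)%:R in
  lin2 (1 / 2) (pw (m / Num.sqrt s%:R) (- (n / Num.sqrt s%:R)) (m * pi * z1 - n * pi * z2))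
    (1 / 2 * (-1) ^+ (if bc is Dir then true else false))
    (pw (m / Num.sqrt s%:R) (n / Num.sqrt s%:R) (m * pi * z1 + n * pi * z2)).

Let rescaledE : rescaled = lc (enum (Nset bc s)) (fun=> 4 / Num.sqrt (#|Nset bc s|%:R)) F.
Proof.
apply/funext => x; apply/funext => y; rewrite /rescaled /u_eig /lc mulr_sumr -big_enum /=.
apply: eq_bigr => p _; congr (_ * _); rewrite product_formula /F /lin2 /pw.
have p0 := pi_gt0 R.
have -> : Num.sqrt (pi ^+ 2 * s%:R) = pi * Num.sqrt s%:R :> R.
  by rewrite sqrtrM ?exprn_ge0 ?(ltW p0)// sqrtr_sqr gtr0_norm.
have : 0 < Num.sqrt s%:R :> R by rewrite sqrtr_gt0 ltr0n.
move: (Num.sqrt s%:R) p0 (p.1 : nat)%:R (p.2 : nat)%:R; move: (@pi R) => c q c0 m n q0.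
rewrite mulrDr mulrA; congr (_ * cos _ + _ * cos _); by field; rewrite (gt_eqF q0) (gt_eqF c0).
Qed.

Let smooth_F p : smooth (F p).
Proof. by apply: smooth_lin2; exact: smooth_pw. Qed.

Lemma smooth_rescaled : smooth rescaled.
Proof. by rewrite rescaledE; apply: smooth_lc. Qed.

Lemma Dw_rescaled w x y : Dw w rescaled x y = usum bc s z1 z2
  (fun a b => Dw w (pw a b 0) x y) (fun a b => Dw w (pw a b (pi / 2)) x y).
Proof.
rewrite rescaledE Dw_lc// /usum /lc -mulr_sumr big_enum /=; congr (_ * _).
apply: eq_bigr => p _; rewrite /F Dw_lin2; [|exact: smooth_pw|exact: smooth_pw].
by rewrite /lin2 !Dw_pw_ev [RHS]mulrDr [in RHS]mulrA.
Qed.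

End Rescaled.

Lemma Dw_pws w s (x y : R) : Dw w (pws s) x y =
  \sum_(p <- s) p.1 * ev (fun a b => Dw w (pw a b 0) x y) (fun a b => Dw w (pw a b (pi / 2)) x y) p.2.1.1 p.2.1.2 p.2.2.
Proof.
rewrite /pws Dw_lc; last by move=> p; exact: smooth_pw.
by rewrite /lc; apply: eq_bigr => p _; rewrite Dw_pw_ev.
Qed.

Lemma inball_bound (c1 c2 r x y : R) : inball c1 c2 r x y ->
  `|x| <= `|c1| + `|c2| + `|r| /\ `|y| <= `|c1| + `|c2| + `|r|.
Proof.
have K (u v : R) : u ^+ 2 + v ^+ 2 < r ^+ 2 -> `|u| <= `|r|.
  move=> uv; rewrite -(@ler_pXn2r _ 2) ?nnegrE// !real_normK ?num_real//.
  by apply: le_trans (ltW uv); rewrite lerDl sqr_ge0.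
have T (c d u : R) : `|u - c| <= `|r| -> `|u| <= `|c| + `|d| + `|r|.
  move=> h; have -> : u = c + (u - c) by ring.
  by rewrite (le_trans (ler_normD _ _))// lerD// lerDl.
move=> h; split; first by apply: T; apply: (K _ (y - c2)).
by rewrite (addrC `|c1|); apply: T; apply: (K _ (x - c1)); rewrite addrC.
Qed.

Theorem universal (bc : BC) (phi : R -> R -> R) (eps c1 c2 r : R) (k : nat) : MW phi -> 0 < eps ->
  exists s, is_eig bc s /\ exists M : set (R * R),
    M `<=` Q1 /\ measurable M /\ (0 < ((@lebesgue_measure R) \x (@lebesgue_measure R)) M)%E /\
    forall z : R * R, M z ->
      Ck_norm_lt k c1 c2 r (fun x y => rescaled bc s z.1 z.2 x y - phi x y) eps.
Proof.
move=> mphi eps0; pose rho : R := `|c1| + `|c2| + `|r|.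
have rho0 : 0 <= rho by rewrite !addr_ge0.
have e3 : 0 < eps / 3 by rewrite divr_gt0.
have [_ [tg tgu ->] Happ] := @MW_approx R phi k rho (eps / 3) mphi e3.
(* On a square of half-side [rho], the derivatives of plane waves of order at most [k] share this
   Lipschitz constant in the frequency, each letter adding 1. *)
have L0 : 0 <= rho + k%:R by rewrite addr_ge0.
have [s [es [s0 [a1 [b1 [a2 [b2 [[a10 ab1 b11] [[a20 ab2 b21] H]]]]]]]]] := realize_waves bc L0 e3 tgu.
exists s; split => //; exists (`]a1, b1[%classic `*` `]a2, b2[%classic).
have m1 : measurable (`]a1, b1[%classic : set R) by exact: measurable_itv.
have m2 : measurable (`]a2, b2[%classic : set R) by exact: measurable_itv.
split.
  move=> [u v] [/=]; rewrite !in_itv /= => /andP[u1 u2] /andP[v1 v2]; rewrite /Q1 /=.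
  by rewrite (le_lt_trans a10 u1) (lt_le_trans u2 b11) (le_lt_trans a20 v1) (lt_le_trans v2 b21).
split; first exact: measurableX.
split.
  have len (a b : R) : a < b -> lebesgue_measure (`]a, b[%classic : set R) = (b - a)%:E.
    by move=> ab; rewrite lebesgue_measure_itv /= lte_fin ab EFinB.
  have -> := product_measure1E (@lebesgue_measure R) (@lebesgue_measure R) m1 m2.
  rewrite [X in (0 < X)%E](_ : _ = ((b1 - a1)%:E * (b2 - a2)%:E)%E); last by rewrite -!len.
  by rewrite -EFinM lte_fin mulr_gt0// subr_gt0.
move=> [u v] [/=]; rewrite !in_itv /= => /andP[u1 u2] /andP[v1 v2].
(* One third for plane waves against [phi], one for the eigenfunction against plane waves; the last
   keeps the bound strictly below [eps]. *)
exists (eps / 3 + eps / 3); split; first by lra.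
move=> w wk x y /inball_bound[xr yr].
have -> : (fun x y => rescaled bc s u v x y - phi x y) = lin2 1 (rescaled bc s u v) (-1) phi.
  by apply/funext => x'; apply/funext => y'; rewrite /lin2 mul1r mulN1r.
have sphi : smooth phi by case: mphi.
rewrite (Dw_lin2 w _ _ (smooth_rescaled bc u v s0) sphi) /lin2 mul1r mulN1r Dw_rescaled//.
have wf : wavefun (rho + k%:R) (fun a b => Dw w (pw a b 0) x y) (fun a b => Dw w (pw a b (pi / 2)) x y).
  by apply: wavefun_le (wavefun_Dw w xr yr); rewrite lerD2l ler_nat.
have H1 := H u v u1 u2 v1 v2 _ _ wf; rewrite -Dw_pws in H1.
have H2 := Happ w wk x y xr yr.
move: (usum _ _ _ _ _ _) (Dw w (pws tg) x y) (Dw w phi x y) H1 H2 => A B C H1 H2.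
have -> : A - C = (A - B) + (B - C) by ring.
by rewrite (le_trans (ler_normD _ _))// lerD.
Qed.

Lemma density_one_id : @density_one R id.
Proof.
split => // ; apply: cvg_near_cst; near=> N.
have -> : count_below id N = N.
  transitivity #|[set: 'I_N]%SET|; last by rewrite cardsT card_ord.
  apply: eq_card => i; rewrite !inE; apply/asboolP => /=; apply/existsP; exists i; exact: eqxx.
by rewrite divff// pnatr_eq0 -lt0n; near: N; exact: nbhs_infty_gt.
Unshelve. all: by end_near.
Qed.

End Universality.

Unset Implicit Arguments.

Theorem theoremA1 (R : realType) (bc : BC) (sigma : nat -> nat)
  (sigma_incr : forall i j, (i < j)%N -> (sigma i < sigma j)%N)
  (sigma_eig : forall i, is_eig bc (sigma i))
  (sigma_onto : forall s, is_eig bc s -> exists i, sigma i = s) :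
  exists ns : nat -> nat, @density_one R ns /\
    forall (phi : R -> R -> R), MW phi ->
    forall (eps : R), 0 < eps ->
    forall (c1 c2 r : R), 0 < r ->
    forall k : nat,
    exists (J : nat) (M : set (R * R)),
      M `<=` Q1 /\ measurable M /\
      (0 < ((@lebesgue_measure R) \x (@lebesgue_measure R)) M)%E /\
      forall z : R * R, M z ->
        Ck_norm_lt k c1 c2 r
          (fun x y =>
             u_eig bc (sigma (ns J))
               (z.1 + x / Num.sqrt (pi ^+ 2 * (sigma (ns J))%:R))
               (z.2 + y / Num.sqrt (pi ^+ 2 * (sigma (ns J))%:R))
             - phi x y)
          eps.
Proof.
exists id; split; first exact: density_one_id.
move=> phi mphi eps eps0 c1 c2 r _ k.
have [s [es [M [MQ [mM [M0 HM]]]]]] := universal bc c1 c2 r k mphi eps0.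
have [J sJ] := sigma_onto s es.
by exists J, M; do 3 (split => //); rewrite /= sJ.
Qed.
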